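(* Assume the ABC conjecture. Let $E$ be an elliptic curve over $\mathbb{Q}$ given by a Weierstrass equation $y^2=x^3+Ax+B$ with $A,B\in\mathbb{Z}$ and with $j$-invariant $0$ or $1728$ (i.e. $A=0$ or $B=0$). Let $Q\in E(\mathbb{Q})$ be a point of infinite order and let $(d_n)_{n\ge1}$ be the elliptic denominator sequence associated to $E$ and $Q$. Then for every $\epsilon>0$, $$P(d_n)\gg_{\epsilon,E,Q} n^{3-\epsilon},$$ equivalently $\log P(d_n)\ge (3-\epsilon)\log n+O_{\epsilon,E,Q}(1)$.
   Context: ABC conjecture: for every $\epsilon>0$ there is a constant $K_\epsilon$ such that whenever $A',B',C'\in\mathbb{Z}$ are relatively prime with $A'+B'+C'=0$, one has $\max\{|A'|,|B'|,|C'|\}\le K_\epsilon\left(\prod_{\pi\mid A'B'C'}\pi\right)^{1+\epsilon}$, the product over primes. Every rational point of $E$ other than the point at infinity can be written uniquely as $(a/d^2, b/d^3)$ with $a,b,d\in\mathbb{Z}$, $d\ge1$, $\gcd(a,d)=\gcd(b,d)=1$. The elliptic denominator sequence is defined by $nQ=(a_n/d_n^2,\,b_n/d_n^3)$ in this normalized form. $P(m)$ denotes the greatest prime factor of the integer $m$ (with $P(1)=1$). *)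

(* Defs.v *)
From Stdlib Require Import Reals.
From HB Require Import structures.
From mathcomp Require Import all_boot all_order all_algebra.
Set Implicit Arguments. Unset Strict Implicit. Unset Printing Implicit Defensive.
Import Order.TTheory GRing.Theory Num.Theory.
Local Open Scope ring_scope.

(* A rational point of E : y^2 = x^3 + A x + B; None is the point at infinity. *)
Definition ec_point := option (rat * rat).

Definition on_curve (A B : int) (P : ec_point) : bool :=
  match P with
  | None => true
  | Some (x, y) => y ^+ 2 == x ^+ 3 + A%:~R * x + B%:~R
  end.

Definition ec_add (A : int) (P Q : ec_point) : ec_point :=
  match P, Q with
  | None, _ => Q
  | _, None => P
  | Some (x1, y1), Some (x2, y2) =>
      if x1 == x2 then
        if y1 + y2 == 0 then None
        else
          let l := (3%:R * x1 ^+ 2 + A%:~R) / (2%:R * y1) in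
          let x3 := l ^+ 2 - x1 - x2 in
          Some (x3, l * (x1 - x3) - y1)
      else
        let l := (y2 - y1) / (x2 - x1) in
        let x3 := l ^+ 2 - x1 - x2 in
        Some (x3, l * (x1 - x3) - y1)
  end.

Definition ec_mul (A : int) (n : nat) (P : ec_point) : ec_point :=
  iter n (ec_add A P) None.

Definition is_ell_denom (P : ec_point) (d : nat) : Prop :=
  match P with
  | None => False
  | Some (x, y) =>
      (0 < d)%N /\
      exists a b : int,
        coprimez a d /\ coprimez b d /\
        x = a%:~R / (d ^ 2)%:R /\ y = b%:~R / (d ^ 3)%:R
  end.

Definition rad (m : nat) : nat := \prod_(p <- primes m) p.

Definition ABC_conjecture : Prop :=
  forall eps : R, Rlt 0 eps ->
  exists K : R,
  forall a b c : int,
    a != 0 -> b != 0 -> c != 0 ->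
    gcdz (gcdz a b) c = 1%N -> a + b + c = 0 ->
    Rle (INR (maxn `|a| (maxn `|b| `|c|)))
        (Rmult K (Rpower (INR (rad `|a * b * c|)) (Rplus 1 eps))).

(* Main.v *)
(* Write [nQ = (a/d^2, b/d^3)] with [d = d_n].  The ABC conjecture applied to
   [b^2 = a^3 + B d^6], or to [b^2 / a = a^2 + A d^4], bounds the height of [nQ]
   by a power of [rad d]; as heights grow quadratically, [log rad d_n >> n^2].

   A prime [p] dividing [d_n] reduces [Q] to a point of order [m | n] in
   [E(F_p)], so [p | d_m] and [m] divides [#E(F_p)].  The primes with [m] below
   [n / (C tau(n))] divide some [d_m] with [log d_m << m^2], and so contribute
   at most [n^2 / C] to [log rad d_n].

   For the others, complex multiplication enters through character sums: either
   [#E(F_p) = p + 1] or [4 D #E(F_p) = w^2 + D z^2] with [D] in [{1, 3}] and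
   [z = #E(F_p) - p + 1].  An integer [N] has [O(N^e)] such representations, so
   at most [O(X^(1+e) / m)] primes [p <= X] have rank [m].  Taking [X = P(d_n)]
   gives [n^2 << n^e X^(1+e) / n]. *)
Require Import Defs.
From Stdlib Require Import Reals Lra Lia.
Set Implicit Arguments. Unset Strict Implicit. Unset Printing Implicit Defensive.

(** * Real estimates *)

(** Every [n^e] is carried by an integer [k]: counts are raised to the power [k], and the divisor
    bound is used as [tau N ^ k <= C * N]. Quadratic growth of heights comes from the parallelogram
    and duplication inequalities alone, without the canonical height.

    The norm equation for [#E(F_p)] comes from a second moment. Up to sign, the character sums of
    the curves [y^2 = x^3 + a x] take 2 values, those of [y^2 = x^3 + b] take 3, and the sum of
    their squares over the whole family is computed exactly. Unless the sum [s] of the given curve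
    vanishes, this yields [D s^2 + w^2 = 4 D p], which also replaces Hasse's bound.

    The equation is then rewritten with the number of points [N] on the right, because it is [N]
    that the rank [m] divides: [N] runs over the multiples of [m], and a representation of [4 D N]
    returns at most one prime.

    In the exponent 3, two units come from [n^2 << log rad d_n] and one from the saving [1 / m], as
    [m] is almost as large as [n]. Summing over the ranks costs a factor [tau(n)], since they all
    divide [n]. *)

Section QuadraticGrowth.
Local Open Scope R_scope.
Variables (f : nat -> R) (C : R).
Hypothesis f_ge0 : forall n, 0 <= f n.
Hypothesis f_parallelogram : forall m n, (0 < n < m)%nat ->
  f (m + n) + f (m - n) <= 2 * f m + 2 * f n + C.

(** The parallelogram inequality with [n = 1] bounds the second differences of [f] by a constant, so
    the first differences grow at most linearly. *)
Lemma quadratic_upper : exists K, forall n, (0 < n)%nat -> f n <= K * INR n ^ 2.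
Proof using f_ge0 f_parallelogram.
pose (E := 2 * f 1%nat + Rabs C + f 2%nat); exists E.
assert (C0 := Rle_abs C); assert (C1 := Rabs_pos C).
assert (f1 := f_ge0 1); assert (f2 := f_ge0 2).
assert (diff : forall k, f (S (S k)) - f (S k) <= E * INR (S k)).
  induction k as [|k IH]; [simpl; unfold E; lra|].
  assert (P := f_parallelogram (m := S (S k)) (n := 1) ltac:(lia)).
  replace (S (S k) + 1)%nat with (S (S (S k))) in P by lia.
  replace (S (S k) - 1)%nat with (S k) in P by lia.
  rewrite (S_INR (S k)); unfold E in *; nra.
intros [|n] n0; [lia|]; clear n0; induction n as [|n IH]; [simpl; unfold E; lra|].
assert (D := diff n); rewrite (S_INR (S n)); assert (0 <= INR (S n)) by apply pos_INR.
assert (0 <= E) by (unfold E; lra); nra.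
Qed.

Hypothesis f_duplication : forall m, (0 < m)%nat -> 4 * f m <= f (2 * m) + C.
Hypothesis f_unbounded : forall M, exists2 n, (0 < n)%nat & M < f n.

Lemma finite_bound m : exists2 M, 0 <= M & forall r, (r < m)%nat -> f r <= M.
Proof using f_ge0.
induction m as [|m [M M0 IH]]; [exists 0; [lra | intros; lia]|].
exists (M + f m); assert (H := f_ge0 m); [lra|].
intros r rm; destruct (Nat.eq_dec r m) as [->|]; [lra|].
assert (r < m)%nat by lia; specialize (IH r ltac:(lia)); lra.
Qed.

(* Inserting [m + n] and [m - n] in the parallelogram inequality and using the
   duplication inequality gives the reverse parallelogram inequality, so that the
   second differences along the multiples of [m0] are bounded below. *)
Lemma quadratic_lower :
  exists2 c, 0 < c & exists n0, forall n, (n0 <= n)%nat -> c * INR n ^ 2 <= f n.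
Proof using f_ge0 f_parallelogram f_duplication f_unbounded.
assert (reverse : forall m n, (0 < n < m)%nat ->
    2 * f m + 2 * f n - 3 * C / 2 <= f (m + n) + f (m - n)).
  intros m n mn.
  assert (P := f_parallelogram (m := m + n) (n := m - n) ltac:(lia)).
  replace (m + n + (m - n))%nat with (2 * m)%nat in P by lia.
  replace (m + n - (m - n))%nat with (2 * n)%nat in P by lia.
  assert (D1 := f_duplication (m := m) ltac:(lia)).
  assert (D2 := f_duplication (m := n) ltac:(lia)).
  lra.
destruct (f_unbounded (Rabs C)) as [m0 m0_gt0 fm0].
assert (C0 := Rle_abs C); assert (C1 := Rabs_pos C).
(* The reverse inequality with [n = m0] bounds the second differences along the multiples of [m0]
   below by [2 * f m0 - 3 * C / 2], hence by [2 * d]. *)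
pose (d := f m0 - 3 / 4 * Rabs C); assert (d0 : 0 < d) by (unfold d; lra).
assert (diff : forall k, f (S (S k) * m0) - f (S k * m0) >= (2 * INR (S k) + 1) * d).
  induction k as [|k IH].
    assert (D := f_duplication m0_gt0); replace (1 * m0)%nat with m0 by lia; simpl INR.
    unfold d; lra.
  assert (P := reverse (S (S k) * m0)%nat m0 ltac:(nia)).
  replace (S (S k) * m0 + m0)%nat with (S (S (S k)) * m0)%nat in P by nia.
  replace (S (S k) * m0 - m0)%nat with (S k * m0)%nat in P by nia.
  rewrite (S_INR (S k)); unfold d in *; nra.
assert (mult : forall k, f (S k * m0) >= d * INR (S k) ^ 2).
  induction k as [|k IH].
    replace (1 * m0)%nat with m0 by lia; simpl; unfold d; lra.
  assert (D := diff k); rewrite (S_INR (S k)); nra.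
destruct (finite_bound m0) as [M M0 bound].
assert (Im : 1 <= INR m0) by (change 1 with (INR 1); apply le_INR; lia).
(* Since [n <= 2 * m0 * (n / m0)], the lower bound at the multiple of [m0] below [n] is at least
   [e * n ^ 2]; half of it is given up to absorb the error [T]. *)
pose (e := d / (8 * INR m0 ^ 2)).
assert (e0 : 0 < e) by (unfold e; apply Rdiv_lt_0_compat; nra).
exists (e / 2); [lra|].
pose (T := M + Rabs C).
destruct (INR_archimed e (2 * T) e0) as [n1 Hn1].
exists (2 * m0 + n1 + 1)%nat; intros n hn.
assert (dm := Nat.div_mod_eq n m0); assert (rm := Nat.mod_upper_bound n m0 ltac:(lia)).
set (k := (n / m0)%nat) in *; set (r := (n mod m0)%nat) in *.
assert (k2 : (2 <= k)%nat) by nia.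
destruct k as [|k]; [lia|].
assert (Hk := mult k).
(* Dropping [f (n + r) >= 0] from the parallelogram inequality for [n] and [r] compares [f n] with
   half the value at the multiple [n - r] of [m0]. *)
assert (low : d * INR (S k) ^ 2 / 2 - T <= f n).
  destruct (Nat.eq_dec r 0) as [r0|r0].
    replace n with (S k * m0)%nat by lia; unfold T; nra.
  assert (P := f_parallelogram (m := n) (n := r) ltac:(nia)).
  replace (n - r)%nat with (S k * m0)%nat in P by nia.
  assert (B := bound r rm); assert (Z := f_ge0 (n + r)); unfold T; nra.
assert (kn : INR n <= 2 * INR m0 * INR (S k)).
  change 2 with (INR 2); rewrite <- !mult_INR; apply le_INR; nia.
assert (n1n : INR n1 <= INR n) by (apply le_INR; lia).
assert (n1' : 1 <= INR n) by (change 1 with (INR 1); apply le_INR; lia).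
assert (n1n2 : INR n1 <= INR n ^ 2) by nra.
assert (big : 2 * T <= e * INR n ^ 2) by nra.
assert (main : e * INR n ^ 2 <= d * INR (S k) ^ 2 / 2).
  unfold e; apply (Rmult_le_reg_r (8 * INR m0 ^ 2)); [nra|].
  replace (d / (8 * INR m0 ^ 2) * INR n ^ 2 * (8 * INR m0 ^ 2)) with (d * INR n ^ 2)
    by (field; lra).
  replace (d * INR (S k) ^ 2 / 2 * (8 * INR m0 ^ 2)) with (d * (2 * INR m0 * INR (S k)) ^ 2)
    by field.
  apply Rmult_le_compat_l; [lra|]; apply pow_incr; split; [apply pos_INR | exact kn].
nra.
Qed.
End QuadraticGrowth.

Section FinalEstimate.
Local Open Scope R_scope.

Lemma ln_le x y : 0 < x -> x <= y -> ln x <= ln y.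
Proof. intros x0 [xy| ->]; [left; now apply ln_increasing | apply Rle_refl]. Qed.

(** Here [S] stands for a number of primes at most [X]. Eliminating [ln S] leaves [k * ln (ln X)],
    and [ln X <= k * exp (ln X / k)] bounds it by [k * ln k + ln X]; this turns [k + 1] into
    [k + 2]. *)
Lemma final_estimate k c n S X Z : 1 <= k -> 0 < c -> 1 <= n -> 0 < S -> 0 < ln X ->
  c * n ^ 2 <= S * ln X ->
  k * ln S + k * ln n <= Z + ln n + (k + 1) * ln X ->
  (3 * k - 1) * ln n <= (Z + k * ln k - k * ln c) + (k + 2) * ln X.
Proof.
intros k1 c0 n1 S0 X0 main count.
assert (n2 : 0 < n ^ 2) by nra.
assert (E1 := ln_le (Rmult_lt_0_compat _ _ c0 n2) main).
rewrite !ln_mult in E1 by (try assumption; lra).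
replace (n ^ 2) with (n * n) in E1 by ring.
rewrite ln_mult in E1 by lra.
assert (E2 : ln X <= k * exp (ln X / k)).
  assert (H := exp_ineq1_le (ln X / k)).
  assert (K := Rmult_le_compat_l k _ _ ltac:(lra) H).
  replace (k * (1 + ln X / k)) with (k + ln X) in K by (field; lra). lra.
assert (E3 := ln_le X0 E2).
rewrite ln_mult, ln_exp in E3 by (try apply exp_pos; lra).
assert (E4 := Rmult_le_compat_l k _ _ ltac:(lra) E3).
replace (k * (ln k + ln X / k)) with (k * ln k + ln X) in E4 by (field; lra).
nra.
Qed.

Lemma le_square x : 1 <= x -> x <= x ^ 2.
Proof. nra. Qed.

Lemma total_combine r b m l q1 q2 c N : c * N <= r -> r <= b + (m + l) -> m <= q1 ->
  q1 <= c / 4 * N -> b <= c / 4 * N -> l <= q2 -> c / 2 * N <= q2.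
Proof. lra. Qed.

Lemma scaled_square_le K l m n : 0 < K -> 0 < l -> 0 <= m -> m * l <= n ->
  K * m ^ 2 <= K * n ^ 2 / l ^ 2.
Proof.
intros K0 l0 m0 H; assert (l2 : 0 < l ^ 2) by nra.
apply (Rmult_le_reg_r (l ^ 2)); [exact l2|].
replace (K * n ^ 2 / l ^ 2 * l ^ 2) with (K * n ^ 2) by (field; lra).
replace (K * m ^ 2 * l ^ 2) with (K * (m * l) ^ 2) by ring.
apply Rmult_le_compat_l; [lra|]; apply pow_incr; split; [nra | exact H].
Qed.

Lemma small_total_le K N c s t l : 0 < K -> 0 <= N -> 0 <= s -> s <= t -> 1 <= t -> 1 <= l ->
  4 * K <= l * c -> s * (K * N / (l * t) ^ 2) <= c / 4 * N.
Proof.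
intros K0 N0 s0 st t1 l1 H; assert (lt2 : 0 < (l * t) ^ 2) by (apply pow_lt; nra).
apply (Rmult_le_reg_r ((l * t) ^ 2)); [exact lt2|].
replace (s * (K * N / (l * t) ^ 2) * (l * t) ^ 2) with (s * K * N) by (field; lra).
replace (c / 4 * N * (l * t) ^ 2) with ((c * l / 4 * (l * (t * t))) * N) by field.
apply Rmult_le_compat_r; [exact N0|].
assert (s <= l * (t * t)) by nra.
apply Rle_trans with (K * (l * (t * t))); [nra|].
apply Rmult_le_compat_r; nra.
Qed.

(** The constant 7 makes [(k + 2) * (3 - e) <= 3 * k - 1]: the two sides differ by
    [7 - e * k - 2 * e]. *)
Lemma final_exponent k e x y Z : 1 <= k -> 0 < e -> 7 <= e * k -> 0 <= x ->
  (3 * k - 1) * x <= Z + (k + 2) * y -> (3 - e) * x - Rabs Z <= y.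
Proof.
intros k1 e0 ek x0 H; assert (Z0 := Rle_abs Z); assert (Z1 := Rabs_pos Z).
apply (Rmult_le_reg_l (k + 2)); [lra|].
assert ((k + 2) * (3 - e) * x <= (3 * k - 1) * x) by nra.
nra.
Qed.
End FinalEstimate.

From HB Require Import structures.
From mathcomp Require Import all_boot all_order all_algebra.
From mathcomp Require Import cyclic finfield.
From mathcomp Require Import ring zify.
Import Order.TTheory GRing.Theory Num.Theory.
Local Open Scope ring_scope.
Delimit Scope R_scope with coqR.
Local Notation rad := Defs.rad.

(** * The group law *)

(* An equation [x = y] that follows from [e1 : l1 = r1] and [e2 : l2 = r2] with
   multipliers [c1] and [c2] is proved by
   [apply: (eq_lc (lcD (lc0 c1 e1) (lc0 c2 e2))); ring]. *)
Section LinearCombination.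
Variable R : pzRingType.
Implicit Types x y z l r c : R.

Lemma lc0 c l r : l = r -> c * (l - r) = 0.
Proof. by move->; rewrite subrr mulr0. Qed.

Lemma lcD x y : x = 0 -> y = 0 -> x + y = 0.
Proof. by move=> -> ->; rewrite addr0. Qed.

Lemma eq_lc x y z : z = 0 -> x - y = z -> x = y.
Proof. by move=> -> /eqP; rewrite subr_eq0 => /eqP. Qed.
End LinearCombination.

Section GroupLaw.
Variables (F : fieldType) (a b : F).
Implicit Types (P Q R : option (F * F)).

Definition cubic (x : F) := x ^+ 3 + a * x + b.

Definition wcurve P : bool :=
  if P is Some (x, y) then y ^+ 2 == cubic x else true.

(** The formulas of [ec_add] over an arbitrary field: over [rat] the two are convertible, and the
    same group law serves over ['F_p]. *)
Definition wadd P Q : option (F * F) :=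
  match P, Q with
  | None, _ => Q
  | _, None => P
  | Some (x1, y1), Some (x2, y2) =>
      if x1 == x2 then
        if y1 + y2 == 0 then None
        else
          let l := (3%:R * x1 ^+ 2 + a) / (2%:R * y1) in
          let x3 := l ^+ 2 - x1 - x2 in
          Some (x3, l * (x1 - x3) - y1)
      else
        let l := (y2 - y1) / (x2 - x1) in
        let x3 := l ^+ 2 - x1 - x2 in
        Some (x3, l * (x1 - x3) - y1)
  end.

Definition wopp P : option (F * F) := if P is Some (x, y) then Some (x, - y) else None.

(* [l] is the slope of the chord, or of the tangent, at two points that are not
   opposite; the two equations determine it in both cases. *)
Definition is_slope (x1 y1 x2 y2 l : F) : Prop :=
  l * (x2 - x1) = y2 - y1 /\ l * (y1 + y2) = x1 ^+ 2 + x1 * x2 + x2 ^+ 2 + a.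

Definition opposite (x1 y1 x2 y2 : F) : bool := (x1 == x2) && (y1 + y2 == 0).

Definition third (x1 y1 x2 l : F) := (l ^+ 2 - x1 - x2, l * (x1 - (l ^+ 2 - x1 - x2)) - y1).

Lemma slope_unique x1 y1 x2 y2 l :
  ~~ opposite x1 y1 x2 y2 -> is_slope x1 y1 x2 y2 l ->
  wadd (Some (x1, y1)) (Some (x2, y2)) = Some (third x1 y1 x2 l).
Proof.
rewrite /opposite /third => no [e1 e2] /=.
case: eqVneq no e1 e2 => [<-|nx] /= no e1 e2; last first.
  suff -> : (y2 - y1) / (x2 - x1) = l by [].
  by rewrite -e1 mulfK // subr_eq0 eq_sym.
rewrite (negPf no).
have ey : y2 = y1 by apply: (eq_lc (lc0 (-1) e1)); ring.
suff -> : (3%:R * x1 ^+ 2 + a) / (2%:R * y1) = l by [].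
have ny : 2%:R * y1 != 0 by rewrite mulr_natl mulr2n -{2}ey.
apply: (mulIf ny); rewrite divfK //.
by apply: (eq_lc (lc0 (-1) e2)); rewrite ey; ring.
Qed.

(** The line of slope [l] meets the cubic in three points whose abscissas sum to [l ^+ 2]. The slope
    equations give [y2] and [a], the curve equation gives [b], and what remains is a polynomial
    identity. *)
Lemma slope_curve x1 y1 x2 y2 l :
  y1 ^+ 2 = cubic x1 -> is_slope x1 y1 x2 y2 l ->
  forall x, cubic x - (y1 + l * (x - x1)) ^+ 2 = (x - x1) * (x - x2) * (x - (l ^+ 2 - x1 - x2)).
Proof.
rewrite /cubic => e0 [e1 e2] x.
have ey : y2 = y1 + l * (x2 - x1) by rewrite e1 addrC subrK.
have ea : a = l * (y1 + y2) - (x1 ^+ 2 + x1 * x2 + x2 ^+ 2) by rewrite e2 addrC addKr.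
have eb : b = y1 ^+ 2 - x1 ^+ 3 - a * x1 by rewrite e0; ring.
by rewrite eb ea ey; ring.
Qed.

Hypothesis char2 : 2%:R != 0 :> F.
Hypothesis smooth : forall x, cubic x = 0 -> 3%:R * x ^+ 2 + a != 0.

Lemma slope_ex x1 y1 x2 y2 :
  y1 ^+ 2 = cubic x1 -> y2 ^+ 2 = cubic x2 -> ~~ opposite x1 y1 x2 y2 ->
  exists l, is_slope x1 y1 x2 y2 l.
Proof.
rewrite /opposite => e1 e2; have [ex|nx _] := eqVneq x1 x2.
  rewrite /= => ny; exists ((x1 ^+ 2 + x1 * x2 + x2 ^+ 2 + a) / (y1 + y2)).
  split; last by rewrite divfK.
  suff -> : y2 = y1 by rewrite ex !subrr mulr0.
  apply/eqP; rewrite -subr_eq0 -(mulIr_eq0 _ (mulIf ny)).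
  have -> : (y2 - y1) * (y1 + y2) = y2 ^+ 2 - y1 ^+ 2 by ring.
  by rewrite e1 e2 ex subrr.
have nx' : x2 - x1 != 0 by rewrite subr_eq0 eq_sym.
exists ((y2 - y1) / (x2 - x1)); split; first by rewrite divfK.
apply: (mulfI nx'); rewrite mulrA [(x2 - x1) * _]mulrC divfK //.
apply: (eq_lc (lcD (lc0 (1) e2) (lc0 (-1) e1))); rewrite /cubic; ring.
Qed.

Lemma waddP x1 y1 x2 y2 : y1 ^+ 2 = cubic x1 -> y2 ^+ 2 = cubic x2 ->
  (opposite x1 y1 x2 y2 /\ wadd (Some (x1, y1)) (Some (x2, y2)) = None) \/
  (~~ opposite x1 y1 x2 y2 /\ exists2 l, is_slope x1 y1 x2 y2 l &
     wadd (Some (x1, y1)) (Some (x2, y2)) = Some (third x1 y1 x2 l)).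
Proof.
move=> e1 e2; case: (boolP (opposite x1 y1 x2 y2)) => [o|no].
  by left; split=> //; move: o => /andP[ox oy] /=; rewrite ox oy.
by right; split=> //; have [l hl] := slope_ex e1 e2 no; exists l => //; exact: slope_unique.
Qed.

Lemma third_curve x1 y1 x2 y2 l : y1 ^+ 2 = cubic x1 -> is_slope x1 y1 x2 y2 l ->
  (third x1 y1 x2 l).2 ^+ 2 = cubic (third x1 y1 x2 l).1.
Proof.
move=> e1 hl; have /= := slope_curve e1 hl (third x1 y1 x2 l).1.
rewrite /third /= subrr mulr0 => /eqP; rewrite subr_eq0 => /eqP ->.
by ring.
Qed.

Lemma wadd_curve P Q : wcurve P -> wcurve Q -> wcurve (wadd P Q).
Proof.
case: P Q => [[x1 y1]|] [[x2 y2]|] // /eqP e1 /eqP e2.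
have [[_ ->] //|[_ [l hl ->]]] := waddP e1 e2.
by apply/eqP; exact: third_curve hl.
Qed.

Lemma wopp_curve P : wcurve P -> wcurve (wopp P).
Proof. by case: P => [[x y]|] //=; rewrite sqrrN. Qed.

Lemma woppK : involutive wopp.
Proof. by case=> [[x y]|] //=; rewrite opprK. Qed.

Lemma waddN P : wcurve P -> wadd P (wopp P) = None.
Proof. by case: P => [[x y]|] //= _; rewrite eqxx subrr eqxx. Qed.

Lemma waddC P Q : wcurve P -> wcurve Q -> wadd P Q = wadd Q P.
Proof.
case: P Q => [[x1 y1]|] [[x2 y2]|] // /eqP e1 /eqP e2.
have [[o ->]|[no [l hl ->]]] := waddP e1 e2.
  by move: o => /andP[/eqP-> oy] /=; rewrite eqxx addrC oy.
have [h1 h2] := hl.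
rewrite (@slope_unique _ _ _ _ l).
- by congr Some; congr pair; [ring | apply: (eq_lc (lc0 (-1) h1)); ring].
- by apply: contraNN no => /andP[/eqP-> oy]; rewrite /opposite eqxx addrC oy.
by split; [apply: (eq_lc (lc0 (-1) h1)) | apply: (eq_lc (lc0 1 h2))]; ring.
Qed.

Lemma waddNN P Q : wcurve P -> wcurve Q -> wadd (wopp P) (wopp Q) = wopp (wadd P Q).
Proof.
case: P Q => [[x1 y1]|] [[x2 y2]|] // /eqP e1 /eqP e2.
have [[o ->]|[no [l hl ->]]] := waddP e1 e2.
  by move: o => /andP[/eqP-> oy] /=; rewrite eqxx -opprD oppr_eq0 oy.
have [h1 h2] := hl; rewrite /wopp.
rewrite (@slope_unique _ _ _ _ (- l)).
- by rewrite /third; congr Some; congr pair; ring.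
- by rewrite /opposite -opprD oppr_eq0.
by split; [apply: (eq_lc (lc0 (-1) h1)) | apply: (eq_lc (lc0 1 h2))]; ring.
Qed.

Lemma smooth2 x y : y ^+ 2 = cubic x -> y = 0 -> 3%:R * x ^+ 2 + a != 0.
Proof. by move=> e y0; apply: smooth; rewrite -e y0 expr0n. Qed.

Lemma waddK P Q : wcurve P -> wcurve Q -> wadd (wopp P) (wadd P Q) = Q.
Proof.
case: P Q => [[x1 y1]|] [[x2 y2]|] //; last first.
  by move=> c1 _; rewrite [wadd (Some _) None]/= waddC ?wopp_curve // waddN.
move=> /eqP e1 /eqP e2.
have [[o ->]|[no [l hl ->]]] := waddP e1 e2.
  by move: o => /andP[/eqP-> oy] /=; rewrite (eqP (_ : -y1 == y2)) // eq_sym -addr_eq0 addrC.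
have [h1 h2] := hl.
set x3 := l ^+ 2 - x1 - x2; rewrite /wopp /third -/x3.
have ey : y2 = y1 + l * (x2 - x1) by rewrite h1 addrC subrK.
rewrite (@slope_unique _ _ _ _ (-l)).
- by rewrite /third -/x3; congr (Some (_, _)); rewrite /x3 ?ey; ring.
(* Otherwise [P + Q = P]. Comparing ordinates gives [y1 = 0], and [P] would be a singular point,
   which [smooth] excludes. *)
- apply: contraNN no => /andP[/eqP ex /eqP ey'].
  have y10 : y1 = 0.
    have /eqP := ey'; rewrite -ex subrr mulr0 sub0r -opprD oppr_eq0 -mulr2n -mulr_natl.
    by rewrite mulf_eq0 (negPf char2) => /eqP.
  have := smooth2 e1 y10.
  have -> : 3%:R * x1 ^+ 2 + a = (x1 - x2) * (x1 - x3).
    have -> : a = l * (y1 + y2) - (x1 ^+ 2 + x1 * x2 + x2 ^+ 2) by rewrite h2 addrC addKr.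
    by rewrite ey y10 /x3; ring.
  by rewrite -ex subrr mulr0 eqxx.
split; first by rewrite /x3; ring.
have -> : a = l * (y1 + y2) - (x1 ^+ 2 + x1 * x2 + x2 ^+ 2) by rewrite h2 addrC addKr.
by rewrite /x3 ey; ring.
Qed.

(** This is the derivative of the identity of [slope_curve] at its third root, where the line takes
    the value [- yD]. *)
Lemma tangent_third x1 y1 x2 y2 l (xD := (third x1 y1 x2 l).1) (yD := (third x1 y1 x2 l).2) :
  is_slope x1 y1 x2 y2 l ->
  3%:R * xD ^+ 2 + a + 2%:R * l * yD = (xD - x1) * (xD - x2).
Proof.
move=> [h1 h2]; rewrite /xD /yD /third /=.
have -> : a = l * (y1 + y2) - (x1 ^+ 2 + x1 * x2 + x2 ^+ 2) by rewrite h2 addrC addKr.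
have -> : y2 = y1 + l * (x2 - x1) by rewrite h1 addrC subrK.
by ring.
Qed.

(* Associativity rests on the slopes: with [l], [k], [m], [n] the slopes of (P, Q),
   (Q, R), (P + Q, R), (P, Q + R), one has [l + m = k + n]. *)
Lemma slope_sum x1 y1 x2 y2 x3 y3 l k m
    (xD := (third x1 y1 x2 l).1) (yD := (third x1 y1 x2 l).2) :
  y1 ^+ 2 = cubic x1 -> y2 ^+ 2 = cubic x2 -> y3 ^+ 2 = cubic x3 ->
  is_slope x1 y1 x2 y2 l -> is_slope x2 y2 x3 y3 k -> is_slope xD yD x3 y3 m ->
  ~~ opposite x2 y2 x3 y3 -> ~~ opposite xD yD x3 y3 ->
  (l + m) * (k - l) = x3 - x1.
Proof.
move=> e1 e2 e3 hl hk hm nBC nDC.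
have eD : yD = - (y1 + l * (xD - x1)) by rewrite /xD /yD /third /=; ring.
have cD := slope_curve e1 hl x3; rewrite -/(third x1 y1 x2 l).1 in cD.
have tD := tangent_third hl; rewrite -/xD -/yD in tD.
have [h1 h2] := hl; have [k1 k2] := hk; have [m1 m2] := hm.
have xDE : l ^+ 2 - x1 - x2 = xD by [].
clearbody xD yD; rewrite xDE in cD.
(* With [L] the line through the first two points, the right sides of [s1] and [s2] are [y3 + L(x3)]
   and [y3 - L(x3)]. Their product is factored by [slope_curve], and division by
   [(x3 - xD) * (x3 - x2)] gives the claim. When one of these factors vanishes, the second slope
   equation takes over. *)
have s1 : (l + m) * (x3 - xD) = y3 + y1 + l * (x3 - x1).
  by apply: (eq_lc (lcD (lc0 1 m1) (lc0 (-1) eD))); ring.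
have s2 : (k - l) * (x3 - x2) = y3 - (y1 + l * (x3 - x1)).
  by apply: (eq_lc (lcD (lc0 1 k1) (lc0 1 h1))); ring.
have [x3D|x3D] := eqVneq x3 xD.
  have y3D : y3 = yD by apply: (eq_lc (lc0 (-1) m1)); rewrite x3D; ring.
  have [x32|x32] := eqVneq x3 x2.
    have y32 : y3 = y2 by apply: (eq_lc (lc0 (-1) k1)); rewrite x32; ring.
    case/negP: nBC; rewrite /opposite x32 eqxx y3D eD -x3D x32 /=.
    by apply/eqP; apply: (eq_lc (lc0 (-1) h1)); ring.
  have y30 : y3 + y3 != 0 by move: nDC; rewrite /opposite -x3D eqxx -y3D.
  have x320 : x3 - x2 != 0 by rewrite subr_eq0.
  apply: (mulIf y30); apply: (mulIf x320).
  have m2' : m * (y3 + y3) = 3%:R * x3 ^+ 2 + a by rewrite {1}y3D m2 -x3D; ring.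
  rewrite -x3D -y3D in tD eD.
  apply: (eq_lc (lcD (lcD (lc0 (l * (y3 + y3)) s2) (lc0 (m * (y3 + y3)) s2))
    (lcD (lc0 (- (l + m) * (y3 + y3)) eD)
    (lcD (lc0 (y3 + y3) m2') (lc0 (y3 + y3) tD))))).
  by ring.
have x3D0 : x3 - xD != 0 by rewrite subr_eq0.
have [x32|x32] := eqVneq x3 x2.
  have y32 : y3 = y2 by apply: (eq_lc (lc0 (-1) k1)); rewrite x32; ring.
  rewrite -x32 -y32 in h1 h2 k2 xDE.
  apply: (mulIf x3D0).
  apply: (eq_lc (lcD (lcD (lc0 (k - l) s1) (lc0 k h1))
    (lcD (lcD (lc0 1 k2) (lc0 (-1) h2)) (lc0 (x1 - x3) xDE)))).
  by ring.
have x320 : x3 - x2 != 0 by rewrite subr_eq0.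
apply: (mulIf x3D0); apply: (mulIf x320).
apply: (eq_lc (lcD (lcD (lc0 ((k - l) * (x3 - x2)) s1) (lc0 (y3 + y1 + l * (x3 - x1)) s2))
  (lcD (lc0 1 e3) (lc0 1 cD)))).
by ring.
Qed.

Lemma wadd_assoc_slopes x1 y1 x2 y2 x3 y3 l k m
    (xD := (third x1 y1 x2 l).1) (yD := (third x1 y1 x2 l).2)
    (xE := (third x2 y2 x3 k).1) (yE := (third x2 y2 x3 k).2) :
  y1 ^+ 2 = cubic x1 -> y2 ^+ 2 = cubic x2 -> y3 ^+ 2 = cubic x3 ->
  is_slope x1 y1 x2 y2 l -> is_slope x2 y2 x3 y3 k -> is_slope xD yD x3 y3 m ->
  ~~ opposite x2 y2 x3 y3 -> ~~ opposite xD yD x3 y3 ->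
  is_slope x1 y1 xE yE (l + m - k) /\ third xD yD x3 m = third x1 y1 xE (l + m - k).
Proof.
move=> e1 e2 e3 hl hk hm nBC nDC.
have s2 := slope_sum e1 e2 e3 hl hk hm nBC nDC.
have eE : yE = - (y2 + k * (xE - x2)) by rewrite /yE /xE /third /=; ring.
have cE := third_curve e2 hk; rewrite -/xE -/yE in cE.
have tE := tangent_third hk; rewrite -/xE -/yE in tE.
have eD : yD = - (y1 + l * (xD - x1)) by rewrite /xD /yD /third /=; ring.
have [h1 h2] := hl; have [k1 k2] := hk; have [m1 m2] := hm.
have xDE : xD = l ^+ 2 - x1 - x2 by [].
have xEE : xE = k ^+ 2 - x2 - x3 by [].
clearbody xD yD xE yE.
have s1 : (l + m) * (x3 - xD) = y3 + y1 + l * (x3 - x1).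
  by apply: (eq_lc (lcD (lc0 1 m1) (lc0 (-1) eD))); ring.
have E1 : (l + m - k) * (xE - x1) = yE - y1.
  apply: (eq_lc (lcD (lcD (lc0 (-1) s1) (lc0 (l + k) s2)) (lc0 1 k1))).
  by rewrite eE xEE xDE; ring.
have E2 : (l + m - k) * (y1 + yE) = x1 ^+ 2 + x1 * xE + xE ^+ 2 + a.
  have [xE1|xE1] := eqVneq xE x1.
    have yE1 : yE = y1 by apply: (eq_lc (lc0 (-1) E1)); rewrite xE1; ring.
    rewrite xE1 yE1 in tE eE *.
    apply: (eq_lc (lcD (lcD (lc0 (x2 - x1) s2) (lc0 (-1) tE))
       (lcD (lc0 (l + m) eE) (lc0 (l + m) h1)))).
    by ring.
  have xE10 : xE - x1 != 0 by rewrite subr_eq0.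
  apply: (mulIf xE10).
  apply: (eq_lc (lcD (lc0 (y1 + yE) E1) (lcD (lc0 1 cE) (lc0 (-1) e1)))).
  by rewrite /cubic; ring.
split=> //; have EX : m ^+ 2 - xD - x3 = (l + m - k) ^+ 2 - x1 - xE.
  by apply: (eq_lc (lc0 2%:R s2)); rewrite xDE xEE; ring.
rewrite /third EX; congr pair; rewrite -EX.
apply: (eq_lc (lcD (lcD (lc0 (l - m) s2) (lc0 (-1) s1))
    (lcD (lcD (lc0 (-1) eD) (lc0 1 h1)) (lc0 1 k1)))).
by rewrite xDE; ring.
Qed.

Lemma waddNK P Q : wcurve P -> wcurve Q -> wadd (wadd P (wopp Q)) Q = P.
Proof.
move=> cP cQ; have cN := wopp_curve cQ.
by rewrite waddC ?wadd_curve // -{1}[Q]woppK (waddC cP) // waddK.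
Qed.

Lemma wadd_eq0 P Q : wcurve P -> wcurve Q -> wadd P Q = None -> P = wopp Q.
Proof. by move=> cP cQ e; rewrite -[P]woppK -[Q](waddK cP cQ) e; case: (P) => [[]|]. Qed.

(** If one of the four sums is the point at infinity, the cancellation laws decide. Otherwise
    [l + m - k] is a slope for [P] and [Q + R], and a slope determines the sum. *)
Theorem wadd_assoc P Q R : wcurve P -> wcurve Q -> wcurve R ->
  wadd P (wadd Q R) = wadd (wadd P Q) R.
Proof.
move=> cP cQ cR; have cNP := wopp_curve cP; have cNQ := wopp_curve cQ.
have cNR := wopp_curve cR; have cD := wadd_curve cP cQ; have cE := wadd_curve cQ cR.
have [e|nPQ] := eqVneq (wadd P Q) None.
  by rewrite e (wadd_eq0 cP cQ e) waddK.
have [e|nQR] := eqVneq (wadd Q R) None.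
  rewrite e (wadd_eq0 cQ cR e) waddNK //.
  by case: (P) => [[]|].
have [e|nDR] := eqVneq (wadd (wadd P Q) R) None.
  rewrite e -[R]woppK -(wadd_eq0 cD cR e) -waddNN //.
  by rewrite (waddC cNP cNQ) -{1}[Q]woppK waddK // waddN.
have [e|nPE] := eqVneq (wadd P (wadd Q R)) None.
  rewrite e (wadd_eq0 cP cE e) -waddNN //.
  by rewrite (waddC cNQ cNR) waddNK // (waddC cNR cR) waddN.
move: P Q R cP cQ cR nPQ nQR nDR nPE {cNP cNQ cNR cD cE}.
case=> [[x1 y1]|] [[x2 y2]|] [[x3 y3]|] //; last by move=> *; case: wadd => [[]|].
move=> /eqP e1 /eqP e2 /eqP e3.
have [[_ -> //]|[nAB [l hl ->]] _] := waddP e1 e2.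
have [[_ -> //]|[nBC [k hk ->]] _] := waddP e2 e3.
have eD := third_curve e1 hl; have eE := third_curve e2 hk.
have [[_ -> //]|[nDC [m hm ->]] _] := waddP eD e3.
have [[_ -> //]|[nAE [n hn _]] _] := waddP e1 eE.
have [hs ->] := wadd_assoc_slopes e1 e2 e3 hl hk hm nBC nDC.
exact: slope_unique.
Qed.
End GroupLaw.

Lemma disc_smooth (F : fieldType) (a b : F) :
  4%:R * a ^+ 3 + 27%:R * b ^+ 2 != 0 ->
  forall x, cubic a b x = 0 -> 3%:R * x ^+ 2 + a != 0.
Proof.
move=> nz x cx; apply: contra_neq nz => ea.
have -> : a = - (3%:R * x ^+ 2) by apply/eqP; rewrite -addr_eq0 addrC ea.
have -> : b = 2%:R * x ^+ 3 by apply: (eq_lc (lcD (lc0 1 cx) (lc0 (-x) ea))); rewrite /cubic; ring.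
by ring.
Qed.

Definition wmul (F : fieldType) (a : F) n P := iter n (wadd a P) None.

Section Multiples.
Variables (F : fieldType) (a b : F).
Hypothesis char2 : 2%:R != 0 :> F.
Hypothesis smooth : forall x, cubic a b x = 0 -> 3%:R * x ^+ 2 + a != 0.
Variable P : option (F * F).
Hypothesis cP : wcurve a b P.

Lemma wmul_curve n : wcurve a b (wmul a n P).
Proof. by elim: n => //= n IH; exact: wadd_curve. Qed.

Lemma wmulD m n : wadd a (wmul a m P) (wmul a n P) = wmul a (m + n) P.
Proof.
elim: m => //= m IH; rewrite -IH (wadd_assoc char2 smooth) //; exact: wmul_curve.
Qed.

Lemma wmulB m n : (n <= m)%N -> wadd a (wmul a m P) (wopp (wmul a n P)) = wmul a (m - n) P.
Proof.
move=> le_nm; rewrite -{1}(subnK le_nm) -wmulD.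
have cn := wmul_curve n; have cN := wopp_curve cn.
rewrite -(wadd_assoc char2 smooth) ?wmul_curve // (waddN cn).
by case: wmul => [[]|].
Qed.

Lemma wmul_eq m n : (n <= m)%N -> wmul a m P = wmul a n P -> wmul a (m - n) P = None.
Proof. by move=> le_nm e; rewrite -wmulB // e (waddN (wmul_curve n)). Qed.

Lemma wmul_opp m n : wmul a m P = wopp (wmul a n P) -> wmul a (m + n) P = None.
Proof.
move=> e; have cn := wmul_curve n; have cN := wopp_curve cn.
by rewrite -wmulD e (waddC cN cn) (waddN cn).
Qed.

Hypothesis infinite_order : forall n, (0 < n)%N -> wmul a n P != None.

(** Equal abscissas would force [mP = nP] or [mP = -nP], so that [m - n] or [m + n] would kill
    [P]. *)
Lemma wmul_x_neq m n xm ym xn yn : (0 < n)%N -> (n < m)%N ->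
  wmul a m P = Some (xm, ym) -> wmul a n P = Some (xn, yn) -> xm != xn.
Proof.
move=> n0 nm em en; apply/negP => /eqP exy.
have := wmul_curve m; have := wmul_curve n; rewrite em en /= -exy => /eqP <-.
rewrite eqf_sqr => /orP[] /eqP ey.
  have := infinite_order (_ : 0 < m - n)%N; rewrite subn_gt0 => /(_ nm).
  by rewrite wmul_eq ?eqxx //; [exact: ltnW | rewrite em en exy ey].
have := infinite_order (_ : 0 < m + n)%N; rewrite addn_gt0 n0 orbT => /(_ isT).
by rewrite wmul_opp ?eqxx // em en exy ey.
Qed.
End Multiples.

(** * Height inequalities *)

Definition height (x : rat) : nat := maxn `|numq x| `|denq x|.

Lemma height_gt0 x : (0 < height x)%N.
Proof. by rewrite leq_max orbC absz_gt0 denq_neq0. Qed.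

Lemma dvdz_coprime_mul (a b c m : int) : coprimez a b -> (m %| c * a)%Z -> (m %| c * b)%Z -> (m %| c)%Z.
Proof.
move=> /eqP co ma mb; have [u [v e]] := Bezoutz a b.
rewrite co in e; rewrite -[c]mulr1 -e mulrDr.
by rewrite (mulrC u) (mulrC v) !mulrA rpredD // dvdz_mulr.
Qed.

Lemma rat_fraction (x : rat) (p q : int) : q != 0 -> x = p%:~R / q%:~R ->
  exists2 t : int, p = t * numq x & q = t * denq x.
Proof.
move=> q0 e; have dx : (denq x)%:~R != 0 :> rat by rewrite intr_eq0 denq_neq0.
have q0' : q%:~R != 0 :> rat by rewrite intr_eq0.
have E : p * denq x = numq x * q.
  apply/eqP; rewrite -(eqr_int rat) !intrM -eqr_div // -e.
  by rewrite divq_num_den.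
have /dvdzP[t et] : (denq x %| q)%Z.
  rewrite -(@Gauss_dvdzr _ (numq x)) ?E -?E ?dvdz_mull //.
  by rewrite coprimez_sym coprimezE coprime_num_den.
exists t => //; apply: (mulIf (denq_neq0 x)).
by rewrite E et; ring.
Qed.

Lemma abszD_le (p q : int) (M : nat) : (`|(p + q)%R| <= M)%N ->
  (`|p| <= M + `|q| /\ `|q| <= M + `|p|)%N.
Proof. lia. Qed.

Lemma abszD_leq (x y : int) (a b : nat) :
  (`|x| <= a)%N -> (`|y| <= b)%N -> (`|(x + y)%R| <= a + b)%N.
Proof. lia. Qed.

Lemma abszB_leq (x y : int) (a b : nat) :
  (`|x| <= a)%N -> (`|y| <= b)%N -> (`|(x - y)%R| <= a + b)%N.
Proof. lia. Qed.

Lemma abszM_leq (x y : int) (a b : nat) :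
  (`|x| <= a)%N -> (`|y| <= b)%N -> (`|(x * y)%R| <= a * b)%N.
Proof. by move=> xa yb; rewrite abszM leq_mul. Qed.

(* Gauss's lemma for [(v3 X - u3)(v4 X - u4)]: the product is primitive. *)
Lemma height_quadratic (x3 x4 : rat) (w0 w1 w2 : int) (M : nat) : w0 != 0 ->
  x3 + x4 = w1%:~R / w0%:~R -> x3 * x4 = w2%:~R / w0%:~R ->
  (`|w0| <= M)%N -> (`|w1| <= M)%N -> (`|w2| <= M)%N ->
  (height x3 * height x4 <= 2 * M)%N.
Proof.
rewrite /height => nz es ep.
have c3 : coprimez (numq x3) (denq x3) by rewrite coprimezE coprime_num_den.
have c4 : coprimez (numq x4) (denq x4) by rewrite coprimezE coprime_num_den.
have d3 : (denq x3)%:~R != 0 :> rat by rewrite intr_eq0 denq_neq0.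
have d4 : (denq x4)%:~R != 0 :> rat by rewrite intr_eq0 denq_neq0.
have nz' : w0%:~R != 0 :> rat by rewrite intr_eq0.
have n3 := denq_neq0 x3; have n4 := denq_neq0 x4.
move: c3 c4 d3 d4 n3 n4 (divq_num_den x3) (divq_num_den x4) es ep.
move: (numq x3) (denq x3) (numq x4) (denq x4) => u3 v3 u4 v4.
move=> c3 c4 d3 d4 n3 n4 <- <- es ep.
have Es : w0 * (u3 * v4 + u4 * v3) = w1 * (v3 * v4).
  apply/eqP; rewrite -(eqr_int rat) !rmorphM !rmorphD !rmorphM /=; apply/eqP.
  move: es; rewrite addf_div // => /eqP; rewrite eqr_div ?mulf_neq0 // => /eqP <-.
  by ring.
have Ep : w0 * (u3 * u4) = w2 * (v3 * v4).
  apply/eqP; rewrite -(eqr_int rat) !rmorphM /=; apply/eqP.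
  move: ep; rewrite mulf_div => /eqP; rewrite eqr_div ?mulf_neq0 // => /eqP <-.
  by ring.
(* As [u3 ^+ 2], [v3 ^+ 2] are coprime and so are [u4 ^+ 2], [v4 ^+ 2], it is enough that [v3 * v4]
   divides [w0] times each of the four mixed products. *)
have [t et] : exists t, w0 = t * (v3 * v4).
  apply/dvdzP; set m := v3 * v4.
  have cs3 : coprimez (u3 ^+ 2) (v3 ^+ 2) by rewrite coprimezXl // coprimezXr.
  have cs4 : coprimez (u4 ^+ 2) (v4 ^+ 2) by rewrite coprimezXl // coprimezXr.
  apply: (dvdz_coprime_mul cs3); apply: (dvdz_coprime_mul cs4); apply/dvdzP.
  - by exists (w2 * u3 * u4); apply: (eq_lc (lc0 (u3 * u4) Ep)); rewrite /m; ring.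
  - exists (w1 * u3 * v4 - w0 * u3 * u4).
    by apply: (eq_lc (lc0 (u3 * v4) Es)); rewrite /m; ring.
  - exists (w1 * u4 * v3 - w0 * u3 * u4).
    by apply: (eq_lc (lc0 (u4 * v3) Es)); rewrite /m; ring.
  - by exists (w0 * v3 * v4); rewrite /m; ring.
have v0 : v3 * v4 != 0 by rewrite mulf_neq0.
have e1 : w1 = t * (u3 * v4 + u4 * v3).
  by apply: (mulIf v0); rewrite -Es et; ring.
have e2 : w2 = t * (u3 * u4) by apply: (mulIf v0); rewrite -Ep et; ring.
have t0 : (0 < `|t|)%N by rewrite absz_gt0; apply: contra_neq nz => t0; rewrite et t0 mul0r.
rewrite et e1 e2 !abszM => W0 W1 W2.
have le_t (z y : nat) : (`|t| * z <= y)%N -> (z <= y)%N.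
  by apply: leq_trans; rewrite leq_pmull.
move: (le_t _ _ W0) (le_t _ _ W1) (le_t _ _ W2) => {}W0 {}W1 {}W2.
have W1' : (`|u3| * `|v4| <= M + `|u4| * `|v3| /\ `|u4| * `|v3| <= M + `|u3| * `|v4|)%N.
  by rewrite -!abszM; apply: abszD_le.
move: W0 W1' W2; move: `|u3|%N `|v3|%N `|u4|%N `|v4|%N {W1} => U3 V3 U4 V4 W0 [W1 W1'] W2.
rewrite maxnMl !maxnMr !geq_max.
(* The middle coefficient may be small by cancellation, but the product of its two terms is that of
   the outer coefficients, at most [M * M]; so the two terms cannot both be large. *)
have cross (p q r s : nat) : (p * r <= M -> q * s <= M -> p * s <= M + q * r -> p * s <= 2 * M)%N.
  move=> pr qs ps; case: (leqP (q * r) M) => [|qr]; first lia.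
  rewrite leqNgt; apply/negP => ps2.
  have : (p * s * (q * r) <= M * M)%N by rewrite (mulnC q) mulnACA leq_mul // mulnC.
  by rewrite leqNgt ltn_mul // (leq_ltn_trans _ ps2) // leq_pmull.
have MM : (M <= 2 * M)%N by rewrite leq_pmull.
rewrite (leq_trans W2 MM) (leq_trans W0 MM) (cross U3 V3 U4 V4) //; last by rewrite (mulnC V3).
by rewrite (cross V3 U3 V4 U4) // mulnC // (mulnC U3).
Qed.


Lemma leq_eq_addr (m n t : nat) : n = (m + t)%N -> (m <= n)%N.
Proof. by move->; rewrite leq_addr. Qed.

Section Parallelogram.
Variables A B : int.

Definition parallelogram_const : nat := 4 * (1 + `|A| + `|B|) ^ 2.

(** For [p, q, r, s] equal to [u1 v2], [u2 v1], [u1 u2], [v1 v2], these are the coefficients,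
    cleared of denominators, of the quadratic whose roots are the abscissas of [P + Q] and
    [P - Q]. *)
Lemma parallelogram_bounds (p q r s : int) (K : nat) :
  (`|p| <= K)%N -> (`|q| <= K)%N -> (`|r| <= K)%N -> (`|s| <= K)%N ->
  [/\ (`|((p - q) ^+ 2)%R| <= parallelogram_const * K ^ 2)%N,
      (`|(2%:R * ((p + q) * (r + A * s) + 2%:R * B * s ^+ 2))%R| <= parallelogram_const * K ^ 2)%N &
      (`|((r - A * s) ^+ 2 - 4%:R * B * s * (p + q))%R| <= parallelogram_const * K ^ 2)%N].
Proof.
move=> hp hq hr hs.
have tri := abszD_leq; have trs := abszB_leq; have mul := abszM_leq.
have pq := tri _ _ _ _ hp hq; have pmq := trs _ _ _ _ hp hq.
have As : (`|(A * s)%R| <= `|A| * K)%N by apply: mul.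
have rA := tri _ _ _ _ hr As; have rmA := trs _ _ _ _ hr As.
have Bs : (`|(B * s)%R| <= `|B| * K)%N by apply: mul.
split.
- rewrite expr2; apply: leq_trans (mul _ _ _ _ pmq pmq) _.
  by apply: (leq_eq_addr (t := (K ^ 2 * 4 * (2 * (`|A| + `|B|) + (`|A| + `|B|) ^ 2))%N)); rewrite /parallelogram_const; ring.
- apply: leq_trans (mul _ _ 2%N _ _ (tri _ _ _ _ (mul _ _ _ _ pq rA) (_ : (_ <= 2 * (`|B| * K) * K)%N))) _ => //.
    by rewrite expr2 mulrA -[2%:R * B * s]mulrA; apply: (mul _ _ _ _) => //; exact: (mul 2%:R (B * s) 2%N _ isT Bs).
  by apply: (leq_eq_addr (t := (4 * K ^ 2 * ((1 + `|A| + `|B|) * (`|A| + `|B|)))%N)); rewrite /parallelogram_const; ring.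
- rewrite expr2; apply: leq_trans (trs _ _ _ _ (mul _ _ _ _ rmA rmA) (_ : (_ <= 4 * (`|B| * K) * (K + K))%N)) _.
    by rewrite -[4%:R * B * s]mulrA; apply: (mul _ _ _ _) => //; exact: (mul 4%:R (B * s) 4%N _ isT Bs).
  by apply: (leq_eq_addr (t := (K ^ 2 * (3 + 6 * `|A| + 3 * `|A| ^ 2 + 8 * `|A| * `|B| + 4 * `|B| ^ 2))%N)); rewrite /parallelogram_const; ring.
Qed.

(** Both symmetric functions are even in [y1] and in [y2], so the curve equation removes the
    ordinates. *)
Lemma chord_sum (F : fieldType) (a b x1 y1 x2 y2 : F) : x1 != x2 ->
  y1 ^+ 2 = cubic a b x1 -> y2 ^+ 2 = cubic a b x2 ->
  let x3 := ((y2 - y1) / (x2 - x1)) ^+ 2 - x1 - x2 in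
  let x4 := ((- y2 - y1) / (x2 - x1)) ^+ 2 - x1 - x2 in
  x3 + x4 = 2%:R * ((x1 + x2) * (x1 * x2 + a) + 2%:R * b) / (x1 - x2) ^+ 2 /\
  x3 * x4 = ((x1 * x2 - a) ^+ 2 - 4%:R * b * (x1 + x2)) / (x1 - x2) ^+ 2.
Proof.
move=> nx e1 e2 /=.
have d1 : x1 - x2 != 0 by rewrite subr_eq0.
have d2 : x2 - x1 != 0 by rewrite subr_eq0 eq_sym.
have d0 : (x1 - x2) ^+ 2 != 0 by rewrite expf_neq0.
have -> : (y2 - y1) / (x2 - x1) = (y1 - y2) / (x1 - x2) by field; rewrite d1 d2.
have -> : (- y2 - y1) / (x2 - x1) = (y1 + y2) / (x1 - x2) by field; rewrite d1 d2.
split; apply: (mulIf d0); rewrite divfK //.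
  transitivity (2%:R * (y1 ^+ 2 + y2 ^+ 2) - 2%:R * (x1 + x2) * (x1 - x2) ^+ 2).
    by field.
  by rewrite e1 e2 /cubic; ring.
apply: (mulIf d0).
transitivity ((y1 ^+ 2 - y2 ^+ 2) ^+ 2 - 2%:R * (x1 + x2) * (y1 ^+ 2 + y2 ^+ 2) * (x1 - x2) ^+ 2
  + (x1 + x2) ^+ 2 * (x1 - x2) ^+ 4); first by field.
by rewrite e1 e2 /cubic; ring.
Qed.

Lemma parallelogram_height (x1 y1 x2 y2 x3 y3 x4 y4 : rat) (a := A%:~R : rat) (b := B%:~R : rat) :
  x1 != x2 -> wcurve a b (Some (x1, y1)) -> wcurve a b (Some (x2, y2)) ->
  wadd a (Some (x1, y1)) (Some (x2, y2)) = Some (x3, y3) ->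
  wadd a (Some (x1, y1)) (wopp (Some (x2, y2))) = Some (x4, y4) ->
  (height x3 * height x4 <= 2 * (parallelogram_const * (height x1 * height x2) ^ 2))%N.
Proof.
move=> nx /eqP e1 /eqP e2 /=; rewrite (negPf nx) => -[e3 _] [e4 _].
have [] := chord_sum nx e1 e2; rewrite e3 e4.
have n1 := denq_neq0 x1; have n2 := denq_neq0 x2.
have d1 : (denq x1)%:~R != 0 :> rat by rewrite intr_eq0.
have d2 : (denq x2)%:~R != 0 :> rat by rewrite intr_eq0.
have hH x : (`|numq x| <= height x)%N /\ (`|denq x| <= height x)%N.
  by split; rewrite leq_max leqnn ?orbT.
have := hH x1; have := hH x2.
move: nx n1 n2 d1 d2 (divq_num_den x1) (divq_num_den x2).
move: (height x1) (height x2) (numq x1) (denq x1) (numq x2) (denq x2).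
move=> H1 H2 u1 v1 u2 v2 nx n1 n2 d1 d2 q1 q2 [hu2 hv2] [hu1 hv1] es ep.
have hm (x y : int) : (`|x| <= H1)%N -> (`|y| <= H2)%N -> (`|(x * y)%R| <= H1 * H2)%N.
  by move=> h1 h2; rewrite abszM leq_mul.
have [b0 b1 b2] := parallelogram_bounds (hm _ _ hu1 hv2) 
   (etrans (congr1 (fun z => `|z| <= H1 * H2)%N (mulrC u2 v1)) (hm _ _ hv1 hu2)) (hm _ _ hu1 hu2) (hm _ _ hv1 hv2).
have nz : u1 * v2 - u2 * v1 != 0.
  apply: contraNneq nx => /eqP; rewrite subr_eq0 -(eqr_int rat) !rmorphM /= -eqr_div // q1 q2.
  by move=> /eqP ->.
have nzr : u1%:~R * v2%:~R - u2%:~R * v1%:~R != 0 :> rat by rewrite -!rmorphM -rmorphB intr_eq0.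
apply: (height_quadratic _ _ _ b0 b1 b2); first by rewrite expf_neq0.
  rewrite es -q1 -q2 !(rmorphM, rmorphD, rmorphB, rmorphXn) /= /a /b.
  by field; rewrite d1 d2 nzr.
rewrite ep -q1 -q2 !(rmorphM, rmorphD, rmorphB, rmorphXn) /= /a /b.
by field; rewrite d1 d2 nzr.
Qed.

Definition cubic_form (c0 c1 c2 c3 u v : int) : int :=
  c0 * u ^+ 3 + c1 * u ^+ 2 * v + c2 * u * v ^+ 2 + c3 * v ^+ 3.

Lemma cubic_form_le c0 c1 c2 c3 u v (H : nat) : (`|u| <= H)%N -> (`|v| <= H)%N ->
  (`|cubic_form c0 c1 c2 c3 u v| <= (`|c0| + `|c1| + `|c2| + `|c3|) * H ^ 3)%N.
Proof.
move=> hu hv; rewrite /cubic_form !mulnDl.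
have tri := abszD_leq.
have m3 c x y z : (`|x| <= H)%N -> (`|y| <= H)%N -> (`|z| <= H)%N -> (`|(c * x * y * z)%R| <= `|c| * H ^ 3)%N.
  by move=> hx hy hz; rewrite !abszM -!mulnA leq_mul // !expnS expn0 muln1 !leq_mul.
apply: (tri _ _ _ _ (tri _ _ _ _ (tri _ _ _ _ _ _) _)).
- by rewrite exprSr expr2 !mulrA; apply: m3.
- by rewrite expr2 !mulrA; apply: m3.
- by rewrite expr2 !mulrA; apply: m3.
- by rewrite exprSr expr2 !mulrA; apply: m3.
Qed.

(* The two identities are the resultant of the numerator and denominator of [x (2 P)]. *)
Lemma duplication_height : 4%:R * A ^+ 3 + 27%:R * B ^+ 2 != 0 ->
  exists C, forall (x1 y1 x2 y2 : rat) (a := A%:~R : rat) (b := B%:~R : rat),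
  wcurve a b (Some (x1, y1)) -> wadd a (Some (x1, y1)) (Some (x1, y1)) = Some (x2, y2) -> 
  (height x1 ^ 4 <= C * height x2)%N.
Proof.
move=> disc; set D := 4%:R * A ^+ 3 + 27%:R * B ^+ 2.
pose c1 : nat := (12 + `|(16%:R * A)%R| + (3 + `|(-5%:R * A)%R| + `|(-27%:R * B)%R|))%N.
pose c2 : nat := ((`|(4%:R * D)%R| + `|(-4%:R * A ^+ 2 * B)%R| + `|(4%:R * A * (3%:R * A ^+ 3 + 22%:R * B ^+ 2))%R|
   + `|(12%:R * B * (A ^+ 3 + 8%:R * B ^+ 2))%R|)
   + (`|(A ^+ 2 * B)%R| + `|(A * (5%:R * A ^+ 3 + 32%:R * B ^+ 2))%R| + `|(2%:R * B * (13%:R * A ^+ 3 + 96%:R * B ^+ 2))%R|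
   + `|(-3%:R * A ^+ 2 * (A ^+ 3 + 8%:R * B ^+ 2))%R|))%N.
exists (c1 + c2)%N => x1 y1 x2 y2 a b /eqP e1 /=; rewrite eqxx; case: eqP => // /eqP y0 [e2 _].
have c1x : coprimez (numq x1) (denq x1) by rewrite coprimezE coprime_num_den.
have n1 := denq_neq0 x1; have q1 := divq_num_den x1.
have : (`|numq x1| <= height x1)%N /\ (`|denq x1| <= height x1)%N.
  by split; rewrite leq_max leqnn ?orbT.
have hH : (height x1 = `|numq x1| \/ height x1 = `|denq x1|)%N.
  by rewrite /height; case: leqP => _; [right | left].
have [hu2 hv2] : (`|numq x2| <= height x2)%N /\ (`|denq x2| <= height x2)%N.
  by split; rewrite leq_max leqnn ?orbT.
have H1gt := height_gt0 x1.
move: c1x n1 q1 hH H1gt; move: (numq x1) (denq x1) (height x1) => u v H co nv q1 hH Hgt0 [hu hv].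
have nvr : v%:~R != 0 :> rat by rewrite intr_eq0.
pose Fp := u ^+ 4 - 2%:R * A * u ^+ 2 * v ^+ 2 - 8%:R * B * u * v ^+ 3 + A ^+ 2 * v ^+ 4.
pose Gp := 4%:R * v * (u ^+ 3 + A * u * v ^+ 2 + B * v ^+ 3).
have yy : y1 != 0 by apply: contraNneq y0 => ->; rewrite addr0.
have cx0 : cubic a b x1 != 0 by rewrite -e1 expf_neq0.
have GE : Gp%:~R = 4%:R * v%:~R ^+ 4 * cubic a b x1 :> rat.
  rewrite /Gp !(rmorphM, rmorphD, rmorphXn) /= /cubic -q1 /a /b.
  by field.
have G0 : Gp != 0 by rewrite -(@intr_eq0 rat) GE !mulf_neq0 ?expf_neq0.
have Ex : x2 = Fp%:~R / Gp%:~R.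
  have -> : x2 = ((3%:R * x1 ^+ 2 + a) ^+ 2 - 8%:R * x1 * y1 ^+ 2) / (4%:R * y1 ^+ 2).
    by rewrite -e2; field.
  rewrite GE -e1 e1 /Fp !(rmorphM, rmorphD, rmorphB, rmorphXn) /=.
  apply/eqP; rewrite eqr_div ?mulf_neq0 ?expf_neq0 //; apply/eqP.
  rewrite /cubic -q1 /a /b.
  by field.
(* [t] is the factor lost when [Fp / Gp] is put in lowest terms. By [I1] and [I2] it divides [4 D],
   because [u ^+ 7] and [v ^+ 7] are coprime. *)
have [t et1 et2] := rat_fraction G0 Ex.
have I1 : cubic_form 0 12%:R 0 (16%:R * A) u v * Fp
    - cubic_form 3%:R 0 (-5%:R * A) (-27%:R * B) u v * Gp = 4%:R * D * v ^+ 7.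
  by rewrite /cubic_form /Fp /Gp /D; ring.
have I2 : cubic_form (4%:R * D) (-4%:R * A ^+ 2 * B) (4%:R * A * (3%:R * A ^+ 3 + 22%:R * B ^+ 2))
      (12%:R * B * (A ^+ 3 + 8%:R * B ^+ 2)) u v * Fp
    + cubic_form (A ^+ 2 * B) (A * (5%:R * A ^+ 3 + 32%:R * B ^+ 2)) (2%:R * B * (13%:R * A ^+ 3 + 96%:R * B ^+ 2))
      (-3%:R * A ^+ 2 * (A ^+ 3 + 8%:R * B ^+ 2)) u v * Gp = 4%:R * D * u ^+ 7.
  by rewrite /cubic_form /Fp /Gp /D; ring.
have tD : (t %| 4%:R * D)%Z.
  apply: (@dvdz_coprime_mul (u ^+ 7) (v ^+ 7)); first by rewrite coprimezXl // coprimezXr.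
    by rewrite -I2 et1 et2 rpredD // dvdz_mull // dvdz_mulr.
  by rewrite -I1 et1 et2 rpredB // dvdz_mull // dvdz_mulr.
have D0 : 4%:R * D != 0 by rewrite mulf_neq0.
have tle : (`|t| <= `|(4%:R * D)%R|)%N by apply: dvdn_leq; rewrite ?absz_gt0.
have tri (f g p q : int) cf cg : (`|f| <= cf * H ^ 3)%N -> (`|g| <= cg * H ^ 3)%N ->
    (`|p| <= height x2)%N -> (`|q| <= height x2)%N ->
    (`|(f * (t * p) + g * (t * q))%R| <= `|(4%:R * D)%R| * ((cf + cg) * H ^ 3 * height x2))%N.
  move=> hf hg hp hq; have -> : f * (t * p) + g * (t * q) = t * (f * p + g * q) by ring.
  rewrite abszM leq_mul // !mulnDl.
  by apply: abszD_leq; apply: abszM_leq.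
have b1 : (`|v| ^ 7 <= c1 * H ^ 3 * height x2)%N.
  rewrite -(@leq_pmul2l `|(4%:R * D)%R|) ?absz_gt0 // -abszX -abszM -I1 et1 et2 -mulNr.
  apply: tri => //; first exact: (@cubic_form_le 0 12%:R 0 (16%:R * A)).
  rewrite abszN; exact: (@cubic_form_le 3%:R 0 (-5%:R * A) (-27%:R * B)).
have b2 : (`|u| ^ 7 <= c2 * H ^ 3 * height x2)%N.
  rewrite -(@leq_pmul2l `|(4%:R * D)%R|) ?absz_gt0 // -abszX -abszM -I2 et1 et2.
  by apply: tri => //; exact: cubic_form_le.
clearbody c1 c2; have bH : (H ^ 7 <= (c1 + c2) * H ^ 3 * height x2)%N.
  rewrite !mulnDl; case: hH => eH; rewrite {1}eH.
    by apply: leq_trans b2 _; rewrite leq_addl.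
  by apply: leq_trans b1 _; rewrite leq_addr.
rewrite -(@leq_pmul2l (H ^ 3)) ?expn_gt0 ?Hgt0 // -expnD.
by rewrite [X in (_ <= X)%N]mulnA [(H ^ 3 * _)%N]mulnC.
Qed.
End Parallelogram.

(** * Growth of heights *)

(** The value 1 at infinity keeps every height positive and its logarithm nonnegative. *)
Definition xheight (P : ec_point) : nat := if P is Some (x, _) then height x else 1%N.

Lemma xheight_gt0 P : (0 < xheight P)%N.
Proof. by case: P => [[x y]|] //; exact: height_gt0. Qed.

Lemma INR_leq m n : (m <= n)%N -> Rle (INR m) (INR n).
Proof. by move=> /ssrnat.leP; exact: le_INR. Qed.

Lemma INR_gt0 n : (0 < n)%N -> Rlt 0 (INR n).
Proof. by move=> /ssrnat.ltP; exact: lt_0_INR. Qed.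

Lemma lnN_ge0 n : (0 < n)%N -> Rle 0 (ln (INR n)).
Proof. by move=> n0; rewrite -ln_1; apply: ln_le; [lra | exact: (@INR_leq 1)]. Qed.

Lemma lnN_le m n : (0 < m)%N -> (m <= n)%N -> Rle (ln (INR m)) (ln (INR n)).
Proof. by move=> m0 mn; apply: ln_le; [exact: INR_gt0 | exact: INR_leq]. Qed.

Lemma lnN_M m n : (0 < m)%N -> (0 < n)%N ->
  ln (INR (m * n)) = Rplus (ln (INR m)) (ln (INR n)).
Proof. by move=> m0 n0; rewrite mult_INR ln_mult //; exact: INR_gt0. Qed.

Lemma lnN_X m k : (0 < m)%N -> ln (INR (m ^ k)) = Rmult (INR k) (ln (INR m)).
Proof.
move=> m0; elim: k => [|k IH]; first by rewrite /= ln_1 Rmult_0_l.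
by rewrite expnS lnN_M ?expn_gt0 ?m0 // IH S_INR; lra.
Qed.

Section HeightGrowth.
Variables A B : int.
Hypothesis disc : 4%:R * A ^+ 3 + 27%:R * B ^+ 2 != 0.
Let a : rat := A%:~R.
Let b : rat := B%:~R.
Variable Q : ec_point.
Hypothesis cQ : wcurve a b Q.
Hypothesis infinite_order : forall n, (0 < n)%N -> wmul a n Q != None.

Let xh n := xheight (wmul a n Q).

Lemma rat_char2 : 2%:R != 0 :> rat.
Proof. by []. Qed.

Lemma rat_smooth x : cubic a b x = 0 -> 3%:R * x ^+ 2 + a != 0.
Proof.
apply: disc_smooth; rewrite /a /b -!rmorphXn -[4%:R]/(4%:~R) -[27%:R]/(27%:~R).
by rewrite -!rmorphM -rmorphD intr_eq0.
Qed.

Lemma wmul_affine n : (0 < n)%N -> exists x y, wmul a n Q = Some (x, y).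
Proof. by move/infinite_order; case: wmul => // -[x y] _; exists x, y. Qed.

Lemma wmul_x_inj m n xm ym xn yn : (0 < n)%N -> (0 < m)%N -> m != n ->
  wmul a m Q = Some (xm, ym) -> wmul a n Q = Some (xn, yn) -> xm != xn.
Proof.
move=> n0 m0; rewrite neq_ltn => /orP[mn|nm] em en; last first.
  exact: (wmul_x_neq rat_char2 rat_smooth cQ infinite_order n0 nm em en).
rewrite eq_sym; exact: (wmul_x_neq rat_char2 rat_smooth cQ infinite_order m0 mn en em).
Qed.

Lemma xheight_parallelogram : exists C : nat, forall m n, (0 < n < m)%N ->
  (xh (m + n) * xh (m - n) <= C * (xh m * xh n) ^ 2)%N.
Proof.
exists (2 * parallelogram_const A B)%N => m n /andP[n0 nm]; rewrite /xh.
have m0 := ltn_trans n0 nm; have mn0 : (0 < m - n)%N by rewrite subn_gt0.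
have mpn0 : (0 < m + n)%N by rewrite addn_gt0 m0.
have [xm [ym em]] := wmul_affine m0; have [xn [yn en]] := wmul_affine n0.
have [x3 [y3 e3]] := wmul_affine mpn0; have [x4 [y4 e4]] := wmul_affine mn0.
have cm := wmul_curve cQ m; have cn := wmul_curve cQ n.
have hD := wmulD rat_char2 rat_smooth cQ m n; have hB := wmulB rat_char2 rat_smooth cQ (ltnW nm).
have mn : m != n by rewrite gtn_eqF.
have nx := wmul_x_inj n0 m0 mn em en.
rewrite em en e3 in hD; rewrite em en e4 in hB; rewrite em in cm; rewrite en in cn.
by rewrite e3 e4 em en /= -mulnA; exact: (parallelogram_height nx cm cn hD hB).
Qed.

Lemma xheight_duplication : exists C : nat, forall m, (0 < m)%N ->
  (xh m ^ 4 <= C * xh (2 * m))%N.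
Proof.
have [C hC] := duplication_height disc; exists C => m m0; rewrite /xh.
have m2 : (0 < 2 * m)%N by rewrite muln_gt0.
have [xm [ym em]] := wmul_affine m0; have [x3 [y3 e3]] := wmul_affine m2.
have cm := wmul_curve cQ m.
have hD := wmulD rat_char2 rat_smooth cQ m m.
rewrite addnn -mul2n em e3 in hD; rewrite em in cm; rewrite em e3 /=.
exact: hC cm hD.
Qed.

(** Pigeonhole: the positive multiples of [Q] have distinct abscissas, and [N] exceeds the number of
    pairs of a numerator, shifted by [M], and a denominator that height at most [M] allows. *)
Lemma xheight_unbounded M : exists2 n, (0 < n)%N & (M < xh n)%N.
Proof.
pose N := ((2 * M).+1 * M.+1).+1.
have [/existsP[i Hi]|/existsPn Hno] := boolP [exists i : 'I_N, (M < xh i.+1)%N].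
  by exists i.+1.
have bounded (i : 'I_N) : (xh i.+1 <= M)%N by rewrite leqNgt Hno.
pose X (i : 'I_N) : rat := if wmul a i.+1 Q is Some (x, _) then x else 0.
have eX (i : 'I_N) : exists y, wmul a i.+1 Q = Some (X i, y).
  by have [x [y e]] := wmul_affine (ltn0Sn i); exists y; rewrite /X e.
have hX (i : 'I_N) : (`|numq (X i)| <= M)%N /\ (`|denq (X i)| <= M)%N.
  have [y e] := eX i; have := bounded i; rewrite /xh e /= /height geq_max.
  by move=> /andP[].
pose g (i : 'I_N) : 'I_(2 * M).+1 * 'I_M.+1 := (inord `|numq (X i) + M%:Z|, inord `|denq (X i)|).
have g_inj : injective g.
  move=> i j [] /(congr1 val) /=; have [ni di] := hX i; have [nj dj] := hX j.
  rewrite !inordK; [ | lia | lia] => en /(congr1 val) /=.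
  rewrite !inordK // => ed.
  have enq : numq (X i) = numq (X j) by move: ni nj en; clear; lia.
  have edq : denq (X i) = denq (X j).
    by have := denq_gt0 (X i); have := denq_gt0 (X j); move: ed; clear; lia.
  have eXij : X i = X j by rewrite -(divq_num_den (X i)) enq edq divq_num_den.
  apply/eqP; apply: contraTT isT => nij.
  have [yi ei] := eX i; have [yj ej] := eX j.
  have := @wmul_x_inj i.+1 j.+1 _ _ _ _ isT isT _ ei ej.
  by rewrite eqSS => /(_ nij); rewrite eXij eqxx.
by have := leq_card g g_inj; rewrite card_prod !card_ord /N ltnn.
Qed.

Local Notation lnh n := (ln (INR (xh n))).

Lemma height_growth :
  (exists K, forall n, (0 < n)%N -> Rle (lnh n) (Rmult K (pow (INR n) 2))) /\
  (exists2 c, Rlt 0 c & exists n0, forall n, (n0 <= n)%N -> Rle (Rmult c (pow (INR n) 2)) (lnh n)).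
Proof.
have [C1 hC1] := xheight_parallelogram; have [C2 hC2] := xheight_duplication.
pose C := ln (INR (C1 + C2).+1).
have xh0 n : (0 < xh n)%N by exact: xheight_gt0.
have f0 n : Rle 0 (lnh n) by exact: lnN_ge0.
have fP (m n : nat) : lt 0 n /\ lt n m ->
    Rle (Rplus (lnh (Nat.add m n)) (lnh (Nat.sub m n)))
        (Rplus (Rplus (Rmult 2 (lnh m)) (Rmult 2 (lnh n))) C).
  move=> [/ssrnat.ltP n0 /ssrnat.ltP nm]; have nm' : (0 < n < m)%N by rewrite n0.
  have := lnN_le _ (leq_trans (hC1 m n nm') (_ : _ <= (C1 + C2).+1 * (xh m * xh n) ^ 2)%N).
  rewrite !lnN_M ?lnN_X ?expn_gt0 ?muln_gt0 ?xh0 ?lnN_M // => /(_ isT).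
  rewrite -/C leq_mul ?leqW ?leq_addr // => /(_ isT) /=.
  rewrite /addn /subn /=; lra.
have fD (m : nat) : lt 0 m -> Rle (Rmult 4 (lnh m)) (Rplus (lnh (Nat.mul 2 m)) C).
  move=> /ssrnat.ltP m0.
  have := lnN_le _ (leq_trans (hC2 m m0) (_ : _ <= (C1 + C2).+1 * xh (2 * m))%N).
  rewrite lnN_X // lnN_M // expn_gt0 xh0 => /(_ isT).
  rewrite -/C leq_mul ?leqW ?leq_addl // => /(_ isT) /=.
  rewrite /muln /=; lra.
have fU M : exists2 n, lt 0 n & Rlt M (lnh n).
  have [k hk] := INR_unbounded (exp M).
  have [n n0 hn] := xheight_unbounded k; exists n; first exact/ssrnat.ltP.
  rewrite -(ln_exp M); apply: ln_increasing; first exact: exp_pos.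
  by apply: Rlt_trans hk _; apply: lt_INR; exact/ssrnat.ltP.
split.
  have [K hK] := quadratic_upper f0 fP; exists K => n /ssrnat.ltP; exact: hK.
have [c c0 [n0 hc]] := quadratic_lower f0 fP fD fU.
by exists c => //; exists n0 => n /ssrnat.leP; exact: hc.
Qed.

End HeightGrowth.

(** * The radical and the ABC conjecture *)

Section Radical.
Local Open Scope nat_scope.

Lemma leq_prod_sub (s1 s2 : seq nat) : uniq s1 -> {subset s1 <= s2} ->
  all (leq 1) s2 -> \prod_(p <- s1) p <= \prod_(p <- s2) p.
Proof.
elim: s1 s2 => [|x s1 IH] s2 /=.
  move=> _ _; rewrite big_nil; elim: s2 => [|y s2 IH]; first by rewrite big_nil.
  by rewrite big_cons /= muln_gt0 => /andP[-> /IH].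
move=> /andP[xs us] sub all2; have x2 : x \in s2 by rewrite sub ?mem_head.
rewrite big_cons (perm_big _ (perm_to_rem x2)) /= big_cons leq_mul // IH //; last first.
  by apply/allP => y /mem_rem; move/allP: all2; exact.
move=> y ys; have := sub y; rewrite inE ys orbT => /(_ isT).
rewrite (perm_mem (perm_to_rem x2)) inE => /orP[/eqP e|//].
by rewrite -e ys in xs.
Qed.

Lemma rad_gt0 m : 0 < rad m.
Proof. by rewrite /Defs.rad big_seq prodn_cond_gt0 // => p; rewrite mem_primes => /andP[/prime_gt0]. Qed.

Lemma primes_ge1 m : all (leq 1) (primes m).
Proof. by apply/allP => p; rewrite mem_primes => /andP[/prime_gt0]. Qed.

Lemma rad_leq_dvd m n : 0 < n -> (forall p, prime p -> p %| m -> p %| n) -> rad m <= rad n.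
Proof.
move=> n0 sub; apply: leq_prod_sub; rewrite ?primes_uniq ?primes_ge1 // => p.
by rewrite !mem_primes => /and3P[pp _ pm]; rewrite pp n0 sub.
Qed.

Lemma rad_mul m n : 0 < m -> 0 < n -> rad (m * n) <= rad m * rad n.
Proof.
move=> m0 n0; rewrite /Defs.rad -big_cat; apply: leq_prod_sub; rewrite ?primes_uniq //.
  by move=> p; rewrite mem_cat primesM.
by rewrite all_cat !primes_ge1.
Qed.

Lemma dvdn_prod_primes (s : seq nat) m : uniq s -> all prime s ->
  (forall p, p \in s -> p %| m) -> \prod_(p <- s) p %| m.
Proof.
elim: s => [|p s IH] /=; first by rewrite big_nil dvd1n.
move=> /andP[ps us] /andP[pp prs] dv; rewrite big_cons Gauss_dvd.
  by rewrite dv ?mem_head // IH // => q qs; apply: dv; rewrite inE qs orbT.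
rewrite prime_coprime //; apply: contra ps.
elim: s prs {IH us dv} => [|q s IH] /=; first by rewrite big_nil dvdn1 => _ /eqP e; rewrite e in pp.
move=> /andP[qq prs]; rewrite big_cons Euclid_dvdM // => /orP[|/(IH prs) h]; last by rewrite inE h orbT.
by rewrite dvdn_prime2 // => /eqP->; rewrite mem_head.
Qed.

Lemma rad_leq m : 0 < m -> rad m <= m.
Proof.
move=> m0; apply: dvdn_leq => //; apply: dvdn_prod_primes; rewrite ?primes_uniq //.
  by apply/allP => p; rewrite mem_primes => /andP[].
by move=> p; rewrite mem_primes => /and3P[].
Qed.
End Radical.

(** The conjecture is applied to the triple divided by its gcd, which costs at most [ln G]. The
    value [1 / 10] of epsilon is fixed once and for all: any value below [1 / 5] leaves a positive
    multiple of the height in the application. *)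
Lemma ABC_ln : ABC_conjecture -> exists C : R, forall (G r : nat) (X Y Z : int),
  X != 0 -> Y != 0 -> Z != 0 -> X + Y + Z = 0 -> (gcdn `|X| `|Y| <= G)%N ->
  (0 < r)%N -> (forall p, prime p -> (p %| `|(X * Y * Z)%R|)%N -> (p %| r)%N) ->
  Rle (ln (INR (maxn `|X| `|Y|))) (C + ln (INR G) + 11 / 10 * ln (INR (rad r)))%coqR.
Proof.
move=> /(_ (1/10)%coqR) [|K hK]; first by lra.
exists (ln (Rmax K 1)) => G r X Y Z X0 Y0 Z0 XYZ hG r0 hr.
set g := gcdn `|X| `|Y|; have g0 : (0 < g)%N by rewrite gcdn_gt0 absz_gt0 X0.
have gz0 : g%:Z != 0 by rewrite -absz_gt0.
have /dvdzP[x ex] : (g %| X)%Z by rewrite dvdzE dvdn_gcdl.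
have /dvdzP[y ey] : (g %| Y)%Z by rewrite dvdzE dvdn_gcdr.
have ez : Z = (- x - y) * g by move/eqP: XYZ; rewrite addrC addr_eq0 => /eqP->; rewrite ex ey; ring.
set z := - x - y in ez.
have x0 : x != 0 by apply: contraNneq X0 => x0; rewrite ex x0 mul0r.
have y0 : y != 0 by apply: contraNneq Y0 => y0; rewrite ey y0 mul0r.
have z0 : z != 0 by apply: contraNneq Z0 => z0; rewrite ez z0 mul0r.
have cop : gcdz x y = 1.
  have : (gcdn `|x| `|y| * g = g)%N by rewrite muln_gcdl {3}/g ex ey !abszM.
  by move=> /eqP; rewrite -{2}[g]mul1n eqn_pmul2r // => /eqP e; rewrite /gcdz e.
have := hK x y z x0 y0 z0; rewrite cop gcd1z => /(_ erefl).
have xyz : x + y + z = 0 by rewrite /z; ring.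
move=> /(_ xyz) main.
have rad_le : (rad `|(x * y * z)%R| <= rad r)%N.
  apply: rad_leq_dvd => // p pp pd; apply: hr => //.
  rewrite ex ey ez; apply: dvdn_trans pd _; rewrite !abszM.
  by rewrite !dvdn_mul // dvdn_mulr.
have max_le : (maxn `|X| `|Y| <= G * maxn `|x| (maxn `|y| `|z|))%N.
  rewrite ex ey !abszM /= -maxnMl mulnC leq_mul // maxnA leq_max leqnn //.
have max0 : (0 < maxn `|x| (maxn `|y| `|z|))%N by rewrite leq_max absz_gt0 x0.
have G0 : (0 < G)%N by exact: leq_trans g0 hG.
have MX : (0 < maxn `|X| `|Y|)%N by rewrite leq_max absz_gt0 X0.
apply: Rle_trans (lnN_le MX max_le) _; rewrite lnN_M //.
have K1 : Rle 1 (Rmax K 1) by exact: Rmax_r.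
have Rpos : Rlt 0 (Rpower (INR (rad `|(x * y * z)%R|)) (1 + 1 / 10)%coqR) by exact: exp_pos.
have M2 : Rle (INR (maxn `|x| (maxn `|y| `|z|)))
   (Rmult (Rmax K 1) (Rpower (INR (rad `|(x * y * z)%R|)) (1 + 1 / 10)%coqR)).
  apply: Rle_trans main _; apply: Rmult_le_compat_r; first by lra.
  exact: Rmax_l.
have := ln_le (INR_gt0 max0) M2; rewrite ln_mult //; last by lra.
rewrite /Rpower ln_exp => M3.
have := lnN_le (rad_gt0 _) rad_le; lra.
Qed.

Lemma ell_denom_eqn (A B : int) (x y : rat) (d : nat) :
  wcurve A%:~R B%:~R (Some (x, y)) -> is_ell_denom (Some (x, y)) d ->
  (0 < d)%N /\ exists a b : int, [/\ coprimez a d, coprimez b d, height x = maxn `|a| (d ^ 2) &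
    b ^+ 2 = a ^+ 3 + A * a * d%:Z ^+ 4 + B * d%:Z ^+ 6].
Proof.
move=> /eqP e [d0 [a [b [ca [cb [ex ey]]]]]]; split => //; exists a, b.
have cad : coprime `|a| (d ^ 2) by rewrite coprimeXr.
have ex' : x = a%:~R / (d ^ 2)%N%:Z%:~R by rewrite ex pmulrn.
split=> //.
  have d20 : (d ^ 2)%N%:Z != 0 by rewrite -lt0n expn_gt0 d0.
  rewrite /height ex' coprimeq_num // coprimeq_den // (negPf d20).
  by rewrite gtr0_sg ?mul1r // ltz_nat expn_gt0 d0.
have dr : (d%:R : rat) != 0 by rewrite pnatr_eq0 -lt0n.
apply/eqP; rewrite -(eqr_int rat) !(rmorphD, rmorphM, rmorphXn) /= -pmulrn.
apply/eqP; move: e; rewrite /cubic ex ey !natrX => e.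
have := congr1 (fun z => z * d%:R ^+ 6) e.
rewrite (_ : _ ^+ 2 * _ = b%:~R ^+ 2); last by field.
by rewrite -[b%:~R * _]expr2 => ->; field.
Qed.

(** With [h = ln H] and [b ^ 2 << H ^ 3], the conjecture gives [3 h <= 11/10 (h + 3/2 h) + ...] if
    [A = 0] and [2 h <= 11/10 (3/2 h) + ...] if [B = 0]. At least [h / 4] survives against
    [11/10 ln (rad d)]; the constants 8, 4 and 10 are rounded up. *)
Lemma ABC_rad_lower (A B : int) : ABC_conjecture ->
  4%:R * A ^+ 3 + 27%:R * B ^+ 2 != 0 -> (A == 0) || (B == 0) ->
  exists C, forall x y d, wcurve A%:~R B%:~R (Some (x, y)) -> is_ell_denom (Some (x, y)) d ->
  Rle (ln (INR (height x))) (C + 8 * ln (INR (rad d)))%coqR.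
Proof.
move=> /ABC_ln[C hC] disc AB.
pose N := (1 + `|A| + `|B|)%N; pose L := ln (INR N).
have N0 : (0 < N)%N by [].
have L0 : Rle 0 L by exact: lnN_ge0.
exists (L + 4 * (Rabs C + 10 * L))%coqR => x y d cxy dxy.
have [d0 [a [b [cad cbd -> eqn]]]] := ell_denom_eqn cxy dxy.
set H := maxn _ _; have H0 : (0 < H)%N by rewrite leq_max expn_gt0 d0 orbT.
have aH : (`|a| <= H)%N by rewrite leq_maxl.
have dH : (d ^ 2 <= H)%N by rewrite leq_maxr.
have rad0 : Rle 0 (ln (INR (rad d))) by exact: lnN_ge0 (rad_gt0 d).
have lnH0 : Rle 0 (ln (INR H)) by exact: lnN_ge0.
have C0 := Rle_abs C; have C1 := Rabs_pos C.
(* The conjecture forbids zero terms. But [a = 0] or [b = 0] forces [d = 1] by coprimality, and the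
   height is then at most [N]. *)
have small : (H <= N)%N -> Rle (ln (INR H)) (L + 4 * (Rabs C + 10 * L) + 8 * ln (INR (rad d)))%coqR.
  by move=> HN; have := lnN_le H0 HN; rewrite -/L; lra.
have d1H : d = 1%N -> H = maxn `|a| 1 by rewrite /H => ->.
have [a0|a0] := eqVneq a 0.
  apply: small; rewrite d1H ?a0 //; move: cad; rewrite a0 /coprimez gcd0z.
  by move=> /eqP[].
have aN0 : (0 < `|a|)%N by rewrite absz_gt0.
have [b0|b0] := eqVneq b 0.
  have d1 : d = 1%N by move: cbd; rewrite b0 /coprimez gcd0z => /eqP[].
  apply: small; rewrite d1H // geq_max N0 andbT.
  move: eqn; rewrite b0 d1 !expr1n !mulr1 expr0n /= => /esym/eqP.
  have [A0|A0] := eqVneq A 0.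
    rewrite A0 mul0r addr0 addr_eq0 => /eqP e3.
    have : (`|a| <= `|a| ^ 3)%N by rewrite !expnS leq_pmulr // !muln_gt0 aN0.
    by rewrite -abszX e3 abszN => /leq_trans -> //; rewrite /N leq_addl.
  move: AB; rewrite (negPf A0) /= => /eqP ->; rewrite addr0.
  rewrite [a ^+ 3]exprS [A * a]mulrC -mulrDr mulf_eq0 (negPf a0) /= addr_eq0 => /eqP e2.
  have : (`|a| <= `|a| ^ 2)%N by rewrite !expnS leq_pmulr // !muln_gt0 aN0.
  by rewrite -abszX e2 abszN => /leq_trans -> //; rewrite /N addnAC leq_addl.
have bN0 : (0 < `|b|)%N by rewrite absz_gt0.
have dz0 : d%:Z != 0 by rewrite -lt0n.
have BN : (`|B| <= N)%N by rewrite /N leq_addl.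
have AN : (`|A| <= N)%N by rewrite /N addnAC leq_addl.
have lnN n : (0 < n)%N -> (n <= N)%N -> Rle (ln (INR n)) L by exact: lnN_le.
have [A0|A0] := eqVneq A 0.
  have B0 : B != 0 by apply: contraNneq disc => B0; rewrite A0 B0.
  have BN0 : (0 < `|B|)%N by rewrite absz_gt0.
  have r0 : (0 < `|a| * `|b| * `|B| * d)%N by rewrite !muln_gt0 aN0 bN0 BN0.
  have := hC `|B|%N _ (a ^+ 3) (B * d%:Z ^+ 6) (- b ^+ 2) _ _ _ _ _ r0 _.
  rewrite expf_neq0 // mulf_neq0 ?expf_neq0 // oppr_eq0 expf_neq0 //.
  have -> : a ^+ 3 + B * d%:Z ^+ 6 - b ^+ 2 = 0 by rewrite eqn A0; ring.
  move=> /(_ isT isT isT erefl) /= main.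
  have G1 : (gcdn `|(a ^+ 3)%R| `|(B * d%:Z ^+ 6)%R| <= `|B|)%N.
    apply: dvdn_leq => //; rewrite !(abszM, abszX) /=.
    rewrite -(@Gauss_dvdl _ _ (d ^ 6)) ?dvdn_gcdr //.
    rewrite (coprime_dvdl (dvdn_gcdl _ _)) // coprimeXl // coprimeXr //.
  have dvr p : prime p -> (p %| `|(a ^+ 3 * (B * d%:Z ^+ 6) * - b ^+ 2)%R|)%N ->
      (p %| `|a| * `|b| * `|B| * d)%N.
    move=> pp; rewrite !(abszM, abszN, abszX) /= !Euclid_dvdM //.
    by do 4?[case: (dvdn p _) => //=].
  have {}main := main G1 dvr.
  have H3 : (H ^ 3 <= maxn `|(a ^+ 3)%R| `|(B * d%:Z ^+ 6)%R|)%N.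
    rewrite abszM !abszX /= /H; case: (leqP `|a|%N (d ^ 2)) => _; rewrite leq_max ?leqnn // -expnM.
    by rewrite [X in _ || X]leq_pmull ?orbT.
  have b2 : (`|b| ^ 2 <= N * H ^ 3)%N.
    have -> : N = (1 + `|B|)%N by rewrite /N A0 addn0.
    rewrite -abszX eqn A0 !mul0r addr0 mulnDl mul1n.
    apply: abszD_leq; first by rewrite abszX leq_exp2r.
    by rewrite abszM abszX leq_mul // -[6%N]/(2 * 3)%N expnM leq_exp2r.
  have lr : (rad (`|a| * `|b| * `|B| * d) <= `|a| * `|b| * `|B| * rad d)%N.
    apply: leq_trans (rad_mul _ d0) _; rewrite ?muln_gt0 ?aN0 ?bN0 //.
    by rewrite leq_mul // rad_leq // !muln_gt0 aN0 bN0.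
  have := lnN_le (rad_gt0 _) lr; have := lnN_le _ b2; have := lnN_le _ H3.
  have := lnN_le aN0 aH; have := lnN _ BN0 BN.
  rewrite !lnN_M ?muln_gt0 ?expn_gt0 ?aN0 ?bN0 ?H0 ?BN0 ?rad_gt0 //.
  rewrite -/L => h1 h2 /(_ isT) h3 /(_ isT) h4 h5; lra.
have B0 : B = 0 by move: AB; rewrite (negPf A0) => /eqP.
have AN0 : (0 < `|A|)%N by rewrite absz_gt0.
(* The terms [a ^+ 3] and [A * a * d ^+ 4] share the factor [a], which is divided out. The radical
   stays under control because [b ^+ 2 = a * c] puts the primes of [a] and [c] among those of
   [b]. *)
pose c := a ^+ 2 + A * d%:Z ^+ 4.
have bac : b ^+ 2 = a * c by rewrite eqn B0 /c; ring.
have c0 : c != 0.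
  by apply: contraNneq b0 => c0; move/eqP: bac; rewrite c0 mulr0 sqrf_eq0.
have r0 : (0 < `|b| * `|A| * d)%N by rewrite !muln_gt0 bN0 AN0.
have := hC `|A|%N _ (a ^+ 2) (A * d%:Z ^+ 4) (- c) _ _ _ _ _ r0 _.
rewrite expf_neq0 // mulf_neq0 ?expf_neq0 // oppr_eq0 c0 subrr.
move=> /(_ isT isT isT erefl) /= main.
have G1 : (gcdn `|(a ^+ 2)%R| `|(A * d%:Z ^+ 4)%R| <= `|A|)%N.
  apply: dvdn_leq => //; rewrite !(abszM, abszX) /=.
  rewrite -(@Gauss_dvdl _ _ (d ^ 4)) ?dvdn_gcdr //.
  rewrite (coprime_dvdl (dvdn_gcdl _ _)) // coprimeXl // coprimeXr //.
have dvr p : prime p -> (p %| `|(a ^+ 2 * (A * d%:Z ^+ 4) * - c)%R|)%N ->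
    (p %| `|b| * `|A| * d)%N.
  move=> pp.
  have pac : (p %| `|a| * `|c|)%N -> (p %| `|b|)%N.
    by rewrite -abszM -bac abszX Euclid_dvdX // andbT.
  rewrite Euclid_dvdM // in pac; move: pac.
  rewrite !(abszM, abszN, abszX) /= !Euclid_dvdM //.
  by do 5?[case: (dvdn p _) => //=].
have {}main := main G1 dvr.
have H2 : (H ^ 2 <= maxn `|(a ^+ 2)%R| `|(A * d%:Z ^+ 4)%R|)%N.
  rewrite abszM !abszX /= /H; case: (leqP `|a|%N (d ^ 2)) => _; rewrite leq_max ?leqnn // -expnM.
  by rewrite [X in _ || X]leq_pmull ?orbT.
have b2 : (`|b| ^ 2 <= N * H ^ 3)%N.
  have -> : N = (1 + `|A|)%N by rewrite /N B0 addn0.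
  rewrite -abszX bac abszM [(H ^ 3)%N]expnS mulnCA leq_mul //.
  rewrite mulnDl mul1n; apply: abszD_leq; first by rewrite abszX leq_exp2r.
  by rewrite abszM abszX leq_mul // -[4%N]/(2 * 2)%N expnM leq_exp2r.
have lr : (rad (`|b| * `|A| * d) <= `|b| * `|A| * rad d)%N.
  apply: leq_trans (rad_mul _ d0) _; rewrite ?muln_gt0 ?bN0 //.
  by rewrite leq_mul // rad_leq // !muln_gt0 bN0.
have := lnN_le (rad_gt0 _) lr; have := lnN_le _ b2; have := lnN_le _ H2.
have := lnN _ AN0 AN.
rewrite !lnN_M ?muln_gt0 ?expn_gt0 ?aN0 ?bN0 ?H0 ?AN0 ?rad_gt0 //.
rewrite -/L => h1 /(_ isT) h3 /(_ isT) h4 h5; lra.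
Qed.

(** * Counting points over finite fields *)

Section CharacterSums.
Variable F : finFieldType.

Lemma finField_primitive_root : exists g : F, #|F|.-1.-primitive_root g.
Proof.
have card0 : #|[set~ (0 : F)]| = #|F|.-1 by rewrite cardsC1.
have q1 := finNzRing_gt1 F.
have : has #|F|.-1.-primitive_root (enum [set~ (0 : F)]).
  apply: has_prim_root; rewrite ?enum_uniq -?cardE ?card0 //; first by rewrite -ltnS (ltn_predK q1).
  apply/allP => x; rewrite mem_enum !inE => x0; rewrite unity_rootE.
  by apply/eqP/(mulfI x0); rewrite -exprS (ltn_predK q1) expf_card mulr1.
by case/hasP => g _ hg; exists g.
Qed.

Definition chi (x : F) : int := if x == 0 then 0 else if [exists y, y ^+ 2 == x] then 1 else -1.

Hypothesis char2 : 2%:R != 0 :> F.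
Variable g : F.
Hypothesis g_prim : #|F|.-1.-primitive_root g.
Local Notation m := #|F|.-1.

Lemma card_predF : #|F| = m.+1.
Proof. by rewrite (ltn_predK (finNzRing_gt1 F)). Qed.

Lemma g_neq0 : g != 0.
Proof.
apply: contra_eq_neq (prim_expr_order g_prim) => ->.
by rewrite expr0n (gtn_eqF (prim_order_gt0 g_prim)) eq_sym oner_neq0.
Qed.

Lemma powP x : x != 0 -> exists j : 'I_m, x = g ^+ j.
Proof.
move=> x0; have [|j ->] := @prim_rootP _ _ _ g_prim x; last by exists j.
by apply: (mulfI x0); rewrite -exprS -card_predF expf_card mulr1.
Qed.

Lemma even_order : ~~ odd m.
Proof.
have [j ej] : exists j : 'I_m, -1 = g ^+ j by apply: powP; rewrite oppr_eq0 oner_neq0.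
apply/negP => om; have : (m %| j * 2)%N.
  by rewrite (prim_order_dvd g_prim) exprM -ej sqrrN expr1n.
rewrite Gauss_dvdl ?coprimen2 // (prim_order_dvd g_prim) -ej -subr_eq0 -opprD oppr_eq0.
by rewrite (negPf char2).
Qed.

Lemma chi0 : chi 0 = 0. Proof. by rewrite /chi eqxx. Qed.

Lemma chi_pow j : chi (g ^+ j) = (-1) ^+ j.
Proof.
rewrite /chi expf_eq0 (negPf g_neq0) andbF -signr_odd.
case: existsP => [[y /eqP ey]|no].
  have y0 : y != 0.
    by apply: contraTneq (expf_neq0 j g_neq0) => y0; rewrite -ey y0 expr0n eqxx.
  have [k ek] := powP y0; move: ey; rewrite ek -exprM => /eqP.
  rewrite (eq_prim_root_expr g_prim) => /eqP /(congr1 odd).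
  by rewrite !odd_mod ?(negbTE even_order) // oddM andbF => <-.
have [//|/negbTE e] := boolP (odd j).
case: no; exists (g ^+ j./2); rewrite -exprM muln2 -{2}(odd_double_half j) e.
by rewrite add0n.
Qed.

Lemma chiM x y : chi (x * y) = chi x * chi y.
Proof.
have [->|x0] := eqVneq x 0; first by rewrite mul0r chi0 mul0r.
have [->|y0] := eqVneq y 0; first by rewrite mulr0 chi0 mulr0.
have [i ->] := powP x0; have [j ->] := powP y0.
by rewrite -exprD !chi_pow exprD.
Qed.

Lemma chi1 : chi 1 = 1. Proof. by rewrite -(expr0 g) chi_pow. Qed.

Lemma chi_sqr x : x != 0 -> chi x * chi x = 1.
Proof. by move=> /powP[i ->]; rewrite chi_pow -expr2 sqrr_sign. Qed.

Lemma chi_g : chi g = -1. Proof. by rewrite -(expr1 g) chi_pow. Qed.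

Lemma sum_scale (R : nmodType) (f : F -> R) c : c != 0 -> \sum_x f (c * x) = \sum_x f x.
Proof.
by move=> c0; rewrite [RHS](reindex_inj (mulfI c0)).
Qed.

Lemma sum_shift (R : nmodType) (f : F -> R) c : \sum_x f (c + x) = \sum_x f x.
Proof. by rewrite [RHS](reindex_inj (addrI c)). Qed.

Lemma sum_chi : \sum_x chi x = 0.
Proof.
have := sum_scale chi g_neq0; under eq_bigr do rewrite chiM chi_g mulN1r.
by rewrite sumrN => /eqP; rewrite eq_sym -subr_eq0 opprK -mulr2n mulrn_eq0 /= => /eqP.
Qed.

Lemma card_sqrt x : (#|[set y : F | y ^+ 2 == x]|)%:Z = 1 + chi x.
Proof.
rewrite /chi; have [->|x0] := eqVneq x 0.
  rewrite (_ : [set y | _] = [set 0]) ?cards1 //.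
  by apply/setP => y; rewrite !inE sqrf_eq0.
case: existsP => [[z /eqP ez]|no].
  rewrite (_ : [set y | _] = [set z; -z]).
    rewrite cards2 -addr_eq0 -mulr2n -mulr_natl mulf_eq0 (negPf char2) /=.
    by rewrite -sqrf_eq0 ez x0.
  by apply/setP => y; rewrite !inE -ez eqf_sqr.
rewrite (_ : [set y | _] = set0) ?cards0 //.
by apply/setP => y; rewrite !inE; apply/negbTE/negP => ey; apply: no; exists y.
Qed.

(** For [u != v] put [d = v - u]. A shift leads to [chi (c * (c + d))], which is [chi (1 + d / c)]
    for nonzero [c]; the argument takes every value except 1, so the total is [0 - chi 1]. *)
Lemma sum_chi_pair u v :
  \sum_c chi ((u + c) * (v + c)) = (if u == v then #|F|%:Z else 0) - 1.
Proof.
case: eqVneq => [<-|uv].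
  rewrite (sum_shift (fun c => chi (c * c)) u) (bigD1 0) //= mulr0 chi0 add0r.
  rewrite (eq_bigr (fun => 1)) => [|c c0]; last by rewrite chiM chi_sqr.
  by rewrite sumr_const cardC1 card_predF /=; lia.
have d0 : v - u != 0 by rewrite subr_eq0 eq_sym.
rewrite -(sum_shift _ (- u)) (eq_bigr (fun c => chi (c * (c + (v - u))))); last first.
  by move=> c _; congr chi; ring.
rewrite (bigD1 0) //= mul0r chi0 !add0r.
rewrite (eq_bigr (fun c => chi (1 + (v - u) * c^-1))); last first.
  move=> c c0; rewrite -[RHS]mul1r -(chi_sqr c0) -!chiM; congr chi.
  by field.
rewrite (reindex_inj invr_inj) /=.
rewrite (eq_bigl (fun c => c != 0)) => [|c]; last by rewrite invr_eq0.
under eq_bigr do rewrite invrK.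
have := sum_scale (fun c => chi (1 + c)) d0; rewrite (bigD1 0) //= mulr0 addr0 chi1.
rewrite sum_shift sum_chi => /eqP; rewrite addrC addr_eq0 => /eqP ->.
by [].
Qed.

Lemma sum_powers (R : nmodType) (f : F -> R) a : a != 0 ->
  \sum_x f x = f 0 + \sum_(j < m) f (a * g ^+ j).
Proof.
move=> a0; rewrite (bigD1 0) //=; congr (_ + _).
pose h (j : 'I_m) := a * g ^+ j.
have h_inj : injective h.
  move=> i j /(mulfI a0)/eqP; rewrite (eq_prim_root_expr g_prim) !modn_small //.
  by move/eqP/val_inj.
rewrite -(big_imset f (A := 'I_m) (h := h)) /=; last by move=> i j _ _; exact: h_inj.
apply: eq_bigl => x; apply/idP/imsetP => [x0|[j _ ->]]; last first.
  by rewrite mulf_neq0 // expf_neq0 // g_neq0.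
have [|j ej] := @powP (x / a); first by rewrite mulf_neq0 ?invr_eq0.
by exists j => //; rewrite /h -ej mulrC divfK.
Qed.

Lemma sum_periodic (R : nmodType) (G : nat -> R) r n : (forall j, G (j + r)%N = G j) ->
  \sum_(j < r * n) G j = (\sum_(j < r) G j) *+ n.
Proof.
move=> per; elim: n => [|n IH]; first by rewrite muln0 big_ord0.
rewrite mulnS addnC big_split_ord /= IH mulrSr; congr (_ + _).
apply: eq_bigr => i _; elim: n {IH} => [|n IH]; first by rewrite muln0.
by rewrite mulnS -addnA addnC per.
Qed.

(** This is minus the trace of Frobenius. *)
Definition csum (a b : F) : int := \sum_x chi (cubic a b x).

Lemma card_wcurve a b :
  (#|[set P : option (F * F) | wcurve a b P]|)%:Z = #|F|%:Z + 1 + csum a b.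
Proof.
pose S := [set P : F * F | P.2 ^+ 2 == cubic a b P.1].
have -> : [set P : option (F * F) | wcurve a b P] = None |: [set Some P | P in S].
  apply/setP => -[[x y]|]; rewrite !inE //=.
  by apply/idP/imsetP => [e|[[x' y'] + [-> ->]]]; [exists (x, y); rewrite ?inE | rewrite inE].
rewrite cardsU1 card_imset; last exact: Some_inj.
have -> : None \notin [set Some P | P in S] by apply/imsetP => -[].
have -> : #|S| = (\sum_x #|[set y : F | y ^+ 2 == cubic a b x]|)%N.
  rewrite -sum1_card -[RHS](eq_bigr _ (fun x _ => sum1_card _)).
  rewrite pair_big_dep /=; apply: eq_bigl => -[x y]; by rewrite !inE.
rewrite PoszD rmorph_sum /= (eq_bigr _ (fun x _ => card_sqrt (cubic a b x))).
by rewrite big_split /= sumr_const natz /csum; ring.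
Qed.

Lemma chi_cube x : chi (x ^+ 3) = chi x.
Proof.
have [->|x0] := eqVneq x 0; first by rewrite expr0n.
by rewrite exprS chiM expr2 chiM chi_sqr // mulr1.
Qed.

Lemma csum00 : csum 0 0 = 0.
Proof.
rewrite -[RHS]sum_chi; apply: eq_bigr => x _.
by rewrite /cubic mul0r !addr0 chi_cube.
Qed.

(** Substitution of [k * x] for [x]: a quadratic twist only changes the sign of the sum. *)
Lemma csum_twist4 c k : k != 0 -> csum (c * k ^+ 2) 0 = chi k * csum c 0.
Proof.
move=> k0; rewrite /csum -(sum_scale _ k0) mulr_sumr; apply: eq_bigr => x _.
by rewrite -[chi k]chi_cube -chiM; congr chi; rewrite /cubic; ring.
Qed.

Lemma csum_twist6 c k : k != 0 -> csum 0 (c * k ^+ 3) = chi k * csum 0 c.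
Proof.
move=> k0; rewrite /csum -(sum_scale _ k0) mulr_sumr; apply: eq_bigr => x _.
by rewrite -[chi k]chi_cube -chiM; congr chi; rewrite /cubic; ring.
Qed.

(** With the sums exchanged, [chi x * chi z] is weighted by the correlation of [c + x ^+ 2] and
    [c + z ^+ 2], and only [z = x] and [z = - x] contribute. *)
Lemma sum_csum4 : \sum_c csum c 0 * csum c 0 = #|F|%:Z * m%:Z * (1 + chi (-1)).
Proof.
pose q := #|F|%:Z.
transitivity (\sum_x \sum_z chi x * chi z * ((if x ^+ 2 == z ^+ 2 then q else 0) - 1)).
  rewrite /csum; under eq_bigr do rewrite mulr_suml.
  under eq_bigr => c _ do under eq_bigr => x _ do rewrite mulr_sumr.
  rewrite exchange_big /=; apply: eq_bigr => x _; rewrite exchange_big /=.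
  apply: eq_bigr => z _; rewrite -sum_chi_pair mulr_sumr; apply: eq_bigr => c _.
  by rewrite -!chiM; congr chi; rewrite /cubic; ring.
transitivity (\sum_x \sum_z (if x ^+ 2 == z ^+ 2 then q * chi x * chi z else 0)).
  have z0 : \sum_x \sum_z chi x * chi z = 0.
    by rewrite big1 // => x _; rewrite -mulr_sumr sum_chi mulr0.
  rewrite -[RHS]subr0 -[X in _ = _ - X]z0 -sumrB; apply: eq_bigr => x _; rewrite -sumrB.
  by apply: eq_bigr => z _; case: ifP => _; ring.
rewrite (bigD1 0) //= big1 ?add0r; last by move=> z _; rewrite chi0 mulr0 mul0r if_same.
rewrite (eq_bigr (fun=> q * (1 + chi (-1)))); last first.
  move=> x x0; rewrite -big_mkcond /= (bigD1 x) //= (bigD1 (- x)) /=; last first.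
    by rewrite sqrrN eqxx /= eq_sym -addr_eq0 -mulr2n -mulr_natl mulf_neq0.
  rewrite big1 ?addr0; last first.
    by move=> z /andP[/andP[]]; rewrite eq_sym eqf_sqr => /orP[] ->.
  have -> : chi (- x) = chi (-1) * chi x by rewrite -chiM mulN1r.
  by apply: (eq_lc (lc0 (q * (1 + chi (-1))) (chi_sqr x0))); ring.
by rewrite sumr_const cardC1 -mulr_natr natz; ring.
Qed.

(** Up to sign, [csum (a * g ^+ j) 0] depends only on the parity of [j], so the second moment is
    [m / 2] times a sum of two squares, one for [a] and one for [a * g]. *)
Lemma csum_norm4 a : a != 0 -> exists w : int,
  csum a 0 ^+ 2 + w ^+ 2 = 2%:R * #|F|%:Z * (1 + chi (-1)).
Proof.
move=> a0; exists (csum (a * g) 0).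
have even_m : (2 * m./2)%N = m by rewrite mul2n -[RHS]odd_double_half (negbTE even_order).
have m2 : (0 < m./2)%N by move: (prim_order_gt0 g_prim); rewrite -{1}even_m; case: (m./2).
have := sum_csum4; rewrite (sum_powers _ a0) csum00 mul0r add0r.
rewrite -even_m (@sum_periodic _ (fun j => csum (a * g ^+ j) 0 * csum (a * g ^+ j) 0) 2); last first.
  by move=> j; rewrite exprD mulrA csum_twist4 ?g_neq0 // chi_g; ring.
rewrite big_ord_recr big_ord1 /= expr0 mulr1 expr1 => e.
have m2' : (m./2)%:Z != 0 by rewrite -lt0n.
apply: (mulIf m2'); move: e; rewrite -mulr_natr natz PoszM => e.
by apply: (eq_lc (lc0 1 e)); ring.
Qed.

Lemma csum_cube_bij b : ~~ (3 %| m)%N -> csum 0 b = 0.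
Proof.
move=> m3; have inj3 : injective (fun x : F => x ^+ 3).
  have xm (x : F) : x ^+ m.+1 = x by rewrite -card_predF expf_card.
  have xm2 (x : F) : x ^+ (m + m.+1)%N = x by rewrite exprD xm -exprSr xm.
  (* The exponents [m + 1] and [2 m + 1] both fix every [x], and one of them is a multiple of 3. *)
  have [u hu] : exists u, forall x : F, x ^+ (3 * u)%N = x.
    have := divn_eq m 3; have := ltn_mod m 3; move: m3; rewrite /dvdn.
    case: (m %% 3)%N => [|[|[|]]] // _ _ e.
      by exists (2 * (m %/ 3)).+1 => x; rewrite -[RHS]xm2; congr (_ ^+ _); rewrite {2 3}e; ring.
    by exists (m %/ 3).+1 => x; rewrite -[RHS]xm; congr (_ ^+ _); rewrite {2}e; ring.
  by apply: (can_inj (g := fun x => x ^+ u)) => x; rewrite -exprM.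
rewrite -[RHS]sum_chi -(sum_shift chi b) (reindex_inj inj3) /=.
by rewrite /csum; apply: eq_bigr => x _; congr chi; rewrite /cubic; ring.
Qed.

(** Only pairs with [x ^+ 3 = z ^+ 3] survive: three values of [z] for each nonzero [x], because the
    field contains the cube roots of unity. *)
Lemma sum_csum6 : (3 %| m)%N -> \sum_c csum 0 c * csum 0 c = 2%:R * #|F|%:Z * m%:Z.
Proof.
move=> m3; pose q := #|F|%:Z.
transitivity (\sum_(x : F) \sum_(z : F) ((if x ^+ 3 == z ^+ 3 then q else 0) - 1)).
  rewrite /csum; under eq_bigr do rewrite mulr_suml.
  under eq_bigr => c _ do under eq_bigr => x _ do rewrite mulr_sumr.
  rewrite exchange_big /=; apply: eq_bigr => x _; rewrite exchange_big /=.
  apply: eq_bigr => z _; rewrite -sum_chi_pair; apply: eq_bigr => c _.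
  by rewrite -!chiM; congr chi; rewrite /cubic; ring.
transitivity (\sum_(x : F) ((if x == 0 then q else 3%:R * q) - q)).
  apply: eq_bigr => x _; rewrite sumrB sumr_const; congr (_ - _); last exact: natz.
  rewrite -big_mkcond /=; have [->|x0] := eqVneq x 0.
    rewrite (bigD1 0) //= big1 ?addr0 // => z /andP[].
    by rewrite expr0n eq_sym expf_eq0 => /= ->.
  pose w := g ^+ (m %/ 3).
  have w3 : 3.-primitive_root w by exact: (dvdn_prim_root g_prim m3).
  have w1 : w != 1 by rewrite -(prim_order_dvd w3 1).
  have ww : 1 + w + w ^+ 2 = 0.
    apply: (mulfI (_ : w - 1 != 0)); first by rewrite subr_eq0.
    by rewrite mulr0; apply: (eq_lc (lc0 1 (prim_expr_order w3))); ring.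
  have w0 : w != 0 by rewrite expf_neq0 // g_neq0.
  rewrite (bigD1 x) //= (bigD1 (w * x)) /=; last first.
    rewrite exprMn (prim_expr_order w3) mul1r eqxx /= -subr_eq0 -{2}[x]mul1r -mulrBl.
    by rewrite mulf_neq0 // subr_eq0.
  rewrite (bigD1 (w ^+ 2 * x)) /=; last first.
    rewrite exprMn -exprM mulnC exprM (prim_expr_order w3) expr1n mul1r eqxx /=.
    apply/andP; split; rewrite -subr_eq0.
      by rewrite -{2}[x]mul1r -mulrBl mulf_neq0 // subr_eq0 -(prim_order_dvd w3).
    by rewrite -mulrBl mulf_neq0 // expr2 -{3}[w]mulr1 -mulrBr mulf_neq0 // subr_eq0.
  rewrite big1; first by ring.
  move=> z /andP[/andP[/andP[/eqP e zx] zwx] zw2x].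
  have : (z - x) * (z - w * x) * (z - w ^+ 2 * x) = 0.
    have w2 : w ^+ 2 = - 1 - w by apply: (eq_lc (lc0 1 ww)); ring.
    apply: (eq_lc (lcD (lc0 (-1) e) (lcD (lc0 (x ^+ 2 * z - x * z ^+ 2) ww) (lc0 (x ^+ 2 * z - x ^+ 3) (prim_expr_order w3))))).
    by ring.
  by move=> /eqP; rewrite !mulf_eq0 !subr_eq0 (negPf zx) (negPf zwx) (negPf zw2x).
rewrite (bigD1 (0 : F)) //= eqxx subrr add0r (eq_bigr (fun=> 2%:R * q)); last first.
  by move=> x /negPf ->; ring.
by rewrite sumr_const cardC1 -mulr_natr natz; ring.
Qed.

(* [V j] has period 3; its three values sum to 0 and their squares to [6 q]. *)
Lemma csum_norm6 b : b != 0 -> (3 %| m)%N -> exists w : int,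
  3%:R * csum 0 b ^+ 2 + w ^+ 2 = 12%:R * #|F|%:Z.
Proof.
move=> b0 m3; pose V j := (-1) ^+ j * csum 0 (b * g ^+ j).
have perV j : V (j + 3)%N = V j.
  by rewrite /V !exprD mulrA csum_twist6 ?g_neq0 // chi_g; ring.
(* From [V 1 + V 2 = - V 0], the square of the difference is [2 (V 1 ^ 2 + V 2 ^ 2) - V 0 ^ 2 = 12 q
   - 3 V 0 ^ 2]. *)
exists (V 1%N - V 2%N).
have em3 : (3 * (m %/ 3))%N = m by rewrite mulnC divnK.
have m30 : ((m %/ 3)%N)%:Z != 0.
  by rewrite -lt0n; move: (prim_order_gt0 g_prim); rewrite -{1}em3; case: (m %/ 3)%N.
have S2 := sum_csum6 m3.
rewrite (sum_powers _ b0) csum00 mul0r add0r in S2.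
rewrite (eq_bigr (fun j : 'I_m => V j * V j)) in S2; last first.
  move=> j _; rewrite /V; have := sqrr_sign int j; rewrite expr2 => h.
  by apply: (eq_lc (lc0 (- csum 0 (b * g ^+ j) ^+ 2) h)); ring.
(* The sign [(-1) ^+ j] is [chi b * chi (b * g ^+ j)], so this is the correlation of [csum 0] with
   [chi]. Exchanging the sums leaves [q] from [x = 0], minus 1 for each of the [q] values of [x]. *)
have S1 : \sum_(j < m) V j = 0.
  have : \sum_c chi c * csum 0 c = 0.
    rewrite /csum; under eq_bigr do rewrite mulr_sumr.
    rewrite exchange_big /= (eq_bigr (fun x => (if x == 0 then #|F|%:Z else 0) - 1)).
      rewrite sumrB -big_mkcond /= big_pred1_eq sumr_const natz; exact: subrr.
    move=> x _; have -> : (x == 0) = (0 == x ^+ 3) by rewrite [RHS]eq_sym expf_eq0.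
    rewrite -sum_chi_pair; apply: eq_bigr => c _.
    by rewrite -chiM; congr chi; rewrite /cubic; ring.
  rewrite (sum_powers _ b0) chi0 mul0r add0r => S0.
  have bb := chi_sqr b0.
  transitivity (chi b * \sum_(j < m) (chi (b * g ^+ j) * csum 0 (b * g ^+ j))); last by rewrite S0 mulr0.
  rewrite mulr_sumr; apply: eq_bigr => j _; rewrite chiM chi_pow /V.
  by apply: (eq_lc (lc0 (- ((-1) ^+ j * csum 0 (b * g ^+ j))) bb)); ring.
move: S1 S2; rewrite -em3 (@sum_periodic _ V 3) // (@sum_periodic _ (fun j => V j * V j) 3); last first.
  by move=> j; rewrite perV.
rewrite !big_ord_recr !big_ord0 /= !add0r => S1 S2; rewrite -mulr_natr natz in S1; rewrite -[(_ + _) *+ _]mulr_natr [(_ %/ _)%N%:R]natz in S2.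
have s1 : V 0%N + V 1%N + V 2%N = 0 by apply: (mulIf m30); rewrite S1 mul0r.
have s2 : V 0%N * V 0%N + V 1%N * V 1%N + V 2%N * V 2%N = 6%:R * #|F|%:Z.
  apply: (mulIf m30); rewrite S2 PoszM; ring.
have -> : csum 0 b = V 0%N by rewrite /V !expr0 mul1r mulr1.
by apply: (eq_lc (lcD (lc0 2%:R s2) (lc0 (V 0%N - V 1%N - V 2%N) s1))); ring.
Qed.

(** Adding [D * (4 s + 4)] to [D s ^ 2 + w ^ 2 = 4 D q] puts [4 D N] on the right. In this form a
    given [N] has few pairs [(w, s + 2)], and each returns [q = N - 1 - s]. *)
Lemma count_wcurve_norm a b (N := (#|[set P : option (F * F) | wcurve a b P]|)%:Z) :
  (a == 0) != (b == 0) ->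
  N = #|F|%:Z + 1 \/
  exists D s w : int, [/\ D = 1 \/ D = 3%:R, N = #|F|%:Z + 1 + s & w ^+ 2 + D * (s + 2%:R) ^+ 2 = 4%:R * D * N].
Proof.
rewrite /N card_wcurve; case: (eqVneq b 0) => [->|b0] /=.
  rewrite eqb_id => a0; have [w hw] := csum_norm4 a0.
  have [c1|c1] : chi (-1) = 1 \/ chi (-1) = -1 by rewrite /chi; case: ifP; [rewrite oppr_eq0 oner_eq0 | case: ifP; [left|right]].
    right; exists 1, (csum a 0), w; split; [by left | by [] |].
    by apply: (eq_lc (lc0 1 hw)); rewrite c1; ring.
  left; move: hw; rewrite c1 subrr mulr0 => /eqP.
  rewrite paddr_eq0 ?sqr_ge0 // sqrf_eq0 => /andP[/eqP -> _]; by rewrite addr0.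
rewrite eqbF_neg negbK => /eqP ->; have [m3|m3] := boolP (3 %| m)%N; last first.
  by left; rewrite csum_cube_bij // addr0.
have [w hw] := csum_norm6 b0 m3; right; exists 3%:R, (csum 0 b), w; split; [by right | by [] |].
by apply: (eq_lc (lc0 1 hw)); ring.
Qed.
End CharacterSums.

(** * Reduction modulo a prime *)

Section PointOrder.
Variables (F : finFieldType) (a b : F).
Hypothesis char2 : 2%:R != 0 :> F.
Hypothesis smooth : forall x, cubic a b x = 0 -> 3%:R * x ^+ 2 + a != 0.
Variable P : option (F * F).
Hypothesis cP : wcurve a b P.

(* Translation by [P] permutes the points, and all its orbits have the same size. *)
Lemma order_dvd_card : exists m, [/\ (0 < m)%N, wmul a m P = None,
  (m %| #|[set R : option (F * F) | wcurve a b R]|)%N &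
  forall n, wmul a n P = None -> (m %| n)%N].
Proof.
pose T := {R : option (F * F) | wcurve a b R}.
pose f (x : T) : T := exist _ (wadd a P (val x)) (wadd_curve cP (valP x)).
have f_inj : injective f.
  move=> x y /(congr1 val) /= e; apply: val_inj.
  by rewrite -(waddK char2 smooth cP (valP x)) e (waddK char2 smooth cP (valP y)).
have iter_f n x : val (iter n f x) = wadd a (wmul a n P) (val x).
  elim: n => [|n IH]; first by case: (val x) => [[]|].
  by rewrite /= IH (wadd_assoc char2 smooth cP (wmul_curve cP n) (valP x)).
have period n x : (iter n f x = x) <-> wmul a n P = None.
  have cn := wmul_curve cP n; split=> [/(congr1 val)|e]; last first.
    by apply: val_inj; rewrite iter_f e; case: (val x) => [[]|].
  rewrite iter_f => e; rewrite -[LHS](waddNK char2 smooth cn (wopp_curve (valP x))).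
  by rewrite woppK e (waddN (valP x)).
have order_le n (x : T) : (0 < n)%N -> wmul a n P = None -> (fingraph.order f x <= n)%N.
  move=> n0 /(period n x) e; rewrite leqNgt; apply/negP => no.
  have := orbit_uniq f x; rewrite /orbit => /uniqP - /(_ x) u.
  have := u 0%N n; rewrite !inE size_traject no fingraph.order_gt0 => /(_ isT isT).
  by rewrite !nth_traject ?fingraph.order_gt0 //= e => /(_ erefl) n0'; rewrite -n0' in n0.
pose O : T := exist _ None isT.
have order_eq x : fingraph.order f x = fingraph.order f O.
  have eO := iter_order f_inj O; have ex := iter_order f_inj x.
  apply/eqP; rewrite eqn_leq !order_le ?fingraph.order_gt0 //; [exact/(period _ x) | exact/(period _ O)].
have mP : wmul a (fingraph.order f O) P = None by apply/(period _ O); exact: iter_order.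
exists (fingraph.order f O); split=> //.
- have h := @fcard_order_set _ f f_inj (fingraph.order f O) predT.
  rewrite cardsE -card_sig (eq_card (B := (predT : {pred T}))) // -h ?dvdn_mull //.
  by apply/subsetP => x _; rewrite inE order_eq.
- move=> n e; have := divn_eq n (fingraph.order f O); set m := fingraph.order f O in mP order_le order_eq *.
  move=> en; rewrite /dvdn; apply/eqP/eqP; rewrite -leqn0 leqNgt; apply/negP => r0.
  have km k : wmul a (k * m) P = None.
    by elim: k => [//|k IH]; rewrite mulSn -(wmulD char2 smooth cP) mP IH.
  have er : wmul a (n %% m) P = None by rewrite -e {2}en -(wmulD char2 smooth cP) km.
  by have := order_le _ O r0 er; rewrite -/m leqNgt ltn_mod fingraph.order_gt0.
Qed.
End PointOrder.

Section Reduction.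
Variable p : nat.
Hypothesis p_pr : prime p.

Definition pint (x : rat) := ~~ (p %| `|denq x|)%N.
Definition red (x : rat) : 'F_p := (numq x)%:~R / (denq x)%:~R.

Lemma intr_Fp_eq0 (z : int) : (z%:~R == 0 :> 'F_p) = (p %| `|z|)%N.
Proof.
case: z => n; rewrite ?NegzE ?rmorphN ?oppr_eq0 ?abszN /= -pmulrn.
  by rewrite -(dvdn_pcharf (pchar_Fp p_pr)).
by rewrite -(dvdn_pcharf (pchar_Fp p_pr)).
Qed.

Lemma pint_frac (x : rat) (u v : int) : x = u%:~R / v%:~R -> ~~ (p %| `|v|)%N ->
  pint x /\ red x = u%:~R / v%:~R.
Proof.
move=> e pv; have v0 : v != 0 by apply: contraNneq pv => ->; rewrite dvdn0.
have [t eu ev] := rat_fraction v0 e.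
have pd : pint x by apply: contra pv => h; rewrite ev abszM dvdn_mull.
have t0 : t%:~R != 0 :> 'F_p by rewrite intr_Fp_eq0; apply: contra pv => h; rewrite ev abszM dvdn_mulr.
split=> //; rewrite /red {1}eu {1}ev !rmorphM /= invfM mulrACA divff // mul1r //.
Qed.

Lemma denq_Fp x : pint x -> (denq x)%:~R != 0 :> 'F_p.
Proof. by rewrite intr_Fp_eq0. Qed.

Lemma pint_int (z : int) : pint z%:~R /\ red z%:~R = z%:~R.
Proof.
have p1 : ~~ (p %| `|1%:Z|)%N by rewrite dvdn1; apply: contraTneq p_pr => ->.
by have [|h ->] := @pint_frac z%:~R z 1 _ p1; rewrite ?divr1.
Qed.

Lemma pintD x y : pint x -> pint y -> pint (x + y) /\ red (x + y) = red x + red y.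
Proof.
move=> px py; have dx := denq_Fp px; have dy := denq_Fp py.
have [||h ->] := @pint_frac (x + y) (numq x * denq y + numq y * denq x) (denq x * denq y).
- rewrite -{1}(divq_num_den x) -{1}(divq_num_den y) addf_div ?intr_eq0 ?denq_neq0 //.
  by rewrite !(rmorphD, rmorphM).
- by rewrite abszM Euclid_dvdM // negb_or; apply/andP.
- by split=> //; rewrite /red addf_div // !(rmorphD, rmorphM).
Qed.

Lemma pintM x y : pint x -> pint y -> pint (x * y) /\ red (x * y) = red x * red y.
Proof.
move=> px py; have dx := denq_Fp px; have dy := denq_Fp py.
have [||h ->] := @pint_frac (x * y) (numq x * numq y) (denq x * denq y).
- by rewrite -{1}(divq_num_den x) -{1}(divq_num_den y) mulf_div !rmorphM.
- by rewrite abszM Euclid_dvdM // negb_or; apply/andP.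
- by split=> //; rewrite /red mulf_div !rmorphM.
Qed.

Lemma pintN x : pint x -> pint (- x) /\ red (- x) = - red x.
Proof.
move=> px; rewrite -mulN1r; have [p1 r1] := pint_int (-1).
rewrite -[-1 : rat]/((-1 : int)%:~R); have [-> ->] := pintM p1 px.
by rewrite r1 mulN1r.
Qed.

Lemma pintV x : pint x -> red x != 0 -> pint x^-1 /\ red x^-1 = (red x)^-1.
Proof.
move=> px rx; have nx : ~~ (p %| `|numq x|)%N.
  by rewrite -intr_Fp_eq0; apply: contraNneq rx => e; rewrite /red e mul0r.
have [|//|h ->] := @pint_frac x^-1 (denq x) (numq x); last by rewrite /red invf_div.
by rewrite -{1}(divq_num_den x) invf_div.
Qed.

Lemma npint_inv x : ~~ pint x -> pint x^-1 /\ red x^-1 = 0.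
Proof.
rewrite negbK => pd; have nx : ~~ (p %| `|numq x|)%N.
  apply/negP => pn; have := coprime_num_den x; rewrite /coprime => /eqP e.
  have : (p %| gcdn `|numq x| `|denq x|)%N by rewrite dvdn_gcd pn.
  by rewrite e dvdn1 => /eqP e1; have := p_pr; rewrite e1.
have [|//|h ->] := @pint_frac x^-1 (denq x) (numq x).
  by rewrite -{1}(divq_num_den x) invf_div.
by split=> //; apply/eqP; rewrite mulf_eq0 intr_Fp_eq0 pd.
Qed.

Lemma pint_sqr x : pint (x ^+ 2) -> pint x.
Proof.
move=> px2; apply: contraT => npx; have [pv rv] := npint_inv npx.
have [pv2 rv2] := pintM pv pv; have [_] := pintM px2 pv2.
rewrite rv2 rv mul0r mulr0; have x0 : x != 0.
  by apply: contraNneq npx => ->; have [] := pint_int 0.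
rewrite -invfM -expr2 divff ?expf_neq0 //; have [_] := pint_int 1.
by rewrite -[1%:~R : rat]/1 => -> /eqP; rewrite oner_eq0.
Qed.

Definition ired (x : rat) (r : 'F_p) := pint x /\ red x = r.

Lemma ired_red x : pint x -> ired x (red x). Proof. by []. Qed.

Lemma ired_eq x r s : ired x r -> ired x s -> r = s.
Proof. by move=> [_ <-] [_ <-]. Qed.

Lemma iredD x y r s : ired x r -> ired y s -> ired (x + y) (r + s).
Proof. by move=> [px <-] [py <-]; exact: pintD. Qed.

Lemma iredM x y r s : ired x r -> ired y s -> ired (x * y) (r * s).
Proof. by move=> [px <-] [py <-]; exact: pintM. Qed.

Lemma iredN x r : ired x r -> ired (- x) (- r).
Proof. by move=> [px <-]; exact: pintN. Qed.

Lemma iredB x y r s : ired x r -> ired y s -> ired (x - y) (r - s).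
Proof. by move=> hx hy; exact: iredD hx (iredN hy). Qed.

Lemma ired1 : ired 1 1. Proof. exact: (pint_int 1). Qed.

Lemma iredX x r n : ired x r -> ired (x ^+ n) (r ^+ n).
Proof. by move=> h; elim: n => [|n IH]; [exact: ired1 | rewrite !exprS; exact: iredM]. Qed.

Variables A B : int.
Hypothesis p_odd : p != 2%N.
Hypothesis p_disc : ~~ (p %| `|(4%:R * A ^+ 3 + 27%:R * B ^+ 2)%R|)%N.
Local Notation aQ := (A%:~R : rat).
Local Notation bQ := (B%:~R : rat).
Local Notation aF := (A%:~R : 'F_p).
Local Notation bF := (B%:~R : 'F_p).

Lemma Fp_char2 : 2%:R != 0 :> 'F_p.
Proof.
rewrite -(dvdn_pcharf (pchar_Fp p_pr)); apply: contra p_odd => h.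
by rewrite -(dvdn_prime2 p_pr).
Qed.

Lemma Fp_smooth x : cubic aF bF x = 0 -> 3%:R * x ^+ 2 + aF != 0.
Proof.
apply: disc_smooth.
have -> : 4%:R * aF ^+ 3 + 27%:R * bF ^+ 2 = (4%:R * A ^+ 3 + 27%:R * B ^+ 2)%:~R.
  by rewrite !(rmorphXn, rmorphM, rmorphD, rmorph_nat).
by rewrite intr_Fp_eq0.
Qed.

(** The points with [p] in the denominator of the abscissa form the kernel of reduction. *)
Definition redpt (P : option (rat * rat)) : option ('F_p * 'F_p) :=
  if P is Some (x, y) then if pint x then Some (red x, red y) else None else None.

Lemma ired_cubic x r : ired x r -> ired (cubic aQ bQ x) (cubic aF bF r).
Proof.
move=> h; apply: iredD; last exact: pint_int.
by apply: iredD (iredX _ h) (iredM _ h); exact: pint_int.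
Qed.

Lemma pint_y x y : y ^+ 2 = cubic aQ bQ x -> pint x -> pint y.
Proof. by move=> e px; apply: pint_sqr; rewrite e; case: (ired_cubic (ired_red px)). Qed.

Lemma redpt_curve P : wcurve aQ bQ P -> wcurve aF bF (redpt P).
Proof.
case: P => [[x y]|] //= /eqP e; case: ifP => //= px; have py := pint_y e px.
have h1 := iredX 2 (ired_red py); rewrite e in h1.
by apply/eqP; exact: ired_eq h1 (ired_cubic (ired_red px)).
Qed.

Lemma redptN P : wcurve aQ bQ P -> redpt (wopp P) = wopp (redpt P).
Proof.
case: P => [[x y]|] //= /eqP e; case: ifP => //= px.
by have [_ ->] := iredN (ired_red (pint_y e px)).
Qed.

(** An integral slope [l] reduces to a slope of the reduced points, which are not opposite by
    smoothness. Otherwise [l^-1] reduces to 0: the two slope equations make the reduced points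
    opposite, and [l ^+ 2] makes the abscissa of the sum non-integral. *)
Lemma redpt_add_integral x1 y1 x2 y2 (P := Some (x1, y1)) (Q := Some (x2, y2)) :
  wcurve aQ bQ P -> wcurve aQ bQ Q -> pint x1 -> pint x2 -> wadd aQ P Q != None ->
  redpt (wadd aQ P Q) = wadd aF (redpt P) (redpt Q).
Proof.
move=> cP cQ px1 px2; have e1 := eqP cP; have e2 := eqP cQ.
have [[_ ->] //|[no [l [h1 h2] ->]] _] := waddP e1 e2.
have f1 : red y1 ^+ 2 = cubic aF bF (red x1) by have := redpt_curve cP; rewrite /= px1 => /eqP.
have ix1 := ired_red px1; have ix2 := ired_red px2.
have iy1 := ired_red (pint_y e1 px1); have iy2 := ired_red (pint_y e2 px2).
have iq : ired (x1 ^+ 2 + x1 * x2 + x2 ^+ 2 + aQ) (red x1 ^+ 2 + red x1 * red x2 + red x2 ^+ 2 + aF).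
  apply: iredD; last exact: pint_int.
  exact: iredD (iredD (iredX 2 ix1) (iredM ix1 ix2)) (iredX 2 ix2).
have idy := iredB iy2 iy1; have idx := iredB ix2 ix1; have isy := iredD iy1 iy2.
rewrite /P /Q /redpt px1 px2.
have [pl|npl] := boolP (pint l).
  have il := ired_red pl.
  have H1 : is_slope aF (red x1) (red y1) (red x2) (red y2) (red l).
    split; apply: ired_eq; [exact: iredM il idx | by rewrite h1 | exact: iredM il isy | by rewrite h2].
  have ix3 := iredB (iredB (iredX 2 il) ix1) ix2.
  have [p3 r3] := ix3; have [p4 r4] := iredB (iredM il (iredB ix1 ix3)) iy1.
  rewrite /third p3 r3 r4 (slope_unique _ H1) //; apply/negP => /andP[/eqP ex /eqP ey].
  have [g1 g2] := H1; have y10 : red y1 = 0.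
    apply: (mulfI Fp_char2); rewrite mulr0.
    by apply: (eq_lc (lcD (lc0 1 ey) (lc0 1 g1))); rewrite ex; ring.
  have := Fp_smooth (_ : cubic aF bF (red x1) = 0); rewrite -f1 y10 expr0n => /(_ erefl).
  by move: g2; rewrite ey mulr0 -ex => /esym g2; rewrite -g2 => /eqP; apply; ring.
have [pv rv] := npint_inv npl; have iv : ired l^-1 0 by [].
have l0 : l != 0 by apply: contraNneq npl => ->; have [] := pint_int 0.
have ex : red x1 == red x2.
  rewrite eq_sym -subr_eq0; apply/eqP; apply: ired_eq idx _.
  have -> : x2 - x1 = l^-1 * (y2 - y1) by rewrite -h1 mulKf.
  by rewrite -(mul0r (red y2 - red y1)); exact: iredM.
have ey : red y1 + red y2 == 0.
  apply/eqP; apply: ired_eq isy _.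
  have -> : y1 + y2 = l^-1 * (x1 ^+ 2 + x1 * x2 + x2 ^+ 2 + aQ) by rewrite -h2 mulKf.
  by rewrite -[0 : 'F_p](mul0r (red x1 ^+ 2 + red x1 * red x2 + red x2 ^+ 2 + aF)); exact: iredM.
rewrite /= ex ey ifN //; apply: contra npl => p3; apply: pint_sqr.
have -> : l ^+ 2 = (l ^+ 2 - x1 - x2) + x1 + x2 by ring.
by have [] := iredD (iredD (ired_red p3) ix1) ix2.
Qed.

(** The coordinates [t = 1 / x2] and [s = y2 / x2 ^+ 2] at infinity are integral. In terms of them
    the abscissa of the sum has denominator [(x1 * t - 1) ^+ 2], which reduces to 1. *)
Lemma pint_add_kernel x1 y1 x2 y2 x3 y3 :
  wcurve aQ bQ (Some (x1, y1)) -> wcurve aQ bQ (Some (x2, y2)) -> pint x1 -> ~~ pint x2 ->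
  wadd aQ (Some (x1, y1)) (Some (x2, y2)) = Some (x3, y3) -> pint x3.
Proof.
move=> /eqP e1 /eqP e2 px1 npx2 /=.
have nx : x1 != x2 by apply: contraNneq npx2 => <-.
rewrite (negPf nx) => -[<- _].
have x20 : x2 != 0 by apply: contraNneq npx2 => ->; have [] := pint_int 0.
have [pt rt] := npint_inv npx2; pose t := x2^-1; have it : ired t 0 by [].
have ix1 := ired_red px1; have iy1 := ired_red (pint_y e1 px1).
have iA : ired aQ aF by exact: pint_int. 
have iB : ired bQ bF by exact: pint_int.
pose s := y2 * t ^+ 2.
have is2 : pint s.
  apply: pint_sqr; have -> : s ^+ 2 = t + aQ * t ^+ 3 + bQ * t ^+ 4.
    by rewrite /s exprMn e2 /cubic /t; field.
  by have [] := iredD (iredD it (iredM iA (iredX 3 it))) (iredM iB (iredX 4 it)).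
have iD : ired ((x1 * t - 1) ^+ 2) 1.
  have := iredX 2 (iredB (iredM ix1 it) ired1).
  by rewrite mulr0 sub0r sqrrN expr1n.
have iDV : pint ((x1 * t - 1) ^+ 2)^-1.
  by have [pD rD] := iD; have [] := pintV pD; rewrite rD ?oner_neq0.
have d1 : x1 * t - 1 != 0.
  by rewrite subr_eq0; apply: contra nx => /eqP e; rewrite -[x1](mulfK (invr_neq0 x20)) -/t e mul1r /t invrK.
have d2 : x2 - x1 != 0 by rewrite subr_eq0 eq_sym.
have -> : ((y2 - y1) / (x2 - x1)) ^+ 2 - x1 - x2 =
  ((x1 + aQ * t) * (x1 * t + 1) + (1 + 1) * bQ * t ^+ 2 - (1 + 1) * y1 * s) * ((x1 * t - 1) ^+ 2)^-1.
  transitivity ((y1 ^+ 2 + y2 ^+ 2 - 2%:R * y1 * y2 - (x1 + x2) * (x2 - x1) ^+ 2) / (x2 - x1) ^+ 2).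
    by field.
  rewrite e1 e2 /cubic /s /t; field.
  by rewrite x20 d2 mulN1r subr_eq0 nx.
have i2 := iredD ired1 ired1.
by have [] := iredM (iredB (iredD (iredM (iredD ix1 (iredM iA it)) (iredD (iredM ix1 it) ired1))
  (iredM (iredM i2 iB) (iredX 2 it))) (iredM (iredM i2 iy1) (ired_red is2))) (ired_red iDV).
Qed.

(** If [Q] lies in the kernel, [P + Q] is integral and the integral case applies to
    [- P + (P + Q) = Q]. As [Q] reduces to infinity, [P + Q] and [P] have the same reduction. *)
Lemma redpt_add P Q : wcurve aQ bQ P -> wcurve aQ bQ Q -> redpt P != None ->
  wadd aQ P Q != None -> redpt (wadd aQ P Q) = wadd aF (redpt P) (redpt Q).
Proof.
case: P => [[x1 y1]|] //; case: Q => [[x2 y2]|]; last first.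
  by move=> _ _ _ _; rewrite [wadd _ _ None]/=; case: redpt => [[]|].
move=> c1 c2 n1 n3; have px1 : pint x1 by move: n1 => /=; case: ifP.
have [px2|npx2] := boolP (pint x2); first exact: redpt_add_integral.
have char2Q : 2%:R != 0 :> rat by [].
have smoothQ : forall x, cubic aQ bQ x = 0 -> 3%:R * x ^+ 2 + aQ != 0.
  apply: disc_smooth.
  have -> : 4%:R * aQ ^+ 3 + 27%:R * bQ ^+ 2 = (4%:R * A ^+ 3 + 27%:R * B ^+ 2)%:~R.
    by rewrite !(rmorphXn, rmorphM, rmorphD, rmorph_nat).
  by rewrite intr_eq0; apply: contraNneq p_disc => ->; rewrite dvdn0.
have c3 := wadd_curve c1 c2; have back := waddK char2Q smoothQ c1 c2.
case e : (wadd aQ (Some (x1, y1)) (Some (x2, y2))) n3 c3 back => [[x3 y3]|] // _ c3 back.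
have px3 := pint_add_kernel c1 c2 px1 npx2 e.
have r2 : redpt (Some (x2, y2)) = None by rewrite /= (negPf npx2).
have cN := wopp_curve c1.
have := redpt_add_integral cN c3 px1 px3; rewrite back r2 => /(_ isT) /esym h.
have [cr3 crN] := (redpt_curve c3, redpt_curve cN).
have := wadd_eq0 Fp_char2 Fp_smooth crN cr3 h.
rewrite (redptN c1) => /(congr1 (@wopp _)).
by rewrite !woppK => <-; case: redpt n1 => [[]|].
Qed.

Variable Q : option (rat * rat).
Hypothesis cQ : wcurve aQ bQ Q.
Hypothesis infinite_order : forall n, (0 < n)%N -> wmul aQ n Q != None.

Lemma redpt_mul n : redpt Q != None -> redpt (wmul aQ n Q) = wmul aF n (redpt Q).
Proof.
move=> nQ; elim: n => // n IH.
rewrite [wmul _ n.+1 _]/= redpt_add ?IH //; first exact: wmul_curve.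
exact: (infinite_order (ltn0Sn n)).
Qed.

Lemma redpt_denom P d : is_ell_denom P d -> (p %| d)%N = (redpt P == None).
Proof.
case: P => [[x y]|] // [d0 [u [v [cud [_ [ex _]]]]]] /=.
have [pd|npd] := boolP (p %| d)%N.
  have d20 : (d ^ 2)%N%:Z != 0 by rewrite -lt0n expn_gt0 d0.
  suff -> : pint x = false by [].
  have cad : coprime `|u| (d ^ 2) by rewrite coprimeXr.
  have ex' : x = u%:~R / (d ^ 2)%N%:Z%:~R by rewrite ex pmulrn.
  by rewrite /pint ex' coprimeq_den // (negPf d20) Euclid_dvdX // pd.
suff [-> _] : pint x /\ red x = u%:~R / (d ^ 2)%N%:Z%:~R by [].
by apply: pint_frac; rewrite ?ex ?pmulrn // Euclid_dvdX // negb_and npd.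
Qed.

Lemma prime_divisor_rank (d : nat -> nat) n :
  (A == 0) || (B == 0) ->
  (forall n, (0 < n)%N -> is_ell_denom (wmul aQ n Q) (d n)) -> (0 < n)%N -> (p %| d n)%N ->
  exists m, [/\ (0 < m)%N, (m %| n)%N, (p %| d m)%N &
   (m %| p.+1)%N \/ exists (D N : nat) (s w : int),
     [/\ D = 1%N \/ D = 3%N, (m %| N)%N, N%:Z = p%:Z + 1 + s &
       w ^+ 2 + D%:Z * (s + 2%:R) ^+ 2 = 4%:R * D%:Z * N%:Z]].
Proof.
move=> AB hd n0 pdn.
have d1 := redpt_denom (hd 1%N isT).
have Q1 : wmul aQ 1 Q = Q by rewrite /wmul /=; case: (Q) => [[]|].
(* If [Q] itself reduces to infinity, its rank is 1, which divides [p + 1]. *)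
rewrite Q1 in d1; have [nQ|nQ] := boolP (redpt Q == None).
  by exists 1%N; rewrite dvd1n d1 nQ; split=> //; left.
have cR := redpt_curve cQ.
have [m [m0 mR mN mdiv]] := order_dvd_card Fp_char2 Fp_smooth cR.
exists m; split=> //.
- apply: mdiv; rewrite -redpt_mul //; apply/eqP; by rewrite -(redpt_denom (hd n n0)).
- by rewrite (redpt_denom (hd m m0)) redpt_mul // mR.
have AFB : (aF == 0) != (bF == 0).
  have pAB : ~~ (p %| `|A|)%N || ~~ (p %| `|B|)%N.
    rewrite -negb_and; apply: contra p_disc => /andP[pA pB].
    suff : (p%:Z %| 4%:R * A ^+ 3 + 27%:R * B ^+ 2)%Z by rewrite dvdzE.
    have pAz : (p%:Z %| A)%Z by rewrite dvdzE.
    have pBz : (p%:Z %| B)%Z by rewrite dvdzE.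
    by rewrite rpredD // dvdz_mull // exprS dvdz_mulr.
  rewrite !intr_Fp_eq0; move: pAB; case/orP: AB => /eqP->; rewrite dvdn0 /=.
    by rewrite eq_sym eqb_id.
  by rewrite orbF eqb_id.
have [g hg] := finField_primitive_root 'F_p.
have cp : #|'F_p| = p by rewrite card_Fp.
have [eN|[D [s [w [hD eN en]]]]] := count_wcurve_norm Fp_char2 hg AFB.
  left; move: mN eN; rewrite cp => mN eN.
  by move: mN; rewrite (_ : #|_| = p.+1) //; apply/eqP; rewrite -eqz_nat eN -addn1 PoszD.
right; exists `|D|%N, #|[set R | wcurve aF bF R]|, s, w; split=> //.
- by case: hD => ->; [left|right].
- by rewrite eN cp.
have -> : (`|D|%N)%:Z = D by case: hD => ->.
by rewrite en.
Qed.
End Reduction.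

(** * Representations by binary quadratic forms *)

Section Counting.
Local Open Scope nat_scope.

Lemma size_fibers (T U : eqType) (f : T -> U) (s : seq T) (t : seq U) c :
  (forall x, x \in s -> f x \in t) ->
  (forall u, u \in t -> size [seq x <- s | f x == u] <= c) ->
  size s <= c * size t.
Proof.
elim: t s => [|u t IH] s ft fc.
  by case: s ft {fc} => [|x s] // /(_ x (mem_head _ _)).
rewrite -(count_predC (fun x => f x == u)) mulnS leq_add // -?size_filter ?fc ?mem_head //.
apply: IH => [x|v vt]; last first.
  apply: leq_trans (fc v _); last by rewrite inE vt orbT.
  rewrite -filter_predI !size_filter.
  by apply: sub_count => x /andP[].
by rewrite mem_filter /= => /andP[fu /ft]; rewrite inE (negPf fu).
Qed.

(** * The divisor bound *)

Definition tau n := size (divisors n).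

Lemma tau_mul p e M : prime p -> ~~ (p %| M) -> 0 < M -> tau (p ^ e * M) <= e.+1 * tau M.
Proof.
move=> pp pM M0; have p0 := prime_gt0 pp; rewrite /tau -(size_iota 0 e.+1) -(size_allpairs (fun i x => p ^ i * x)).
apply: uniq_leq_size; first exact: divisors_uniq.
move=> d; rewrite -dvdn_divisors ?muln_gt0 ?expn_gt0 ?p0 // => dN.
have d0 : 0 < d by apply: dvdn_gt0 dN; rewrite muln_gt0 expn_gt0 p0.
apply/allpairsP; exists (logn p d, d`_p^'); split.
- rewrite mem_iota add0n ltnS /=; have := dvdn_leq_log p _ dN.
  rewrite muln_gt0 expn_gt0 p0 M0 => /(_ isT).
  by rewrite lognM ?expn_gt0 ?p0 // pfactorK // (lognE p M) (negPf pM) !andbF addn0.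
- rewrite -dvdn_divisors //=; have : d`_p^' %| p ^ e * M by apply: dvdn_trans (dvdn_part _ _) dN.
  rewrite Gauss_dvdr // coprime_sym coprimeXl //.
  by rewrite prime_coprime //; have := part_pnat p^' d; rewrite p'natE.
- by rewrite /= -p_part partnC.
Qed.

(** With the integer quotient, [e + 1 <= k * (e / k + 1) <= k * 2 ^ (e / k)]. *)
Lemma expn_bound k e : 0 < k -> e.+1 ^ k <= k ^ k * 2 ^ e.
Proof.
move=> k0; apply: (@leq_trans ((k * 2 ^ (e %/ k)) ^ k)).
  rewrite leq_exp2r //; apply: (@leq_trans (k * (e %/ k).+1)); last by rewrite leq_mul2l ltn_expl ?orbT.
  by rewrite mulnC ltn_ceil.
by rewrite expnMn -expnM leq_mul2l leq_exp2l // leq_divM orbT.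
Qed.

(** A prime [p >= 2 ^ k] of exponent [e] costs nothing, since [(e + 1) ^ k <= 2 ^ (e k) <= p ^ e].
    Each smaller prime costs a factor [k ^ k], and there are at most [2 ^ k] of them. *)
Lemma tau_bound k : 0 < k -> exists C, forall N, 0 < N -> tau N ^ k <= C * N.
Proof.
move=> k0; exists ((k ^ k) ^ (2 ^ k)) => N N0.
have kk0 : 0 < k ^ k by rewrite expn_gt0 k0.
apply: (@leq_trans ((k ^ k) ^ (count (fun p => p < 2 ^ k) (primes N)) * N)); last first.
  rewrite leq_mul2r leq_pexp2l ?orbT // -size_filter.
  rewrite -[X in _ <= X](size_iota 0 (2 ^ k)); apply: uniq_leq_size; first by rewrite filter_uniq ?primes_uniq.
  by move=> p; rewrite mem_filter mem_iota => /andP[].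
elim: N {-2}N (leqnn N) N0 => [|n IH] N; first by rewrite leqn0 => /eqP->.
move=> Nn N0; have [N1|N1] := leqP N 1.
  by have -> : N = 1 by [lia]; rewrite /tau /= exp1n.
have pp := pdiv_prime N1; set p := pdiv N in pp; have p0 := prime_gt0 pp.
pose e := logn p N; pose M := N`_p^'.
have NE : N = p ^ e * M by rewrite -p_part partnC.
have e0 : 0 < e by rewrite logn_gt0 mem_primes pp N0 pdiv_dvd.
have M0 : 0 < M by exact: part_gt0.
have pM : ~~ (p %| M) by rewrite -p'natE ?part_pnat.
have MN : M < N by rewrite NE ltn_Pmull // -(expn0 p) ltn_exp2l // prime_gt1.
have primesN : perm_eq (primes N) (p :: primes M).
  apply: uniq_perm; rewrite ?primes_uniq //= ?primes_uniq ?andbT.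
    by rewrite mem_primes (negPf pM) !andbF.
  by move=> q; rewrite NE primesM ?expn_gt0 ?p0 // primesX // primes_prime // !inE.
rewrite (permP primesN) /= expnD -/p.
apply: leq_trans (_ : (e.+1 * tau M) ^ k <= _).
  by rewrite leq_exp2r // {1}NE tau_mul.
rewrite [X in _ <= _ * X]NE expnMn mulnACA leq_mul //; last by apply: IH => //; rewrite -ltnS (leq_trans MN).
case: ltnP => [_|pk]; rewrite ?expn1 ?expn0 ?mul1n.
  apply: leq_trans (expn_bound e k0) _; rewrite leq_mul2l leq_exp2r ?prime_gt1 ?orbT //.
apply: (@leq_trans ((2 ^ e) ^ k)); first by rewrite leq_exp2r // ltn_expl.
by rewrite -expnM mulnC expnM leq_exp2r.
Qed.
End Counting.

Lemma tau_dvd m n : (m %| n)%N -> (0 < n)%N -> (tau m <= tau n)%N.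
Proof.
move=> mn n0; have m0 := dvdn_gt0 n0 mn; apply: uniq_leq_size; first exact: divisors_uniq.
by move=> d; rewrite -!dvdn_divisors // => /dvdn_trans; apply.
Qed.

Section Representations.
Variable D : nat.
Hypothesis D13 : D = 1%N \/ D = 3%N.

Definition repr (N : nat) (P : int * int) : bool := P.1 ^+ 2 + D%:Z * P.2 ^+ 2 == N%:Z.

(** Reading [P] as [P.1 + P.2 sqrt(-D)], the number [inner P Q + det P Q sqrt(-D)] is the conjugate
    of [P] times [Q]. *)
Definition det (P Q : int * int) := P.1 * Q.2 - Q.1 * P.2.
Definition inner (P Q : int * int) := P.1 * Q.1 + D%:Z * P.2 * Q.2.

Lemma inner_det N P Q : repr N P -> repr N Q ->
  [/\ N%:Z * Q.1 = P.1 * inner P Q - D%:Z * P.2 * det P Q,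
      N%:Z * Q.2 = P.2 * inner P Q + P.1 * det P Q &
      inner P Q ^+ 2 + D%:Z * det P Q ^+ 2 = N%:Z ^+ 2].
Proof.
move=> /eqP eP /eqP eQ; rewrite /inner /det; split; rewrite ?expr2 -{1}eP ?eQ; try by ring.
by rewrite -{1}eQ; ring.
Qed.

Lemma coprime_x N P : (0 < N)%N -> repr N P -> coprimez P.1 P.2 -> coprimez N P.2.
Proof.
move=> N0 /eqP <- co; rewrite coprimez_sym /coprimez.
have -> : P.1 ^+ 2 + D%:Z * P.2 ^+ 2 = D%:Z * P.2 * P.2 + P.1 ^+ 2 by ring.
rewrite gcdzMDl -/(coprimez _ _) coprimezXr // coprimez_sym //.
Qed.

(* With [g] the gcd of [N] and [det P P0], the determinant of two representations
   sharing the same [g] is divisible by [g] and by [N / g], hence [N %| 2 D det P Q]. *)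
Lemma fiber_det N P0 P Q : (0 < N)%N -> repr N P0 -> repr N P -> repr N Q ->
  coprimez P0.1 P0.2 -> coprimez P.1 P.2 -> coprimez Q.1 Q.2 ->
  gcdz N (det P P0) = gcdz N (det Q P0) -> (N%:Z %| 2%:R * D%:Z * det P Q)%Z.
Proof.
move=> N0 r0 rP rQ c0 cP cQ e; have [g eg] : exists g, gcdz N (det P P0) = g by eexists.
have eg' : gcdz N (det Q P0) = g by rewrite -e.
have cx0 := coprime_x N0 r0 c0; have cx := coprime_x N0 rP cP.
have gN : (g %| N%:Z)%Z by rewrite -eg dvdz_gcdl.
have gP : (g %| det P P0)%Z by rewrite -eg dvdz_gcdr.
have gQ : (g %| det Q P0)%Z by rewrite -eg' dvdz_gcdr.
(* [eps R] is the determinant of [R] and [(- P0.1, P0.2)]. Its product with [det R P0] is a multiple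
   of [N], so [h = N / g] divides it. *)
pose eps (R : int * int) := R.1 * P0.2 + P0.1 * R.2.
have prod R : repr N R -> det R P0 * eps R = N%:Z * (P0.2 ^+ 2 - R.2 ^+ 2).
  move=> /eqP eR; rewrite mulrBr -{1}eR -(eqP r0) /det /eps; ring.
have x0det : P0.2 * det P Q = det P P0 * Q.2 - det Q P0 * P.2 by rewrite /det; ring.
have x0det' : P0.2 * det P Q = eps P * Q.2 - eps Q * P.2 by rewrite /det /eps; ring.
have g0 : g != 0 by rewrite -eg gcdz_eq0 negb_and -lt0n N0.
have cop (k : int) x : (k %| N%:Z)%Z -> coprimez N x -> coprimez k x.
  by rewrite !coprimezE dvdzE => kN; exact: coprime_dvdl.
have gdet : (g %| det P Q)%Z.
  have cg : coprimez g P0.2 by exact: cop.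
  rewrite -(Gauss_dvdzr _ cg).
  rewrite x0det.
  apply: rpredB.
  exact: dvdz_mulr.
  exact: dvdz_mulr.
have [h eh] : exists h, N%:Z = h * g by apply/dvdzP.
have hN : (h %| N%:Z)%Z by rewrite eh dvdz_mulr.
have gz : (`|g|%N)%:Z = g by rewrite -eg.
have heps R : repr N R -> gcdz N (det R P0) = g -> (h %| eps R)%Z.
  move=> rR eR; have [d ed] : exists d, det R P0 = d * g by apply/dvdzP; rewrite -eR dvdz_gcdr.
  have cd : coprimez h d.
    move: eR; rewrite eh ed /gcdz !abszM -muln_gcdl => /eqP.
    rewrite PoszM gz.
    by rewrite -{2}[g]mul1r (inj_eq (mulIf g0)).
  rewrite -(Gauss_dvdzr _ cd); apply/dvdzP; exists (P0.2 ^+ 2 - R.2 ^+ 2).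
  by apply: (mulIf g0); have := prod R rR; rewrite eh ed => hh; apply: (eq_lc (lc0 1 hh)); ring.
have hP := heps P rP eg; have hQ := heps Q rQ eg'.
have hdet : (h %| det P Q)%Z.
  have cg : coprimez h P0.2 by exact: cop.
  by rewrite -(Gauss_dvdzr _ cg) x0det'; apply: rpredB; exact: dvdz_mulr.
(* Both [g] and [h] divide the determinant and [g * h = N], so [N] divides [k] times it. Moreover
   [k] divides [2 P.1], hence [2 D P.2 ^+ 2 = 2 N - 2 P.1 ^+ 2], hence [2 D]. *)
pose k := gcdz g h.
have kg : (k %| g)%Z by exact: dvdz_gcdl.
have kh : (k %| h)%Z by exact: dvdz_gcdr.
have kN : (k %| N%:Z)%Z by apply: dvdz_trans gN.
have k2w : (k %| 2%:R * P.1)%Z.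
  have ck : coprimez k P0.2 by exact: cop.
  rewrite -(Gauss_dvdzl _ ck).
  have -> : 2%:R * P.1 * P0.2 = det P P0 + eps P by rewrite /det /eps; ring.
  by apply: rpredD; [exact: dvdz_trans kg gP | exact: dvdz_trans kh hP].
have k2D : (k %| 2%:R * D%:Z)%Z.
  have ck : coprimez k (P.2 ^+ 2) by rewrite coprimezXr //; exact: cop.
  rewrite -(Gauss_dvdzl _ ck).
  have -> : 2%:R * D%:Z * P.2 ^+ 2 = 2%:R * N%:Z - P.1 * (2%:R * P.1).
    by rewrite -(eqP rP); ring.
  by apply: rpredB; exact: dvdz_mull.
have [al eal] : exists al, det P Q = al * g by apply/dvdzP.
have [be ebe] : exists be, 2%:R * D%:Z = be * k by apply/dvdzP.
have [u [v euv]] := Bezoutz g h; rewrite -/k in euv.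
have [ga ega] : exists ga, det P Q = ga * h by apply/dvdzP.
apply/dvdzP; exists (be * (u * ga + v * al)).
apply: (eq_lc (lcD (lcD (lc0 (det P Q) ebe) (lc0 (be * det P Q) (esym euv)))
  (lcD (lcD (lc0 (be * u * g) ega) (lc0 (be * v * h) eal)) (lc0 (- be * (u * ga + v * al)) eh)))).
ring.
Qed.

Lemma bounded_quotient (n q d i : int) : 0 < D%:Z -> n != 0 ->
  2%:R * D%:Z * d = q * n -> i ^+ 2 + D%:Z * d ^+ 2 = n ^+ 2 ->
  (q <= 2%:R * D%:Z) * (- (2%:R * D%:Z) <= q).
Proof.
move=> D0 n0 e h; have n2 : 0 < n ^+ 2 by rewrite exprn_even_gt0.
have : q ^+ 2 * n ^+ 2 <= (2%:R * D%:Z) ^+ 2 * n ^+ 2.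
  rewrite -exprMn -e exprMn ler_wpM2l ?sqr_ge0 // -h.
  have := sqr_ge0 i; have := sqr_ge0 d; case: D13 => ->; lia.
rewrite ler_pM2r // -(real_normK (num_real q)) ler_pXn2r ?nnegrE //.
by rewrite ler_norml => /andP[].
Qed.

Lemma same_sign (x y : int) : x = - y -> (0 <= x) = (0 <= y) -> x = y.
Proof. by move=> -> h; have [->|] := eqVneq y 0; [rewrite oppr0 | move: h; lia]. Qed.

(** The gcd of [N] and [det P P0] is a divisor of [N]. Among representations sharing it, fix one,
    [P]: then [2 D det P Q = q N] with [q] between [- 2 D] and [2 D], at most 13 values. These and
    the sign of [inner P Q] determine [Q], whence [26 = 2 * 13]. *)
Lemma primitive_repr_count N (s : seq (int * int)) : (0 < N)%N -> uniq s ->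
  (forall P, P \in s -> repr N P /\ coprimez P.1 P.2) -> (size s <= 26 * tau N)%N.
Proof.
move=> N0 us rs; case: s us rs => // P0 s' us rs; set s := P0 :: s' in us rs *.
have [r0 c0] := rs P0 (mem_head _ _).
pose f P := `|gcdz N (det P P0)|%N.
apply: (@size_fibers _ _ f s (divisors N)).
  by move=> P _; rewrite -dvdn_divisors // dvdn_gcdl.
move=> u _; set t := [seq x <- s | f x == u].
have ut : uniq t by rewrite filter_uniq.
case et : t => [//|P t'].
have tP Q : Q \in t -> [/\ repr N Q, coprimez Q.1 Q.2 & f Q = u].
  by rewrite mem_filter => /andP[/eqP fQ /rs[]].
have [rP cP fP] : [/\ repr N P, coprimez P.1 P.2 & f P = u] by apply: tP; rewrite et mem_head.
rewrite -et.
pose j Q := `|(((2%:R * D%:Z * det P Q) %/ N%:Z)%Z + 2%:R * D%:Z)%R|%N.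
pose F Q := (0 <= inner P Q, j Q).
have N0z : N%:Z != 0 by rewrite -lt0n.
have dvd Q : Q \in t -> (N%:Z %| 2%:R * D%:Z * det P Q)%Z.
  move=> /tP[rQ cQ fQ]; apply: fiber_det N0 r0 rP rQ c0 cP cQ _.
  by move: fP; rewrite -fQ /f /gcdz /= => ->.
have D0 : 0 < D%:Z by case: D13 => ->.
have small Q : Q \in t -> exists q, [/\ 2%:R * D%:Z * det P Q = q * N%:Z, - (2%:R * D%:Z) <= q & q <= 2%:R * D%:Z].
  move=> Qt; have [rQ cQ fQ] := tP Q Qt; have [_ _ h] := inner_det rP rQ.
  have /dvdzP[q eq] := dvd Q Qt; exists q; split=> //; last first.
    exact: (bounded_quotient D0 N0z eq h).1.
  exact: (bounded_quotient D0 N0z eq h).2.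
have jE Q q : 2%:R * D%:Z * det P Q = q * N%:Z -> j Q = `|(q + 2%:R * D%:Z)%R|%N.
  by move=> e; rewrite /j e mulzK.
have := @size_fibers _ _ F t [seq (b, i) | b <- [:: true; false], i <- iota 0 13] 1.
rewrite size_allpairs size_iota => -> //.
  move=> Q Qt; apply/allpairsP; exists (F Q); split; last by case: (F Q).
    by rewrite /F /=; case: (0 <= _).
  have [q [eq q1 q2]] := small Q Qt; rewrite mem_iota /F /= (jE Q q eq).
  by move: q1 q2; clear -D13; case: D13 => ->; lia.
move=> v _; set L := [seq x <- t | F x == v].
have uL : uniq L by rewrite filter_uniq.
have LP Q : Q \in L -> F Q = v /\ Q \in t by rewrite mem_filter => /andP[/eqP].
case eL : L uL LP => [|Q1 [|Q2 L']] //= /andP[nQ _] LP.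
have [F1 t1] := LP Q1 (mem_head _ _).
have m2 : Q2 \in [:: Q1, Q2 & L'] by rewrite !inE eqxx orbT.
have [F2 t2] := LP Q2 m2.
suff e12 : Q1 = Q2 by rewrite e12 mem_head in nQ.
have [q1 [eq1 l1 u1]] := small Q1 t1; have [q2 [eq2 l2 u2]] := small Q2 t2.
move: F1; rewrite -F2 => -[eS]; rewrite (jE _ _ eq1) (jE _ _ eq2) => ej.
have eq12 : q1 = q2 by move: ej l1 u1 l2 u2; clear; lia.
have D20 : 2%:R * D%:Z != 0 by rewrite mulf_neq0 // gt_eqF.
have edet : det P Q1 = det P Q2 by apply: (mulfI D20); rewrite eq1 eq2 eq12.
have [r1 _ _] := tP _ t1; have [r2 _ _] := tP _ t2.
have [a1 b1 i1] := inner_det rP r1; have [a2 b2 i2] := inner_det rP r2.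
have ei : inner P Q1 = inner P Q2.
  have : inner P Q1 ^+ 2 = inner P Q2 ^+ 2.
    by apply: (eq_lc (lcD (lc0 1 i1) (lc0 (-1) i2))); rewrite edet; ring.
  move/eqP; rewrite eqf_sqr => /orP[/eqP //|/eqP e].
  exact: same_sign e eS.
have e1 : Q1.1 = Q2.1 by apply: (mulfI N0z); rewrite a1 a2 ei edet.
have e2 : Q1.2 = Q2.2 by apply: (mulfI N0z); rewrite b1 b2 ei edet.
by rewrite [Q1]surjective_pairing e1 e2 -surjective_pairing.
Qed.

(** Division by the gcd [g] of the coordinates gives a primitive representation of [N / g ^ 2]. One
    factor [tau N] counts the values of [g], the other comes from the primitive case. *)
Lemma repr_count N (s : seq (int * int)) : (0 < N)%N -> uniq s ->
  (forall P, P \in s -> repr N P) -> (size s <= 26 * tau N ^ 2)%N.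
Proof.
move=> N0 us rs; rewrite expnS expn1 mulnA.
have gP P : P \in s -> [/\ (0 < `|gcdz P.1 P.2|)%N, (`|gcdz P.1 P.2| ^ 2 %| N)%N &
    forall g, `|gcdz P.1 P.2|%N = g -> P = ((P.1 %/ g)%Z * g, (P.2 %/ g)%Z * g)].
  move=> Ps; have /eqP e := rs P Ps; have g1 := dvdz_gcdl P.1 P.2; have g2 := dvdz_gcdr P.1 P.2.
  split.
  - rewrite absz_gt0 gcdz_eq0; apply/negP => /andP[/eqP p1 /eqP p2].
    by move: e; rewrite p1 p2 !expr0n mulr0 => -[] N0'; rewrite -N0' in N0.
  - have : (gcdz P.1 P.2 ^+ 2 %| N%:Z)%Z.
      by rewrite -e; apply: rpredD; [exact: dvdz_exp2r | apply: dvdz_mull; exact: dvdz_exp2r].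
    by rewrite dvdzE abszX.
  - move=> g eg; have -> : g%:Z = gcdz P.1 P.2 by rewrite -eg.
    by rewrite !divzK // -surjective_pairing.
apply: (@size_fibers _ _ (fun P => `|gcdz P.1 P.2|%N) s (divisors N)).
  move=> P Ps; have [_ h _] := gP P Ps; rewrite -dvdn_divisors //.
  by apply: dvdn_trans h; rewrite expnS dvdn_mulr.
move=> g _; set t := [seq x <- s | _].
have tP P : P \in t -> `|gcdz P.1 P.2|%N = g /\ P \in s by rewrite mem_filter => /andP[/eqP].
have [->//|] := eqVneq t [::]; case et : t => [//|P0 t'] _; rewrite -et.
have [eg0 s0] : `|gcdz P0.1 P0.2|%N = g /\ P0 \in s by apply: tP; rewrite et mem_head.
have [g0 gN _] := gP P0 s0; rewrite eg0 in g0 gN.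
pose q (P : int * int) := ((P.1 %/ g)%Z, (P.2 %/ g)%Z).
have qK P : P \in t -> P = ((q P).1 * g%:Z, (q P).2 * g%:Z).
  by move=> /tP[e /gP[_ _]] /(_ _ e).
rewrite -(size_map q); have N1 : (0 < N %/ g ^ 2)%N by rewrite divn_gt0 ?expn_gt0 ?g0 // dvdn_leq.
have gz : g%:Z != 0 by rewrite -lt0n.
apply: leq_trans (@primitive_repr_count (N %/ g ^ 2) _ N1 _ _) _.
- rewrite map_inj_in_uniq ?filter_uniq // => P Q Pt Qt eq.
  by rewrite (qK P Pt) (qK Q Qt) eq.
- move=> _ /mapP[P Pt ->]; have [eg Ps] := tP P Pt; have eP := qK P Pt.
  have rP := rs P Ps; case: (q P) eP => q1 q2 /= eP; rewrite {}eP /= in eg rP; split.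
    have g2z : g%:Z ^+ 2 != 0 by rewrite expf_neq0.
    apply/eqP; apply: (mulIf g2z) => /=.
    have -> : (N %/ g ^ 2)%N%:Z * g%:Z ^+ 2 = N%:Z by rewrite expr2 -!PoszM mulnn divnK.
    by rewrite -(eqP rP) /=; ring.
  move: eg; rewrite /gcdz !abszM /= -muln_gcdl -{2}[g]mul1n => /eqP.
  by rewrite eqn_pmul2r // coprimezE.
by rewrite leq_mul2l tau_dvd ?orbT //; apply/dvdnP; exists (g ^ 2)%N; rewrite mulnC divnK.
Qed.

End Representations.

(** * Counting the primes of given rank *)

Lemma ex_choice_seq (T : eqType) (U : Type) (u0 : U) (R : T -> U -> Prop) (s : seq T) :
  (forall x, x \in s -> exists u, R x u) -> exists h, forall x, x \in s -> R x (h x).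
Proof.
elim: s => [|x s IH] hs; first by exists (fun=> u0).
have [h hh] := IH (fun y ys => hs y (mem_behead (s := x :: s) ys)).
have [u hu] := hs x (mem_head _ _).
exists (fun y => if y == x then u else h y) => y; rewrite inE.
by case: eqVneq => [->|_] //= /hh.
Qed.

Definition rank_cond (m p : nat) : Prop :=
  (m %| p.+1)%N \/ exists (D N : nat) (s w : int),
     [/\ D = 1%N \/ D = 3%N, (m %| N)%N, N%:Z = p%:Z + 1 + s &
       w ^+ 2 + D%:Z * (s + 2%:R) ^+ 2 = 4%:R * D%:Z * N%:Z].

(** [D = 0] marks the case [N = p + 1]. Otherwise [P] is [(w, s + 2)], and [N + 1 = p + P.2]
    recovers [p] from the code. *)
Definition rank_code (m p : nat) (c : nat * nat * (int * int)) : Prop :=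
  let: (D, N, P) := c in
  [/\ D \in [:: 0; 1; 3]%N, (0 < N <= 4 * p)%N, (m %| N)%N &
    if D == 0%N then N = p.+1 else N%:Z + 1 = p%:Z + P.2 /\ repr D (4 * D * N) P].

(** A crude substitute for Hasse's bound: [N > 4 p] would make [z = N + 1 - p] exceed [3 p], too
    large for [z ^+ 2 <= 4 N]. *)
Lemma norm_bound (p z N : int) : 4%:R < p -> z ^+ 2 <= 4%:R * N -> N + 1 = p + z -> 0 < N <= 4%:R * p.
Proof.
move=> p4 zN e; have eN : N = p + z - 1 by rewrite -e addrK.
move: zN; rewrite {}eN {e} => zN; apply/andP; split.
  rewrite ltNge; apply/negP => h; have : z ^+ 2 <= 0 by apply: le_trans zN _; rewrite pmulr_rle0.
  by rewrite exprn_even_le0 //= => /eqP z0; move: h; rewrite z0; move: p4; clear; lia.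
rewrite leNgt; apply/negP => h; have zp : 3%:R * p + 2%:R <= z by move: h; clear; lia.
have : (3%:R * p + 2%:R) * z <= 4%:R * (p + z - 1).
  by apply: le_trans zN; rewrite expr2 ler_wpM2r //; move: p4 zp; clear; lia.
have : 17%:R * z <= (3%:R * p + 2%:R) * z.
  by rewrite ler_wpM2r //; move: p4 zp; clear; lia.
by move: ((3%:R * p + 2%:R) * z) => T; move: p4 zp; clear; lia.
Qed.

Lemma rank_codeP m p : (4 < p)%N -> rank_cond m p -> exists c, rank_code m p c.
Proof.
move=> p4 [mp|[D [N [s [w [hD mN eN en]]]]]].
  by exists (0%N, p.+1, (0, 0)); split=> //; move: p4; clear; lia.
exists (D, N, (w, s + 2%:R)); split=> //.
- by case: hD => ->.
- have D0 : 0 < D%:Z by case: hD => ->.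
  have : (s + 2%:R) ^+ 2 <= 4%:R * N%:Z.
    rewrite -(ler_pM2l D0); have -> : D%:Z * (4%:R * N%:Z) = 4%:R * D%:Z * N%:Z by ring.
    by rewrite -en lerDr sqr_ge0.
  move=> /(@norm_bound p%:Z); rewrite eN; move: p4 eN; clear => p4 eN h.
  have : 0 < N%:Z <= 4%:R * p%:Z by rewrite eN; apply: h; [lia | ring].
  by move: (4%:R) ; lia.
- have -> : (D == 0)%N = false by case: hD => ->.
  by split; [rewrite eN /=; ring | rewrite /repr /= en !PoszM].
Qed.

Lemma rank_count k : (0 < k)%N -> exists C, forall m X (ps : seq nat),
  (0 < m)%N -> (0 < X)%N -> uniq ps ->
  (forall p, p \in ps -> [/\ (4 < p)%N, (p <= X)%N & rank_cond m p]) ->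
  ((size ps * m) ^ k <= C * X ^ k.+1)%N.
Proof.
move=> k0; have k20 : (0 < 2 * k)%N by rewrite muln_gt0.
have [C hC] := tau_bound k20.
(* There are 3 values of [D] and [4 X / m] multiples of [m], which gives 12; each such pair has at
   most [26 T ^ 2] primes; and [4 D N <= 48 X] since [D <= 3] and [N <= 4 X]. *)
exists ((12 * 26) ^ k * (C * 48))%N => m X ps m0 X0 ups hps.
have X48 : (0 < 48 * X)%N by rewrite muln_gt0.
have card48 : (0 < #|'I_(48 * X)|)%N by rewrite card_ord.
have [i0 Tmax] := @mathcomp.boot.bigop.eq_bigmax _ (fun i : 'I_(48 * X) => tau i.+1) card48.
set T := (\max_(i < 48 * X) tau i.+1)%N in Tmax.
have tauT N : (0 < N <= 48 * X)%N -> (tau N <= T)%N.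
  move=> /andP[N0 NX]; have NX' : (N.-1 < 48 * X)%N by rewrite prednK.
  by have := @mathcomp.boot.bigop.leq_bigmax _ (fun i : 'I_(48 * X) => tau i.+1) (Ordinal NX'); rewrite /= prednK.
have TC : (T ^ (2 * k) <= C * (48 * X))%N.
  rewrite Tmax; apply: leq_trans (hC i0.+1 isT) _; rewrite leq_mul2l; apply/orP; right; exact: ltn_ord.
have T0 : (0 < T)%N by apply: leq_trans (tauT 1%N _).
have [h hh] := @ex_choice_seq _ _ (0%N, 0%N, (0, 0)) (rank_code m) ps
   (fun p pp => let: And3 a b c := hps p pp in rank_codeP a c).
pose f p : nat * nat := ((h p).1.1, (h p).1.2 %/ m)%N.
have sz : (size ps <= (26 * T ^ 2) * (3 * (4 * X %/ m)))%N.
  have := @size_fibers _ _ f ps [seq (D, i) | D <- [:: 0; 1; 3]%N, i <- iota 1 (4 * X %/ m)] (26 * T ^ 2).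
  rewrite size_allpairs size_iota; apply.
    move=> p pp; apply/allpairsP; exists (f p); rewrite /f; have [p4 pX _] := hps p pp.
    have := hh p pp; case: (h p) => -[D N] P /= [hD /andP[N0 N4] mN _]; split=> //.
    rewrite mem_iota add1n ltnS divn_gt0 // (dvdn_leq N0 mN) leq_div2r //.
    by apply: leq_trans N4 _; rewrite leq_mul2l.
  move=> [D i] _; set t := [seq x <- ps | _].
  have tP p : p \in t -> [/\ D \in [:: 0; 1; 3]%N, (0 < i * m <= 4 * X)%N &
      if D == 0%N then (i * m)%N = p.+1
      else (i * m)%N%:Z + 1 = p%:Z + (h p).2.2 /\ repr D (4 * D * (i * m)) (h p).2].
    rewrite mem_filter => /andP[/eqP[eD ei] pp]; have [p4 pX _] := hps p pp.
    have := hh p pp; rewrite -ei -eD; case: (h p) => -[D' N'] P /= [hD /andP[N0 N4] mN].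
    rewrite divnK // => hN; split=> //; rewrite N0; apply: leq_trans N4 _.
    by rewrite leq_mul2l.
  have ut : uniq t by rewrite filter_uniq.
  case et : t => [//|p0 t']; rewrite -et.
  have t0 : p0 \in t by rewrite et mem_head.
  have [hD N0 c0] := tP p0 t0.
  have [D0|D0] := eqVneq D 0%N.
    have : (size t <= size [:: p0])%N.
      apply: uniq_leq_size => // p pt; rewrite inE.
      have [_ _] := tP p pt; by move: c0; rewrite D0 /= => -> [->].
    by move=> /leq_trans; apply; rewrite !muln_gt0 ?expn_gt0 T0.
  rewrite -(size_map (fun p => (h p).2)).
  have D13 : D = 1%N \/ D = 3%N by move: hD D0; rewrite !inE => /or3P[]/eqP->; [|left|right].
  have N4 : (0 < 4 * D * (i * m) <= 48 * X)%N.
    by move: N0; clear -D13; case: D13 => ->; move: (i * m)%N => y; lia.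
  apply: leq_trans (_ : 26 * tau (4 * D * (i * m)) ^ 2 <= _)%N; last first.
    by rewrite leq_mul2l leq_exp2r // tauT.
  apply: (repr_count D13); first by case/andP: N4.
    rewrite map_inj_in_uniq // => p q pt qt eP.
    have [_ _] := tP p pt; have [_ _] := tP q qt; rewrite (negPf D0) eP => -[e1 _] [e2 _].
    by move: e1 e2; clear; lia.
  by move=> _ /mapP[p pt ->]; have [_ _] := tP p pt; rewrite (negPf D0) => -[].
have szm : (size ps * m <= 12 * 26 * T ^ 2 * X)%N.
  apply: leq_trans (leq_mul sz (leqnn m)) _.
  have : (4 * X %/ m * m <= 4 * X)%N by exact: leq_divM.
  move: (4 * X %/ m)%N => y; nia.
apply: (@leq_trans ((12 * 26 * T ^ 2 * X) ^ k)); first by rewrite leq_exp2r.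
rewrite expnMn (expnMn (12 * 26)) -expnM expnSr mulnA [X in (_ <= X)%N]mulnAC.
by rewrite leq_mul // -[X in (_ <= X)%N]mulnA leq_mul // -mulnA.
Qed.

(** * The greatest prime factor *)

Lemma ex_max_seq (U : eqType) (f : U -> nat) (Pr : nat -> Prop) (t : seq U) : Pr 0%N ->
  (forall u, u \in t -> Pr (f u)) -> exists2 c, Pr c & forall u, u \in t -> (f u <= c)%N.
Proof.
move=> P0; elim: t => [|u t IH] ht; first by exists 0%N.
have [c Pc hc] := IH (fun v vt => ht v (mem_behead (s := u :: t) vt)).
exists (maxn (f u) c) => [|v]; first by case: leqP => // _; exact: ht (mem_head _ _).
by rewrite inE leq_max => /orP[/eqP->|/hc ->]; rewrite ?leqnn ?orbT.
Qed.

Lemma ln_prod_le (U : eqType) (s : seq U) (F : U -> nat) (b : R) :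
  (forall u, u \in s -> (0 < F u)%N /\ Rle (ln (INR (F u))) b) ->
  (0 < \prod_(u <- s) F u)%N /\ Rle (ln (INR (\prod_(u <- s) F u)%N)) (INR (size s) * b)%coqR.
Proof.
elim: s => [|u s IH] hs; first by rewrite big_nil /= ln_1; split=> //; lra.
have [s0 sb] := IH (fun v vs => hs v (mem_behead (s := u :: s) vs)).
have [u0 ub] := hs u (mem_head _ _).
rewrite big_cons muln_gt0 u0 s0 lnN_M // [size _]/= S_INR; split=> //; lra.
Qed.

Section Assembly.
Variables A B : int.
Hypothesis disc : 4%:R * A ^+ 3 + 27%:R * B ^+ 2 != 0.
Hypothesis AB : (A == 0) || (B == 0).
Local Notation aQ := (A%:~R : rat).
Local Notation bQ := (B%:~R : rat).
Variable Q : ec_point.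
Hypothesis cQ : wcurve aQ bQ Q.
Hypothesis infinite_order : forall n, (0 < n)%N -> wmul aQ n Q != None.
Variable d : nat -> nat.
Hypothesis d_denom : forall n, (0 < n)%N -> is_ell_denom (wmul aQ n Q) (d n).

Lemma d_gt0 n : (0 < n)%N -> (0 < d n)%N.
Proof. by move/d_denom; case: wmul => // -[x y] []. Qed.

Lemma denom_growth : ABC_conjecture ->
  (exists2 K, Rlt 0 K & forall n, (0 < n)%N -> Rle (ln (INR (d n))) (Rmult K (pow (INR n) 2))) /\
  (exists2 c, Rlt 0 c & exists n0, forall n, (n0 <= n)%N -> Rle (Rmult c (pow (INR n) 2)) (ln (INR (rad (d n))))).
Proof.
move=> abc; have [[K hK] [c c0 [n0 hc]]] := height_growth disc cQ infinite_order.
split.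
  exists (Rabs K + 1)%coqR => [|n n1]; first by have := Rabs_pos K; lra.
  have hKn := hK n n1; have := d_denom n1; have := wmul_curve cQ n.
  case e : (wmul aQ n Q) hKn => [[x y]|] //= hKn cxy dxy.
  have [d0 [a [b [_ _ hx _]]]] := ell_denom_eqn cxy dxy.
  have : (d n ^ 2 <= height x)%N by rewrite hx leq_maxr.
  move/(lnN_le _); rewrite lnN_X // expn_gt0 d0 => /(_ isT) h1.
  have := lnN_ge0 d0; have := Rle_abs K; have := pow2_ge_0 (INR n).
  move: hKn h1; rewrite /=; move: (ln (INR (d n))) (ln (INR (height x))) (INR n) => u v w.
  move=> h2 h1 h3 h4 h5.
  have : Rle (K * (w * (w * 1))) (Rabs K * (w * (w * 1)))%coqR by apply: Rmult_le_compat_r.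
  nra.
have [C hC] := ABC_rad_lower abc disc AB.
(* From [c n ^ 2 <= C + 8 ln (rad (d n))], where [C] is at most [c / 2 n ^ 2] for large [n]. *)
exists (c / 16)%coqR; first by lra.
have c2 : Rlt 0 (c / 2)%coqR by lra.
have [n1 hn1] := INR_archimed (c / 2) C c2.
exists (n0 + (n1 + 1))%N => n hn.
have nn0 : (n0 <= n)%N by apply: leq_trans hn; rewrite leq_addr.
have nn1 : (n1 + 1 <= n)%N by apply: leq_trans hn; rewrite leq_addl.
have n_gt0 : (0 < n)%N by apply: leq_trans nn1; rewrite addn1.
have := hc n nn0; have := d_denom n_gt0; have := wmul_curve cQ n.
case e : (wmul aQ n Q) => [[x y]|] //= cxy dxy h1.
have h2 := hC x y (d n) cxy dxy.
have n1n : Rle (INR n1) (INR n) by apply: INR_leq; apply: leq_trans nn1; rewrite leq_addr.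
have n1' : Rle 1 (INR n) by exact: (@INR_leq 1).
move: h1 h2 hn1 n1n n1' c0; move: (ln (INR (height x))) (ln (INR (rad (d n)))) (INR n) (INR n1) => u v w z.
move=> h1 h2 h3 h4 h5 h6; have h7 : Rle z (w * (w * 1))%coqR by nra.
nra.
Qed.

(** Besides 2 and the divisors of the discriminant, 3 is excluded because [norm_bound] asks for
    [p > 4]. *)
Definition bad_primes : seq nat := [:: 2; 3]%N ++ primes `|(4%:R * A ^+ 3 + 27%:R * B ^+ 2)%R|.

Lemma good_prime_rank p n : prime p -> p \notin bad_primes -> (0 < n)%N -> (p %| d n)%N ->
  (4 < p)%N /\ exists m, [/\ (0 < m)%N, (m %| n)%N, (p %| d m)%N & rank_cond m p].
Proof.
move=> pp; rewrite /bad_primes mem_cat !inE !negb_or => /andP[/andP[p2 p3] pd] n0 pn.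
have p4 : (4 < p)%N.
  by move: p pp p2 p3 {pd pn} => [|[|[|[|[|p]]]]].
split=> //; have pd' : ~~ (p %| `|(4%:R * A ^+ 3 + 27%:R * B ^+ 2)%R|)%N.
  by apply: contra pd => h; rewrite mem_primes pp h absz_gt0 disc.
exact: (prime_divisor_rank pp p2 pd' cQ infinite_order AB d_denom n0 pn).
Qed.

Lemma main_estimate : ABC_conjecture -> forall k, (0 < k)%N -> exists Z n0, forall n, (n0 <= n)%N ->
  Rle ((3 * INR k - 1) * ln (INR n))%coqR (Z + (INR k + 2) * ln (INR (max_pdiv (d n))))%coqR.
Proof.
move=> abc k k0; have [[K K0 hK] [c c0 [n0 hc]]] := denom_growth abc.
have [C1 hC1] := rank_count k0; have k20 : (0 < 2 * k)%N by rewrite muln_gt0.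
have [C2 hC2] := tau_bound k20.
(* With this [Lam], the ranks below [n / (Lam * tau n)] contribute at most [tau n * K n ^ 2 / (Lam *
   tau n) ^ 2 <= c / 4 n ^ 2]. The bad primes get another [c / 4], and [c / 2] is left for the
   others. *)
have [Lam0 hLam0] := INR_archimed c (4 * K) c0.
pose Lam := Lam0.+1; have hLam : Rle (4 * K) (INR Lam * c)%coqR.
  by rewrite /Lam S_INR; lra.
pose Bd := (\prod_(p <- bad_primes) p)%N.
have bad0 : all (leq 1) bad_primes by rewrite all_cat primes_ge1.
have Bd0 : (0 < Bd)%N by rewrite /Bd big_seq prodn_cond_gt0 // => p /(allP bad0).
have c4 : Rlt 0 (c / 4)%coqR by lra.
have [n1 hn1] := INR_archimed (c / 4) (ln (INR Bd)) c4.
pose W := (C1 * Lam ^ k * C2).+1.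
exists (ln (INR W) + INR k * ln (INR k) - INR k * ln (c / 2))%coqR, (n0 + (n1 + 1))%N => n hn.
have nn0 : (n0 <= n)%N by apply: leq_trans hn; rewrite leq_addr.
have nn1 : (n1 + 1 <= n)%N by apply: leq_trans hn; rewrite leq_addl.
have n_gt0 : (0 < n)%N by apply: leq_trans nn1; rewrite addn1.
have n1n : Rle (INR n1) (INR n) by apply: INR_leq; apply: leq_trans nn1; rewrite leq_addr.
have nR1 : Rle 1 (INR n) by exact: (@INR_leq 1).
set X := max_pdiv (d n); have X0 : (0 < X)%N by exact: max_pdiv_gt0.
have dn0 := d_gt0 n_gt0.
pose t := tau n; pose L := (Lam * t)%N.
have t0 : (0 < t)%N by rewrite lt0n size_eq0; apply: contraTneq (divisors_id n_gt0) => ->.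
have L0 : (0 < L)%N by rewrite muln_gt0.
(* All divisors [m] of [n] with [p %| d m] are tested, so a prime kept in [sl] has [m * L >= n] for
   whichever rank [mu] selects. *)
pose smallp p := has (fun m => (m * L < n)%N && (p %| d m)%N) (divisors n).
pose sl := [seq p <- primes (d n) | (p \notin bad_primes) && ~~ smallp p].
pose sm := [seq m <- divisors n | (m * L < n)%N].
have slP p : p \in sl -> [/\ prime p, p \notin bad_primes, ~~ smallp p, (p %| d n)%N & (p <= X)%N].
  rewrite mem_filter => /andP[/andP[p1 p2] p3]; split=> //; try by move: p3; rewrite mem_primes => /and3P[].
  exact: max_pdiv_max.
have smP m : m \in sm -> (0 < d m)%N /\ Rle (ln (INR (d m))) (K * INR n ^ 2 / INR L ^ 2)%coqR.
  rewrite mem_filter -dvdn_divisors // => /andP[mL mn]; have m0 := dvdn_gt0 n_gt0 mn.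
  split; first exact: d_gt0.
  apply: Rle_trans (hK m m0) _; apply: scaled_square_le => //; [exact: INR_gt0 | exact: pos_INR |].
  by rewrite -mult_INR; apply: INR_leq; exact: ltnW.
have n2_ge0 : Rle 0 (INR n ^ 2)%coqR by exact: pow2_ge_0.
have small_total : Rle (INR (size sm) * (K * INR n ^ 2 / INR L ^ 2)) (c / 4 * INR n ^ 2)%coqR.
  rewrite mult_INR; apply: small_total_le => //; [exact: pos_INR | | |].
  - by apply: INR_leq; rewrite size_filter count_size.
  - exact: (@INR_leq 1).
  - exact: (@INR_leq 1).
have total : Rle (c / 2 * INR n ^ 2) (INR (size sl) * ln (INR X))%coqR.
  have prod_le : (rad (d n) <= Bd * (\prod_(m <- sm) d m * \prod_(p <- sl) p))%N.
    apply: (@leq_trans (\prod_(p <- bad_primes ++ (flatten [seq primes (d m) | m <- sm] ++ sl)) p)%N).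
      apply: leq_prod_sub; first exact: primes_uniq.
        move=> p pn; rewrite mem_cat (mem_cat p (flatten _)).
        case: (boolP (p \in bad_primes)) => [//|pb]; rewrite orFb.
        have [/hasP[m mn /andP[mL pm]]|ps] := boolP (smallp p).
          apply/orP; left; apply/flatten_mapP; exists m; first by rewrite mem_filter mL.
          rewrite mem_primes pm andbT d_gt0 ?andbT; first by move: pn; rewrite mem_primes => /andP[].
          by move: mn; rewrite -dvdn_divisors //; exact: dvdn_gt0.
        by rewrite mem_filter pb ps pn orbT.
      rewrite all_cat bad0 all_cat /=; apply/andP; split; apply/allP => p.
        by move=> /flatten_mapP[m _]; exact/allP/primes_ge1.
      by rewrite mem_filter => /andP[_]; exact/allP/primes_ge1.
    rewrite big_cat -/Bd leq_mul // big_cat leq_mul // big_flatten big_map.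
    rewrite big_seq [X in (_ <= X)%N]big_seq; apply: leq_prod => m /smP[dm _].
    exact: rad_leq dm.
  have [P0 Ple] := ln_prod_le smP.
  have [S0 Sle] := @ln_prod_le _ sl id (ln (INR X)) (fun p pp =>
    let: And5 a _ _ _ b := slP p pp in conj (prime_gt0 a) (lnN_le (prime_gt0 a) b)).
  have h2 := lnN_le (rad_gt0 _) prod_le; rewrite !lnN_M ?muln_gt0 ?Bd0 ?P0 // in h2.
  have h5 : Rle (ln (INR Bd)) (c / 4 * INR n ^ 2)%coqR.
    have := Rmult_le_compat_r _ _ _ (Rlt_le _ _ c4) (Rle_trans _ _ _ n1n (le_square nR1)).
    move: hn1; rewrite ![Rmult _ (c / 4)%coqR]Rmult_comm => u v.
    exact: Rle_trans (Rlt_le _ _ u) v.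
  exact: (total_combine (hc n nn0) h2 Ple small_total h5 Sle).
have n2_gt0 : Rlt 0 (c / 2 * INR n ^ 2)%coqR.
  by have := le_square nR1 => hsq; apply: Rmult_lt_0_compat; lra.
have S0 : (0 < size sl)%N.
  by rewrite lt0n; apply/eqP => e; move: total; rewrite e /=; lra.
have lnX0 : Rlt 0 (ln (INR X)).
  have [//|e] := Rle_lt_or_eq_dec _ _ (lnN_ge0 X0).
  by move: total; rewrite -e; lra.
have [mu hmu] := @ex_choice_seq _ _ 0%N (fun p m => [/\ (m %| n)%N, (p %| d m)%N & rank_cond m p]) sl
  (fun p pp => let: And5 a b _ e _ := slP p pp in let: conj _ (ex_intro m (And4 _ f g h)) :=
     good_prime_rank a b n_gt0 e in ex_intro _ m (And3 f g h)).
have fiber m : m \in divisors n ->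
    ((size [seq p <- sl | mu p == m] * n) ^ k <= C1 * L ^ k * X ^ k.+1)%N.
  rewrite -dvdn_divisors // => mn; have m0 := dvdn_gt0 n_gt0 mn; set ps := [seq p <- _ | _].
  have psP p : p \in ps -> p \in sl /\ mu p = m by rewrite mem_filter => /andP[/eqP].
  case e : ps => [|p0 ps']; first by rewrite mul0n exp0n.
  rewrite -e; have mL : (n <= m * L)%N.
    have [p0l ep] : p0 \in sl /\ mu p0 = m by apply: psP; rewrite e mem_head.
    have [_ _ /hasPn ns _ _] := slP p0 p0l; have [_ pd _] := hmu p0 p0l.
    have := ns m; rewrite -dvdn_divisors // mn => /(_ isT).
    by rewrite -ep pd andbT -leqNgt.
  apply: (@leq_trans ((size ps * m) ^ k * L ^ k)%N).
    by rewrite -expnMn leq_exp2r // -mulnA leq_mul2l mL orbT.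
  rewrite mulnAC leq_mul2r; apply/orP; right; apply: hC1 => //.
    by rewrite !filter_uniq // primes_uniq.
  move=> p /psP[pl ep]; have [pp pb _ pd pX] := slP p pl.
  have [p4 _] := good_prime_rank pp pb n_gt0 pd; split=> //.
  by have [_ _] := hmu p pl; rewrite ep.
have Pr0 : ((0 * n) ^ k <= C1 * L ^ k * X ^ k.+1)%N by rewrite mul0n exp0n.
(* [cm] bounds all the fibres of [mu] and, being the size of one of them or 0, still satisfies their
   inequality. *)
have [cm hcm fle] := @ex_max_seq _ (fun m => size [seq p <- sl | mu p == m]) (fun z => (z * n) ^ k <= C1 * L ^ k * X ^ k.+1)%N
   (divisors n) Pr0 fiber.
have Sle : (size sl <= cm * t)%N.
  apply: (size_fibers (f := mu)) => // p pl; rewrite -dvdn_divisors //.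
  by have [] := hmu p pl.
have count : ((size sl * n) ^ k <= W * n * X ^ k.+1)%N.
  apply: (@leq_trans ((t * (cm * n)) ^ k)).
    by rewrite leq_exp2r // mulnA (mulnC t) leq_mul2r Sle orbT.
  rewrite expnMn; apply: leq_trans (leq_mul (leqnn _) hcm) _.
  rewrite mulnA leq_mul2r; apply/orP; right.
  apply: (@leq_trans (C1 * Lam ^ k * C2 * n)); last by rewrite leq_mul2r leqnSn orbT.
  (* One factor [t ^ k] comes from the number of ranks, the other from [L]; [tau_bound] for [2 * k]
     turns their product into a multiple of [n]. *)
  have -> : (t ^ k * (C1 * L ^ k) = C1 * Lam ^ k * t ^ (2 * k))%N.
    by rewrite expnMn mul2n -addnn expnD; ring.
  by rewrite -[X in (_ <= X)%N]mulnA leq_mul2l hC2 // orbT.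
apply: (@final_estimate (INR k) (c / 2) (INR n) (INR (size sl)) (INR X) (ln (INR W))) => //.
- exact: (@INR_leq 1).
- by lra.
- exact: INR_gt0.
have Sn0 : (0 < size sl * n)%N by rewrite muln_gt0 S0.
have := lnN_le _ count; rewrite expn_gt0 Sn0 => /(_ isT).
rewrite lnN_X // !lnN_M ?lnN_X ?expn_gt0 ?muln_gt0 ?X0 // S_INR; lra.
Qed.
End Assembly.

Theorem mainTheorem4 :
  ABC_conjecture ->
  forall (A B : int),
    4%:~R * A ^+ 3 + 27%:~R * B ^+ 2 != (0 : int) ->
    (A == 0) || (B == 0) ->
  forall Q : ec_point,
    on_curve A B Q ->
    (forall n : nat, (0 < n)%N -> ec_mul A n Q != None) ->
  forall d : nat -> nat,
    (forall n : nat, (0 < n)%N -> is_ell_denom (ec_mul A n Q) (d n)) ->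
  forall eps : R, Rlt 0 eps ->
  exists c : R, Rlt 0 c /\
    forall n : nat, (0 < n)%N ->
      Rle (Rmult c (Rpower (INR n) (Rminus 3 eps))) (INR (max_pdiv (d n))).
Proof.
move=> abc A B disc AB Q cQ infQ d hd eps eps0.
rewrite -!pmulrn in disc.
have [k0 hk0] := INR_archimed eps 7 eps0.
have hk : Rle 7 (eps * INR k0.+1)%coqR by rewrite S_INR; lra.
have [Z [n0 hZ]] := main_estimate disc AB cQ infQ hd abc (ltn0Sn k0).
set U := ln (INR n0.+1); have U0 : Rle 0 U by exact: lnN_ge0.
have Z0 := Rabs_pos Z.
(* The term [3 * U] covers [n < n0], where [(3 - eps) * ln n <= 3 * U] and [ln X >= 0]. *)
exists (exp (- (Rabs Z + 3 * U)))%coqR; split; first exact: exp_pos.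
move=> n n_gt0; set X := max_pdiv (d n); have X0 : (0 < X)%N by exact: max_pdiv_gt0.
have x0 := lnN_ge0 n_gt0; have y0 := lnN_ge0 X0.
have lower : Rle ((3 - eps) * ln (INR n) - (Rabs Z + 3 * U))%coqR (ln (INR X)).
  have [n0n|nn0] := leqP n0 n.
    have k1 : Rle 1 (INR k0.+1) by exact: (@INR_leq 1).
    by have := final_exponent k1 eps0 hk x0 (hZ n n0n); rewrite -/X; lra.
  have : Rle (ln (INR n)) U by apply: lnN_le => //; exact: leqW (ltnW nn0).
  by nra.
rewrite /Rpower -exp_plus -[X in Rle _ X]exp_ln; last exact: INR_gt0.
have [h|e] := lower; [left; apply: exp_increasing | right; congr exp]; lra.
Qed.
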